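(* Let $\mathcal X$ be a lattice variety belonging to $\mathbf B_{23}$, the sublattice of the lattice of all lattice varieties generated by the twenty-three varieties $\mathcal L_i^{m}$ ($1\le i\le 15$) and $\mathcal V_j^{m}$ ($1\le j\le 8$) defined in the context. (i) If the color of $\mathcal X$ is $3$, $4$, or $6$, then the atom spectrum $\mathrm{AS}(\mathcal X)$ is $\{1,2,3\}$, $\{1,2,3,4\}$, and $\{1,2,3,4,6\}$, respectively. (ii) If $\mathcal X$ belongs to one of the following intervals of the lattice of all lattice varieties, then its double spectrum is as follows: - if $\mathcal X\in[\mathcal N_5^{m},\mathcal B]$, then $\mathrm{DS}(\mathcal X)=\delta(3)$; - if $\mathcal X\in[\mathcal V_6^{m},\mathcal V_6^{m}\vee\mathcal B]$ or $\mathcal X\in[\mathcal V_7^{m},\mathcal V_7^{m}\vee\mathcal B]$, then $\mathrm{DS}(\mathcal X)=\delta(3)$; - if $\mathcal X\in[\mathcal L_1^{m},\mathcal L_1^{m}\vee\mathcal B]$ or $\mathcal X\in[\mathcal L_2^{m},\mathcal L_2^{m}\vee\mathcal B]$, then $\mathrm{DS}(\mathcal X)=\delta(3)$; - if $\mathcal X\in[\mathcal L_3^{m},\mathcal L_3^{m}\vee\mathcal B]$, then $\mathrm{DS}(\mathcal X)=\delta(4)$; - if $\mathcal X\in[\mathcal L_4^{m},\mathcal L_4^{m}\vee\mathcal B]$, then $\mathrm{DS}(\mathcal X)=\delta(6)$; - if $\mathcal X\in[\mathcal L_5^{m},\mathcal L_5^{m}\vee\mathcal B]$, then $\mathrm{DS}(\mathcal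 X)=\delta(6)^{-1}$. Here $\delta(3)=\{(1,1),(1,2),(2,1),(2,2),(2,3),(3,2),(3,3)\}$, $\delta(4)=\delta(3)\cup\{(4,3),(3,4),(4,2),(2,4)\}$, $\delta(6)=\delta(3)\cup\{(4,2),(4,3),(6,3)\}$, $\delta(6)^{-1}=\delta(3)\cup\{(2,4),(3,4),(3,6)\}$.
   Context: **Spectra.** A lattice is three-generated if it has a three-element generating set. $\mathrm{At}(L)$ and $\mathrm{Ct}(L)$ denote the sets of atoms and of coatoms of a lattice $L$. For a lattice variety $\mathcal V$: $\mathrm{AS}(\mathcal V)=\{|\mathrm{At}(L)| : L\in\mathcal V \text{ three-generated}\}$ and $\mathrm{DS}(\mathcal V)=\{(|\mathrm{At}(L)|,|\mathrm{Ct}(L)|): L\in\mathcal V\text{ three-generated}\}$. **Varieties.** Lattice varieties are ordered by inclusion and form a lattice, in which joins $\vee$ and intervals are taken. $\mathcal M$ is the variety of modular lattices, $\mathbf{HSP}X$ is the variety generated by $X$, and for a lattice variety $\mathcal Z$ we put $\mathcal Z^{m}:=\mathcal Z\vee\mathcal M$. $N_5$ is the five-element nonmodular lattice, $\mathcal N_5=\mathbf{HSP}\{N_5\}$, $\mathcal L_i=\mathbf{HSP}\{L_i\}$ ($1\le i\le 15$), $\mathcal V_j=\mathbf{HSP}\{V_j\}$ ($1\le j\le 8$), where $L_i$, $V_j$ are the finite subdirectly irreducible lattices below (each given by its covering relation $\prec$; ''$x\prec y,z$'' abbreviates $x\prec y$ and $x\prec z$, and ''$x,y\prec z$'' abbreviates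 $x\prec z$ and $y\prec z$). *The lattices $L_i$* (McKenzie's list): - $L_1=\{0,a,b,c,p,q,1\}$: $0\prec a,b,c$; $a,b\prec p$; $b,c\prec q$; $p,q\prec1$. - $L_2$ is the dual of $L_1$. - $L_3=\{0,e,a,p,b,c,1\}$: $0\prec e\prec a\prec p\prec 1$; $e\prec c\prec 1$; $0\prec b\prec p$. - $L_4=\{0,a,b,c,d,1\}$: $0\prec a,b,c$; $a,b\prec d\prec1$; $c\prec 1$. - $L_5$ is the dual of $L_4$. - By a theorem of Jónsson and Rival, $\mathcal N_5$ has exactly fifteen covers in the lattice of all lattice varieties that are join-irreducible in that lattice; each is generated by a finite subdirectly irreducible lattice, unique up to isomorphism. Five of them are $\mathcal L_1,\dots,\mathcal L_5$; $L_6,\dots,L_{15}$ are the finite subdirectly irreducible lattices generating the other ten (their order is irrelevant here). *The lattices $V_j$* (Ruckelshausen's list): - $V_6=\{0,r,w,u,x,y,z,v,1\}$: $0\prec r,u$; $r\prec w,x$; $w\prec 1$; $u\prec x,y,z$; $x,y,z\prec v\prec 1$. - $V_7$ is the dual of $V_6$. - $V_1,\dots,V_5,V_8$ are the following six lattices (their order is irrelevant here): (1) $\{0,a,a',b,c,1\}$ with $0\prec a\prec a'\prec 1$, $0\prec b\prec 1$, $0\prec c\prec1$; (2) $\{0,w,u,x,y,z,v,1\}$ with $0\prec w\prec1$, $0\prec u\prec x,y,z$ and $x,y,z\prec v\prec 1$; (3) $\{u,o,d,e,c,a,b,i\}$ with $u\prec o,d,e$; $o,d,e\prec c\prec i$;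 $o\prec a\prec b\prec i$; (4) the dual of (3); (5) $\{u,o,d,e,a,b,c,i\}$ with $u\prec o,d,e$; $o,d,e\prec a\prec b\prec i$; $o\prec c\prec i$; (6) the dual of (5). **Joins and colors.** Put $\mathcal B=\mathcal V_8^{m}\vee\bigvee_{i=6}^{15}\mathcal L_i^{m}\vee\bigvee_{j=1}^{5}\mathcal V_j^{m}$, $\mathcal B'=\mathcal B\vee\mathcal L_2^{m}\vee\mathcal V_7^{m}$, $\mathcal H_3^{m}=\mathcal L_1^{m}\vee\mathcal L_5^{m}\vee\mathcal V_6^{m}$, $\mathcal H_6^{m}=\mathcal H_3^{m}\vee\mathcal L_3^{m}\vee\mathcal L_4^{m}$. $\mathbf B_{23}$ is a $2^{23}$-element Boolean lattice with bottom $\mathcal N_5^{m}$ whose atoms are the twenty-three generating varieties; it is an interval in the lattice of all lattice varieties and it is the disjoint union of four intervals (layers). The color of $\mathcal X\in\mathbf B_{23}$ is: $3$ if $\mathcal X\in[\mathcal N_5^{m},\mathcal H_3^{m}\vee\mathcal B']$; $4$ if $\mathcal X\in[\mathcal L_3^{m},\mathcal H_3^{m}\vee\mathcal L_3^{m}\vee\mathcal B']$; $6$ if $\mathcal X\in[\mathcal L_4^{m},\mathcal H_3^{m}\vee\mathcal L_4^{m}\vee\mathcal B']$ or $\mathcal X\in[\mathcal L_3^{m}\vee\mathcal L_4^{m},\mathcal H_6^{m}\vee\mathcal B']$. *)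

(* Defs.v *)
From HB Require Import structures.
From Stdlib Require List.
From mathcomp Require Import all_boot all_order.
From mathcomp Require Import boolp classical_sets functions cardinality.

Set Implicit Arguments.
Unset Strict Implicit.
Unset Printing Implicit Defensive.

Import Order.TTheory.

Local Open Scope classical_set_scope.

(* The display is fixed so that there is a single type of lattices. It is its
   own dual up to conversion, so that [L^d] is again a [lattice]. The carrier may
   be empty, which has no influence on the nonempty members of a variety. *)
Notation lattice := (latticeType (Order.Disp tt tt)).

(* [set lattice] would be a universe inconsistency, since every [set T] is
   itself a lattice. *)
Definition lattice_class := lattice -> Prop.

(* Giving the display explicitly matters: otherwise [L^d : lattice] elaborates
   to [L] itself. *)
Definition dual_lattice (L : lattice) : lattice :=
  (L^d : latticeType (Order.dual_display (Order.Disp tt tt))).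

Fact dual_latticeE (L : lattice) (x y : L) :
  ((x : dual_lattice L) <= (y : dual_lattice L))%O = (y <= x)%O.
Proof. by []. Qed.

Implicit Types (L : lattice) (X Y Z W : lattice_class).

Definition subclass X Y : Prop := forall L, X L -> Y L.
Definition psubclass X Y : Prop := subclass X Y /\ ~ subclass Y X.
Definition eqclass X Y : Prop := forall L, X L <-> Y L.

Definition prod_lattice (I : Type) (A : I -> lattice) : Type := forall i, A i.

Section ProdLattice.
Variables (I : Type) (A : I -> lattice).
Local Notation T := (prod_lattice A).

HB.instance Definition _ := Choice.copy T (forall i, A i : choiceType).

Definition prod_le (x y : T) : bool := `[< forall i, (x i <= y i)%O >].
Definition prod_meet (x y : T) : T := fun i => Order.meet (x i) (y i).
Definition prod_join (x y : T) : T := fun i => Order.join (x i) (y i).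

Fact prod_le_refl : reflexive prod_le.
Proof. by move=> x; apply/asboolP. Qed.

Fact prod_le_anti : antisymmetric prod_le.
Proof.
move=> x y /andP[/asboolP xy /asboolP yx]; apply: functional_extensionality_dep.
by move=> i; apply/eqP; rewrite eq_le xy yx.
Qed.

Fact prod_le_trans : transitive prod_le.
Proof.
move=> y x z /asboolP xy /asboolP yz; apply/asboolP => i.
exact: le_trans (xy i) (yz i).
Qed.

HB.instance Definition _ :=
  Order.Le_isPOrder.Build (Order.Disp tt tt) T
    prod_le_refl prod_le_anti prod_le_trans.

Fact prod_meetP (x y z : T) :
  (x <= prod_meet y z)%O = (x <= y)%O && (x <= z)%O.
Proof.
apply/asboolP/andP => [h|[/asboolP h1 /asboolP h2] i]; last by rewrite lexI h1 h2.
by split; apply/asboolP => i; have := h i; rewrite lexI => /andP[].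
Qed.

Fact prod_joinP (x y z : T) :
  (prod_join x y <= z)%O = (x <= z)%O && (y <= z)%O.
Proof.
apply/asboolP/andP => [h|[/asboolP h1 /asboolP h2] i]; last by rewrite leUx h1 h2.
by split; apply/asboolP => i; have := h i; rewrite leUx => /andP[].
Qed.

HB.instance Definition _ :=
  Order.POrder_MeetJoin_isLattice.Build (Order.Disp tt tt) T
    prod_meetP prod_joinP.

End ProdLattice.

Definition classH X : lattice_class := fun L =>
  exists S : lattice, X S /\
  exists f : {lmorphism S -> L}, forall y, exists x, f x = y.

Definition classS X : lattice_class := fun L =>
  exists S : lattice, X S /\
  exists f : {lmorphism L -> S}, injective f.

Definition classP X : lattice_class := fun L =>
  exists (I : Type) (A : I -> lattice), (forall i, X (A i)) /\
  exists f : {lmorphism L -> prod_lattice A}, bijective f.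

Definition HSP X : lattice_class := classH (classS (classP X)).

Definition is_variety X : Prop :=
  [/\ subclass (classH X) X, subclass (classS X) X & subclass (classP X) X].

Definition vsup (I : Type) (F : I -> lattice_class) : lattice_class := fun L =>
  forall Z, is_variety Z -> (forall i, subclass (F i) Z) -> Z L.

Definition vjoin X Y : lattice_class := fun L =>
  forall Z, is_variety Z -> subclass X Z -> subclass Y Z -> Z L.

Definition vmeet X Y : lattice_class := fun L => X L /\ Y L.

Definition vinterval X Y Z : Prop :=
  [/\ is_variety Z, subclass X Z & subclass Z Y].

(* [vcovers X Y] : [Y] covers [X]. *)
Definition vcovers X Y : Prop :=
  [/\ is_variety X, is_variety Y, psubclass X Y &
      forall Z, is_variety Z -> psubclass X Z -> ~ psubclass Z Y].

Definition vjoin_irreducible X : Prop :=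
  forall Y Z, is_variety Y -> is_variety Z ->
  eqclass X (vjoin Y Z) -> eqclass X Y \/ eqclass X Z.

Inductive sublattice_gen (G : lattice_class -> Prop) : lattice_class -> Prop :=
| sublattice_incl X : G X -> sublattice_gen G X
| sublattice_join X Y :
    sublattice_gen G X -> sublattice_gen G Y -> sublattice_gen G (vjoin X Y)
| sublattice_meet X Y :
    sublattice_gen G X -> sublattice_gen G Y -> sublattice_gen G (vmeet X Y)
| sublattice_ext X Y :
    eqclass X Y -> sublattice_gen G X -> sublattice_gen G Y.

Definition modular : lattice_class := fun L =>
  forall x y z : L, (x <= z)%O ->
  Order.join x (Order.meet y z) = Order.meet (Order.join x y) z.

Definition congruence L (r : L -> L -> Prop) : Prop :=
  [/\ forall x, r x x,
      forall x y, r x y -> r y x,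
      forall x y z, r x y -> r y z -> r x z &
      forall x x' y y', r x x' -> r y y' ->
        r (Order.meet x y) (Order.meet x' y') /\
        r (Order.join x y) (Order.join x' y')].

Definition nontrivial L (r : L -> L -> Prop) : Prop :=
  exists x y, x <> y /\ r x y.

Definition subdirectly_irreducible L : Prop :=
  exists mu : L -> L -> Prop, [/\ congruence mu, nontrivial mu &
    forall r, congruence r -> nontrivial r -> forall x y, mu x y -> r x y].

Definition three_generated L : Prop :=
  exists a b c : L, [/\ a <> b, a <> c, b <> c &
    forall S : set L, S a -> S b -> S c ->
      (forall x y, S x -> S y -> S (Order.meet x y) /\ S (Order.join x y)) ->
      S = setT].

Definition covers L (x y : L) : Prop :=
  (x < y)%O /\ forall z : L, ~ ((x < z)%O /\ (z < y)%O).

Definition At L : set L :=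
  [set a | exists z : L, (forall x : L, (z <= x)%O) /\ covers z a].

Definition Ct L : set L :=
  [set a | exists u : L, (forall x : L, (x <= u)%O) /\ covers a u].

(* [None] stands for an infinite cardinality; three-generated lattices being
   countable, infinite cardinals need not be distinguished. *)
Definition has_card T (A : set T) (c : option nat) : Prop :=
  if c is Some n then (A #= `I_n)%card else infinite_set A.

Definition AS X : set (option nat) :=
  [set c | exists L : lattice,
     [/\ X L, three_generated L & has_card (@At L) c]].

Definition DS X : set (option nat * option nat) :=
  [set c | exists L : lattice,
     [/\ X L, three_generated L, has_card (@At L) c.1 & has_card (@Ct L) c.2]].

Definition spec1 (s : seq nat) : set (option nat) :=
  [set Some n | n in [set` s]].

Definition spec2 (s : seq (nat * nat)) : set (option nat * option nat) :=
  [set (Some p.1, Some p.2) | p in [set` s]].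

Definition delta3 : seq (nat * nat) :=
  [:: (1, 1); (1, 2); (2, 1); (2, 2); (2, 3); (3, 2); (3, 3)].
Definition delta4 := delta3 ++ [:: (4, 3); (3, 4); (4, 2); (2, 4)].
Definition delta6 := delta3 ++ [:: (4, 2); (4, 3); (6, 3)].
Definition delta6inv := delta3 ++ [:: (2, 4); (3, 4); (3, 6)].

(* A diagram on the elements 0, ..., n.-1 is the list whose i-th item
   lists the upper covers of i. *)
Section Hasse.
Variable c : seq (seq nat).
Local Notation elts := (iota 0 (size c)).

Fixpoint reach (k i j : nat) : bool :=
  (i == j) ||
  (if k is k'.+1 then has (fun i' => reach k' i' j) (nth [::] c i) else false).

Definition hasse_le (i j : nat) : bool := reach (size c) i j.

Fact hasse_le_refl i : hasse_le i i.
Proof. by rewrite /hasse_le; case: (size c) => [|n] /=; rewrite eqxx. Qed.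

Definition is_inf (i j k : nat) : bool :=
  all (fun l => hasse_le l k == hasse_le l i && hasse_le l j) elts.

Definition is_sup (i j k : nat) : bool :=
  all (fun l => hasse_le k l == hasse_le i l && hasse_le j l) elts.

Definition hasse_meet (i j : nat) : nat := find (is_inf i j) elts.
Definition hasse_join (i j : nat) : nat := find (is_sup i j) elts.

(* [hasse_le] is a lattice order whose covering relation is exactly [c]. *)
Definition lattice_diagram : bool :=
  [&& all (fun i => all (fun j =>
        hasse_le i j && hasse_le j i ==> (i == j)) elts) elts,
      all (fun i => all (fun j => all (fun k =>
        hasse_le i j && hasse_le j k ==> hasse_le i k) elts) elts) elts,
      all (fun i => all (fun j =>
        has (is_inf i j) elts && has (is_sup i j) elts) elts) elts,
      all (fun s => all (fun j => j < size c) s) c &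
      all (fun i => all (fun j =>
        (j \in nth [::] c i) ==
        [&& i != j, hasse_le i j &
            all (fun k => hasse_le i k && hasse_le k j ==> (k == i) || (k == j))
                elts]) elts) elts].

End Hasse.

Record diagram := Diagram {
  upper_covers :> seq (seq nat);
  diagramP : lattice_diagram upper_covers }.

Definition hasse_lattice (D : diagram) : Type := 'I_(size D).

Section HasseLattice.
Variable D : diagram.
Local Notation T := (hasse_lattice D).

HB.instance Definition _ := Finite.copy T 'I_(size D).

Definition hle (x y : T) : bool :=
  hasse_le D (nat_of_ord x) (nat_of_ord y).
Definition hmeet (x y : T) : T :=
  insubd x (hasse_meet D (nat_of_ord x) (nat_of_ord y)).
Definition hjoin (x y : T) : T :=
  insubd x (hasse_join D (nat_of_ord x) (nat_of_ord y)).

Let ord_in (x : T) : nat_of_ord x \in iota 0 (size D).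
Proof. by rewrite mem_iota /= add0n ltn_ord. Qed.

Fact hle_refl : reflexive hle.
Proof. by move=> x; exact: hasse_le_refl. Qed.

Fact hle_anti : antisymmetric hle.
Proof.
have /and5P[/allP h _ _ _ _] := diagramP D => x y xy; apply: val_inj.
by have /allP/(_ _ (ord_in y))/implyP/(_ xy)/eqP := h _ (ord_in x).
Qed.

Fact hle_trans : transitive hle.
Proof.
have /and5P[_ /allP h _ _ _] := diagramP D => y x z xy yz.
have /allP/(_ _ (ord_in y))/allP/(_ _ (ord_in z))/implyP := h _ (ord_in x).
by apply; apply/andP.
Qed.

HB.instance Definition _ :=
  Order.Le_isPOrder.Build (Order.Disp tt tt) T hle_refl hle_anti hle_trans.

Fact hmeetP (x y z : T) : (x <= hmeet y z)%O = (x <= y)%O && (x <= z)%O.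
Proof.
have /and5P[_ _ /allP h _ _] := diagramP D.
have /allP/(_ _ (ord_in z))/andP[hi _] := h _ (ord_in y).
have lt : hasse_meet D (nat_of_ord y) (nat_of_ord z) < size D.
  by rewrite /hasse_meet -[X in _ < X](size_iota 0) -has_find.
have /allP/(_ _ (ord_in x))/eqP := nth_find 0 hi.
by rewrite nth_iota // add0n -/(hasse_meet D _ _) /Order.le /= /hle val_insubd lt.
Qed.

Fact hjoinP (x y z : T) : (hjoin x y <= z)%O = (x <= z)%O && (y <= z)%O.
Proof.
have /and5P[_ _ /allP h _ _] := diagramP D.
have /allP/(_ _ (ord_in y))/andP[_ hs] := h _ (ord_in x).
have lt : hasse_join D (nat_of_ord x) (nat_of_ord y) < size D.
  by rewrite /hasse_join -[X in _ < X](size_iota 0) -has_find.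
have /allP/(_ _ (ord_in z))/eqP := nth_find 0 hs.
by rewrite nth_iota // add0n -/(hasse_join D _ _) /Order.le /= /hle val_insubd lt.
Qed.

HB.instance Definition _ :=
  Order.POrder_MeetJoin_isLattice.Build (Order.Disp tt tt) T hmeetP hjoinP.

End HasseLattice.

Definition N5 : lattice := hasse_lattice (@Diagram
  (let o := 0 in let a := 1 in let b := 2 in let c := 3 in let i := 4 in
   [:: (* o *) [:: a; c];
       (* a *) [:: b];
       (* b *) [:: i];
       (* c *) [:: i];
       (* i *) [::]]) isT).

Definition L1 : lattice := hasse_lattice (@Diagram
  (let o := 0 in let a := 1 in let b := 2 in let c := 3 in
   let p := 4 in let q := 5 in let i := 6 in
   [:: (* o *) [:: a; b; c];
       (* a *) [:: p];
       (* b *) [:: p; q];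
       (* c *) [:: q];
       (* p *) [:: i];
       (* q *) [:: i];
       (* i *) [::]]) isT).

Definition L2 : lattice := dual_lattice L1.

Definition L3 : lattice := hasse_lattice (@Diagram
  (let o := 0 in let e := 1 in let a := 2 in let p := 3 in
   let b := 4 in let c := 5 in let i := 6 in
   [:: (* o *) [:: e; b];
       (* e *) [:: a; c];
       (* a *) [:: p];
       (* p *) [:: i];
       (* b *) [:: p];
       (* c *) [:: i];
       (* i *) [::]]) isT).

Definition L4 : lattice := hasse_lattice (@Diagram
  (let o := 0 in let a := 1 in let b := 2 in let c := 3 in
   let d := 4 in let i := 5 in
   [:: (* o *) [:: a; b; c];
       (* a *) [:: d];
       (* b *) [:: d];
       (* c *) [:: i];
       (* d *) [:: i];
       (* i *) [::]]) isT).

Definition L5 : lattice := dual_lattice L4.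

Definition V1 : lattice := hasse_lattice (@Diagram
  (let o := 0 in let a := 1 in let a' := 2 in let b := 3 in
   let c := 4 in let i := 5 in
   [:: (* o *) [:: a; b; c];
       (* a *) [:: a'];
       (* a' *) [:: i];
       (* b *) [:: i];
       (* c *) [:: i];
       (* i *) [::]]) isT).

Definition V2 : lattice := hasse_lattice (@Diagram
  (let o := 0 in let w := 1 in let u := 2 in let x := 3 in
   let y := 4 in let z := 5 in let v := 6 in let i := 7 in
   [:: (* o *) [:: w; u];
       (* w *) [:: i];
       (* u *) [:: x; y; z];
       (* x *) [:: v];
       (* y *) [:: v];
       (* z *) [:: v];
       (* v *) [:: i];
       (* i *) [::]]) isT).

Definition V3 : lattice := hasse_lattice (@Diagram
  (let u := 0 in let o := 1 in let d := 2 in let e := 3 in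
   let c := 4 in let a := 5 in let b := 6 in let i := 7 in
   [:: (* u *) [:: o; d; e];
       (* o *) [:: c; a];
       (* d *) [:: c];
       (* e *) [:: c];
       (* c *) [:: i];
       (* a *) [:: b];
       (* b *) [:: i];
       (* i *) [::]]) isT).

Definition V4 : lattice := dual_lattice V3.

Definition V5 : lattice := hasse_lattice (@Diagram
  (let u := 0 in let o := 1 in let d := 2 in let e := 3 in
   let a := 4 in let b := 5 in let c := 6 in let i := 7 in
   [:: (* u *) [:: o; d; e];
       (* o *) [:: a; c];
       (* d *) [:: a];
       (* e *) [:: a];
       (* a *) [:: b];
       (* b *) [:: i];
       (* c *) [:: i];
       (* i *) [::]]) isT).

Definition V6 : lattice := hasse_lattice (@Diagram
  (let o := 0 in let r := 1 in let w := 2 in let u := 3 in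
   let x := 4 in let y := 5 in let z := 6 in let v := 7 in let i := 8 in
   [:: (* o *) [:: r; u];
       (* r *) [:: w; x];
       (* w *) [:: i];
       (* u *) [:: x; y; z];
       (* x *) [:: v];
       (* y *) [:: v];
       (* z *) [:: v];
       (* v *) [:: i];
       (* i *) [::]]) isT).

Definition V7 : lattice := dual_lattice V6.

Definition V8 : lattice := dual_lattice V5.

Definition gen L : lattice_class := HSP (fun L' => L' = L).

Definition genm L : lattice_class := vjoin (gen L) modular.

(* [K] lists $L_6, ..., L_{15}$. By the theorem of Jonsson and Rival, ten
   pairwise distinct such varieties exhaust the join-irreducible covers of
   [gen N5] other than the first five, so exhaustiveness is not required. *)
Definition jonsson_rival_rest (K : 'I_10 -> lattice) : Prop :=
  [/\ forall k, finite_set [set: K k] /\ subdirectly_irreducible (K k),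
      forall k, vcovers (gen N5) (gen (K k)) /\ vjoin_irreducible (gen (K k)),
      forall k L, List.In L [:: L1; L2; L3; L4; L5] ->
        ~ eqclass (gen (K k)) (gen L) &
      forall k k', eqclass (gen (K k)) (gen (K k')) -> k = k'].

Section Boolean.
Variable K : 'I_10 -> lattice.

Definition B23 : lattice_class -> Prop :=
  sublattice_gen (fun X => exists L, X = genm L /\
    (List.In L [:: L1; L2; L3; L4; L5] \/ (exists k, L = K k) \/
     List.In L [:: V1; V2; V3; V4; V5; V6; V7; V8])).

Definition varB : lattice_class :=
  vjoin (vjoin (genm V8) (vsup (fun k => genm (K k))))
        (vjoin (vjoin (vjoin (vjoin (genm V1) (genm V2)) (genm V3)) (genm V4))
               (genm V5)).

Definition varB' : lattice_class :=
  vjoin (vjoin varB (genm L2)) (genm V7).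

Definition H3m : lattice_class :=
  vjoin (vjoin (genm L1) (genm L5)) (genm V6).

Definition H6m : lattice_class :=
  vjoin (vjoin H3m (genm L3)) (genm L4).

Definition color3 X : Prop := vinterval (genm N5) (vjoin H3m varB') X.

Definition color4 X : Prop :=
  vinterval (genm L3) (vjoin (vjoin H3m (genm L3)) varB') X.

Definition color6 X : Prop :=
  vinterval (genm L4) (vjoin (vjoin H3m (genm L4)) varB') X \/
  vinterval (vjoin (genm L3) (genm L4)) (vjoin H6m varB') X.

End Boolean.

(* Main.v *)
From HB Require Import structures.
From Stdlib Require List.
Require Import Defs.
From mathcomp Require Import all_boot all_order.
From mathcomp Require Import finmap boolp classical_sets functions cardinality.

(** Let [L] be generated by three elements and belong to a join of the variety of
    modular lattices with varieties generated by finite lattices. Lattice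
    preorders on terms form a distributive lattice ([chain_distr]), whence
    Jonsson's lemma ([sat3_pieces]): [L] is a subdirect product of quotients of
    three-generated sublattices of the generating lattices. Here [M3] stands for
    all modular lattices, because an inequality in three variables that holds in
    [M3] holds in every modular lattice ([modular_M3]). In particular [L] is
    finite.

    An atom of [L] is nonzero in some factor, where it is mapped to an atom [q] of
    a finite lattice [S] with three given generators, and it is the least element
    of [L] mapped above [q]. So atoms are classified by types: a pointed lattice
    [S] together with an atom [q]. Whether the least element belonging to one type
    lies below that of another depends only on the sublattice generated in the
    product of the two pointed lattices, not on [L]. Hence the atoms of [L]
    correspond to the minimal types among those of the pointed lattices that are
    quotients of [L] ([count_atoms]), and the coatoms dually. The pair formed by
    the numbers of atoms and coatoms is thus a function of a subset of a finite
    list of pointed lattices ([spectrum_upper]), and each subset separating the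
    generators is realized by the lattice that it generates in a product
    ([spectrum_lower]). Running through the subsets gives the spectra.

    It remains to see that the pointed lattices in question are those on the
    two-element chain, on [M3] and on whichever of [L1], ..., [L5], [V6], [V7]
    are present. For the explicit lattices this is a finite verification
    ([atom_check]), which amounts to tracing how a congruence that makes an element
    an atom collapses other pairs. The ten remaining covers [K k] are known only
    abstractly. A join-irreducible cover of the variety of [N5] contains no lattice
    outside the variety of [N5] other than generators of the cover, so that it
    excludes [M3], [L1], ..., [L5] ([jonsson_rival_excludes]). By the argument of
    Davey, Poguntke and Rival a finite lattice with an atom that is not join-prime
    contains [M3], [L1], [L3], [L4] or [L5] ([nonprime_atom]). So in the quotients
    of sublattices of [K k] all atoms, and dually all coatoms, are prime, and have
    the type of a two-element chain. *)

Set Implicit Arguments.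
Unset Strict Implicit.
Unset Printing Implicit Defensive.

Import Order.TTheory.

Local Open Scope order_scope.
Local Open Scope quotient_scope.

(** * Lattice terms and lattice preorders *)

Inductive term (V : Type) : Type :=
| Var of V
| Meet of term V & term V
| Join of term V & term V.

Fixpoint ev (L : lattice) (V : Type) (e : V -> L) (s : term V) : L :=
  match s with
  | Var v => e v
  | Meet s t => ev e s `&` ev e t
  | Join s t => ev e s `|` ev e t
  end.

(** A lattice with a generating family indexed by [V] is encoded by the preorder
    that its order induces on terms. Homomorphic images become larger preorders,
    so that congruences and their joins are treated without quotient types. *)
Record lpre (V : Type) := LPre {
  lrel :> term V -> term V -> Prop;
  lpre_refl : forall s, lrel s s;
  lpre_trans : forall t s u, lrel s t -> lrel t u -> lrel s u;
  lpre_meetP : forall u s t, lrel u (Meet s t) <-> lrel u s /\ lrel u t;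
  lpre_joinP : forall u s t, lrel (Join s t) u <-> lrel s u /\ lrel t u }.

#[export] Hint Resolve lpre_refl : core.

Definition sublpre V (R S : lpre V) : Prop := forall s t, R s t -> S s t.

Section LPreTheory.
Variables (V : Type) (R : lpre V).
Implicit Types s t u : term V.

Lemma lpre_meetl s t : R (Meet s t) s.
Proof. by have /lpre_meetP[] := lpre_refl R (Meet s t). Qed.

Lemma lpre_meetr s t : R (Meet s t) t.
Proof. by have /lpre_meetP[] := lpre_refl R (Meet s t). Qed.

Lemma lpre_joinl s t : R s (Join s t).
Proof. by have /lpre_joinP[] := lpre_refl R (Join s t). Qed.

Lemma lpre_joinr s t : R t (Join s t).
Proof. by have /lpre_joinP[] := lpre_refl R (Join s t). Qed.

Lemma lpre_meet_mono s s' t t' :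
  R s s' -> R t t' -> R (Meet s t) (Meet s' t').
Proof.
by move=> h h'; apply/lpre_meetP; split;
   [apply: lpre_trans (lpre_meetl _ _) h | apply: lpre_trans (lpre_meetr _ _) h'].
Qed.

Lemma lpre_join_mono s s' t t' :
  R s s' -> R t t' -> R (Join s t) (Join s' t').
Proof.
by move=> h h'; apply/lpre_joinP; split;
   [apply: lpre_trans h (lpre_joinl _ _) | apply: lpre_trans h' (lpre_joinr _ _)].
Qed.

End LPreTheory.

Definition evle (L : lattice) V (e : V -> L) : lpre V.
Proof.
refine (@LPre V (fun s t => ev e s <= ev e t) _ _ _ _).
- by move=> s; exact: lexx.
- by move=> t s u; exact: le_trans.
- by move=> u s t; rewrite /= lexI; split=> [/andP|] // [-> ->].
- by move=> u s t; rewrite /= leUx; split=> [/andP|] // [-> ->].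
Defined.

(** The preorder of a subdirect product. *)
Definition lcap V (I : Type) (F : I -> lpre V) : lpre V.
Proof.
refine (@LPre V (fun s t => forall i, F i s t) _ _ _ _).
- by [].
- by move=> t s u h1 h2 i; exact: lpre_trans (h1 i) (h2 i).
- move=> u s t; split=> [h|[h1 h2] i]; last exact/lpre_meetP.
  by split=> i; have /lpre_meetP[] := h i.
- move=> u s t; split=> [h|[h1 h2] i]; last exact/lpre_joinP.
  by split=> i; have /lpre_joinP[] := h i.
Defined.

Definition lcap2 V (R S : lpre V) : lpre V := lcap (fun b : bool => if b then R else S).

Lemma lcap2P V (R S : lpre V) s t : lcap2 R S s t <-> R s t /\ S s t.
Proof. by split=> [h|[hR hS] []] //; split; [exact: (h true)|exact: (h false)]. Qed.

(** Chains of steps from [R] and [S]: the join of [R] and [S]. *)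
Inductive chain V (R S : lpre V) : term V -> term V -> Prop :=
| chain0 s : chain R S s s
| chainl s t u : R s t -> chain R S t u -> chain R S s u
| chainr s t u : S s t -> chain R S t u -> chain R S s u.

Section Chain.
Variable V : Type.
Implicit Types (R S T : lpre V) (s t u : term V).

Lemma chain_trans R S t s u : chain R S s t -> chain R S t u -> chain R S s u.
Proof.
by elim=> // {}s t' {}t h _ IH /IH; [exact: chainl|exact: chainr].
Qed.

Lemma chainl1 R S s t : R s t -> chain R S s t.
Proof. by move=> h; apply: chainl h (chain0 _ _ _). Qed.

Lemma chainr1 R S s t : S s t -> chain R S s t.
Proof. by move=> h; apply: chainr h (chain0 _ _ _). Qed.

Lemma chain_map R S R' S' (f : term V -> term V) :
  (forall s t, R s t -> chain R' S' (f s) (f t)) ->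
  (forall s t, S s t -> chain R' S' (f s) (f t)) ->
  forall s t, chain R S s t -> chain R' S' (f s) (f t).
Proof.
move=> hR hS s t; elim=> [u|u v w h _|u v w h _]; first exact: chain0.
- exact: chain_trans (hR _ _ h).
- exact: chain_trans (hS _ _ h).
Qed.

Lemma chain_absorb R S s t : sublpre S R -> chain R S s t -> R s t.
Proof.
move=> SR; elim=> [//|{}s {}t u h _|{}s {}t u /SR h _]; exact: lpre_trans h.
Qed.

Definition lsup R S : lpre V.
Proof.
refine (@LPre V (chain R S) (@chain0 _ _ _) (@chain_trans R S) _ _).
- move=> u s t; split=> [h|[h1 h2]].
    by split; apply: chain_trans h _; apply: chainl1;
       [exact: lpre_meetl|exact: lpre_meetr].
  apply: (@chain_trans _ _ (Meet u u)); first by apply: chainl1; apply/lpre_meetP.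
  apply: (@chain_trans _ _ (Meet s u)).
    apply: (@chain_map R S R S (fun x => Meet x u)) h1 => x y h;
      by [apply: chainl1; exact: lpre_meet_mono|apply: chainr1; exact: lpre_meet_mono].
  apply: (@chain_map R S R S (fun x => Meet s x)) h2 => x y h;
    by [apply: chainl1; exact: lpre_meet_mono|apply: chainr1; exact: lpre_meet_mono].
- move=> u s t; split=> [h|[h1 h2]].
    by split; apply: chain_trans h; apply: chainl1;
       [exact: lpre_joinl|exact: lpre_joinr].
  apply: (@chain_trans _ _ (Join u u)); last by apply: chainl1; apply/lpre_joinP.
  apply: (@chain_trans _ _ (Join u t)).
    apply: (@chain_map R S R S (fun x => Join x t)) h1 => x y h;
      by [apply: chainl1; exact: lpre_join_mono|apply: chainr1; exact: lpre_join_mono].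
  apply: (@chain_map R S R S (fun x => Join u x)) h2 => x y h;
    by [apply: chainl1; exact: lpre_join_mono|apply: chainr1; exact: lpre_join_mono].
Defined.

Lemma lsup_subl R S : sublpre R (lsup R S).
Proof. by move=> s t; exact: chainl1. Qed.

Lemma lsup_subr R S : sublpre S (lsup R S).
Proof. by move=> s t; exact: chainr1. Qed.

(** Distributivity of the lattice of lattice preorders. If [T s t], then the
    polynomial [x |-> s /\ (x \/ t)] maps a chain from [s] to [t] into the
    interval between [s /\ t] and [s], where [T] relates everything. *)
Lemma chain_distr R S T s t :
  chain R S s t -> T s t -> chain (lcap2 R T) (lcap2 S T) s t.
Proof.
move=> hRS hT.
have all0 u v : (forall Q : lpre V, Q u v) -> chain (lcap2 R T) (lcap2 S T) u v.
  by move=> h; apply: chainl1; apply/lcap2P.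
apply: (@chain_trans _ _ (Meet s (Join s t))).
  by apply: all0 => Q; apply/lpre_meetP; split=> //; exact: lpre_joinl.
apply: (@chain_trans _ _ (Meet s (Join t t))); last first.
  apply: all0 => Q; apply: lpre_trans (lpre_meetr _ _ _) _.
  by apply/lpre_joinP.
have TT u v : T (Meet s (Join u t)) (Meet s (Join v t)).
  apply: lpre_trans (lpre_meetl _ _ _) _; apply/lpre_meetP; split=> //.
  exact: lpre_trans hT (lpre_joinr _ _ _).
by apply: (@chain_map R S _ _ (fun x => Meet s (Join x t))) hRS => u v h;
   [apply: chainl1|apply: chainr1]; apply/lcap2P; split=> //;
   apply: lpre_meet_mono => //; apply: lpre_join_mono.
Qed.

Definition linf (Ss : seq (lpre V)) : lpre V := lcap (fun S : {S | List.In S Ss} => sval S).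

Lemma linfP Ss s t : linf Ss s t <-> forall S, List.In S Ss -> S s t.
Proof. by split=> [h S hS|h [S hS]]; [exact: (h (exist _ S hS))|exact: h]. Qed.

(** Distributivity extends to finite meets. With [linf Ss] contained in [R]
    this says that [R] is the meet of its joins with the members of [Ss]: a
    quotient of a finite subdirect product is a subdirect product of quotients
    of the factors, which is the finite case of Jonsson's lemma. *)
Lemma chain_linf R Ss s t :
  (forall S, List.In S Ss -> chain R S s t) -> chain R (linf Ss) s t.
Proof.
elim: Ss s t => [|S Ss IH] s t h; first by apply: chainr1; apply/linfP.
have h1 := h S (or_introl erefl).
have h2 : lsup R (linf Ss) s t by apply: IH => S' hS'; apply: h; right.
have := chain_distr h1 h2; apply: (@chain_map _ _ _ _ id) => u v /lcap2P[huv] h3.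
  exact: chainl1.
have := chain_distr h3 huv; apply: (@chain_map _ _ _ _ id) => u' v' /lcap2P[h4 h5].
  exact: chainl1.
by apply: chainr1; apply/linfP => S' [<-//|]; move/linfP: h4; apply.
Qed.

End Chain.

(** * Quotients of term algebras and varieties *)

Section LMorphism.
Variables (L M : lattice) (f : L -> M).
Hypotheses (fI : forall x y, f (x `&` y) = f x `&` f y)
           (fU : forall x y, f (x `|` y) = f x `|` f y).

(* A constant is needed as the key of the canonical structures. *)
Definition lmorph_fun of phant (L -> M) & f = f := f.
Local Notation g := (lmorph_fun (Phant _) (erefl f)).

Fact lmorph_fun_le : {homo g : x y / x <= y}.
Proof. by move=> x y /meet_idPl h; apply/meet_idPl; rewrite /lmorph_fun -fI h. Qed.

HB.instance Definition _ := Order.isOrderMorphism.Build _ _ _ _ g lmorph_fun_le.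
HB.instance Definition _ := Order.isLatticeMorphism.Build _ _ _ _ g fI fU.

Lemma lmorphism_of : exists h : {lmorphism L -> M}, forall x, h x = f x.
Proof. by exists g. Qed.
End LMorphism.

Section Quotient.
Variables (V : Type) (R : lpre V).

HB.instance Definition _ := gen_eqMixin (term V).
HB.instance Definition _ := gen_choiceMixin (term V).

Definition lequiv (s t : term V) : bool := `[< R s t /\ R t s >].

Fact lequiv_refl : reflexive lequiv.
Proof. by move=> s; apply/asboolP. Qed.

Fact lequiv_sym : symmetric lequiv.
Proof. by move=> s t; apply/asboolP/asboolP=> -[]. Qed.

Fact lequiv_trans : transitive lequiv.
Proof.
move=> t s u /asboolP[h1 h2] /asboolP[h3 h4]; apply/asboolP.
by split; [exact: lpre_trans h1 h3|exact: lpre_trans h4 h2].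
Qed.

Canonical lequiv_rel := EquivRel lequiv lequiv_refl lequiv_sym lequiv_trans.

Definition quot := {eq_quot lequiv_rel}.
HB.instance Definition _ := Choice.on quot.
HB.instance Definition _ := EqQuotient.on quot.

Definition quot_le (x y : quot) : bool := `[< R (repr x) (repr y) >].
Definition quot_meet (x y : quot) : quot := \pi_quot (Meet (repr x) (repr y)).
Definition quot_join (x y : quot) : quot := \pi_quot (Join (repr x) (repr y)).

Lemma repr_pi_equiv s : R (repr (\pi_quot s)) s /\ R s (repr (\pi_quot s)).
Proof. by have /eqmodP/asboolP := reprK (\pi_quot s). Qed.

Lemma quot_lepi s t : quot_le (\pi_quot s) (\pi_quot t) <-> R s t.
Proof.
have [[hs hs'] [ht ht']] := (repr_pi_equiv s, repr_pi_equiv t).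
split=> [/asboolP h|h]; last first.
  by apply/asboolP; exact: lpre_trans hs (lpre_trans h ht').
exact: lpre_trans hs' (lpre_trans h ht).
Qed.

Fact quot_le_refl : reflexive quot_le.
Proof. by move=> x; apply/asboolP. Qed.

Fact quot_le_anti : antisymmetric quot_le.
Proof.
move=> x y /andP[/asboolP h1 /asboolP h2]; rewrite -[x]reprK -[y]reprK.
by apply/eqmodP/asboolP.
Qed.

Fact quot_le_trans : transitive quot_le.
Proof. by move=> y x z /asboolP h1 /asboolP h2; apply/asboolP; apply: lpre_trans h2. Qed.

HB.instance Definition _ := Order.Le_isPOrder.Build (Order.Disp tt tt) quot
  quot_le_refl quot_le_anti quot_le_trans.

Fact quot_meetP (x y z : quot) : (x <= quot_meet y z) = (x <= y) && (x <= z).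
Proof.
rewrite -[x]reprK -{2}[y]reprK -{2}[z]reprK /quot_meet.
apply/idP/andP => [/quot_lepi/lpre_meetP[]|[/quot_lepi h1 /quot_lepi h2]].
  by split; apply/quot_lepi.
by apply/quot_lepi/lpre_meetP.
Qed.

Fact quot_joinP (x y z : quot) : (quot_join x y <= z) = (x <= z) && (y <= z).
Proof.
rewrite -{2}[x]reprK -{2}[y]reprK -[z]reprK /quot_join.
apply/idP/andP => [/quot_lepi/lpre_joinP[]|[/quot_lepi h1 /quot_lepi h2]].
  by split; apply/quot_lepi.
by apply/quot_lepi/lpre_joinP.
Qed.

HB.instance Definition _ := Order.POrder_MeetJoin_isLattice.Build
  (Order.Disp tt tt) quot quot_meetP quot_joinP.

Lemma quotP s t : (\pi_quot s <= \pi_quot t) <-> R s t.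
Proof. exact: quot_lepi. Qed.

Lemma quot_ev s : ev (fun v => \pi_quot (Var v) : quot) s = \pi_quot s.
Proof.
elim: s => [//|s IHs t IHt|s IHs t IHt] /=; rewrite {}IHs {}IHt;
  apply/eqmodP/asboolP; have [[h1 h2] [h3 h4]] := (repr_pi_equiv s, repr_pi_equiv t).
  by split; exact: lpre_meet_mono.
by split; exact: lpre_join_mono.
Qed.

Lemma quot_surj (x : quot) : exists s, ev (fun v => \pi_quot (Var v) : quot) s = x.
Proof. by exists (repr x); rewrite quot_ev reprK. Qed.

End Quotient.

Definition qvar V (R : lpre V) (v : V) : quot R := \pi_(quot R) (Var v).

Lemma qvarP V (R : lpre V) s t : (ev (qvar R) s <= ev (qvar R) t) <-> R s t.
Proof. by rewrite !quot_ev; exact: quotP. Qed.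

Lemma qvar_gen V (R : lpre V) (x : quot R) : exists s, ev (qvar R) s = x.
Proof. exact: quot_surj. Qed.

Lemma lmorphI (L M : lattice) (f : {lmorphism L -> M}) x y : f (x `&` y) = f x `&` f y.
Proof. exact: omorphI. Qed.

Lemma lmorphU (L M : lattice) (f : {lmorphism L -> M}) x y : f (x `|` y) = f x `|` f y.
Proof. exact: omorphU. Qed.

Lemma ev_morph (L M : lattice) (f : {lmorphism L -> M}) V (e : V -> L) s :
  f (ev e s) = ev (f \o e) s.
Proof.
by elim: s => //= s IHs t IHt; [rewrite lmorphI IHs IHt|rewrite lmorphU IHs IHt].
Qed.

Lemma ev_prod (I : Type) (A : I -> lattice) V (e : V -> prod_lattice A) s i :
  ev e s i = ev (fun v => e v i) s.
Proof.
elim: s => //= s IHs t IHt; rewrite -IHs -IHt; [exact: (erefl (prod_meet _ _ _))|].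
exact: (erefl (prod_join _ _ _)).
Qed.

(** The hypotheses make [L] a homomorphic image of the sublattice of the product
    of the [A i] generated by the points [(d i v)_i]. All memberships in
    varieties below come from this lemma. *)
Lemma HSP_eval (X : lattice_class) (L : lattice) V (e : V -> L)
    (I : Type) (A : I -> lattice) (d : forall i, V -> A i) :
  (forall y, exists s, ev e s = y) -> (forall i, X (A i)) ->
  (forall s t, (forall i, ev (d i) s <= ev (d i) t) -> ev e s <= ev e t) ->
  HSP X L.
Proof.
move=> gen hA hd; pose R := lcap (fun i => evle (d i)).
have eqR s t : ev (qvar R) s = ev (qvar R) t ->
    forall i, ev (d i) s = ev (d i) t.
  by move=> h i; apply: le_anti; apply/andP; split; apply: (qvarP R _ _).1;
     rewrite h.
exists (quot R); split.
  exists (prod_lattice A); split.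
    exists I, A; split=> //.
    have [f hf] := @lmorphism_of (prod_lattice A) (prod_lattice A) id
       (fun _ _ => erefl) (fun _ _ => erefl).
    by exists f; exists id => x; rewrite hf.
  pose D v : prod_lattice A := fun i => d i v.
  pose f (x : quot R) : prod_lattice A := ev D (repr x).
  have fE s : f (ev (qvar R) s) = ev D s.
    apply: functional_extensionality_dep => i; rewrite /f !ev_prod.
    by apply: eqR; rewrite !quot_ev reprK.
  have [||g hg] := @lmorphism_of _ _ f.
  - by move=> x y; have [[s <-] [t <-]] := (qvar_gen x, qvar_gen y);
       rewrite -[_ `&` _]/(ev _ (Meet s t)) !fE.
  - by move=> x y; have [[s <-] [t <-]] := (qvar_gen x, qvar_gen y);
       rewrite -[_ `|` _]/(ev _ (Join s t)) !fE.
  exists g => x y; rewrite !hg; have [[s <-] [t <-]] := (qvar_gen x, qvar_gen y).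
  rewrite !fE => h; have hi i : ev (d i) s = ev (d i) t.
    by have := congr1 (fun p => p i) h; rewrite !ev_prod.
  by apply: le_anti; apply/andP; split; apply/qvarP => i; rewrite /= hi.
pose f (x : quot R) : L := ev e (repr x).
have fE s : f (ev (qvar R) s) = ev e s.
  rewrite /f quot_ev; have [h1 h2] := repr_pi_equiv R s.
  by apply: le_anti; apply/andP; split; apply: hd.
have [||g hg] := @lmorphism_of _ _ f.
- by move=> x y; have [[s <-] [t <-]] := (qvar_gen x, qvar_gen y);
     rewrite -[_ `&` _]/(ev _ (Meet s t)) !fE.
- by move=> x y; have [[s <-] [t <-]] := (qvar_gen x, qvar_gen y);
     rewrite -[_ `|` _]/(ev _ (Join s t)) !fE.
by exists g => y; have [s <-] := gen y; exists (ev (qvar R) s); rewrite hg fE.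
Qed.

Lemma variety_HSP (X Y : lattice_class) :
  is_variety Y -> subclass X Y -> subclass (HSP X) Y.
Proof.
move=> [hH hS hP] XY L [S [[P [[I [A [hA hf]]] hg]] hh]].
apply: hH; exists S; split=> //; apply: hS; exists P; split=> //; apply: hP.
by exists I, A; split=> // i; exact: XY.
Qed.

(** Variables of an arbitrary type are allowed, so that [L] itself can serve as
    the set of variables in [gen_models]. *)
Definition models (F L : lattice) : Prop :=
  forall V (s t : term V), (forall d : V -> F, ev d s <= ev d t) ->
  forall e : V -> L, ev e s <= ev e t.

Lemma ineq_variety V (P : term V -> term V -> Prop) :
  is_variety (fun L => forall s t, P s t -> forall e : V -> L, ev e s <= ev e t).
Proof.
split=> L.
- move=> [S [hS [f hf]]] s t /hS h e; have [e' he'] := choice (fun v => hf (e v)).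
  have -> : e = f \o e' by apply: functional_extensionality_dep => v; rewrite /= he'.
  by rewrite -!ev_morph; apply: omorph_le.
- move=> [S [hS [f hf]]] s t /hS h e; apply/meet_idPl/hf; rewrite lmorphI !ev_morph.
  exact/meet_idPl.
- move=> [I [A [hA [f /bij_inj hf]]]] s t hst e; apply/meet_idPl/hf.
  rewrite lmorphI !ev_morph; apply/meet_idPl/asboolP => i; rewrite !ev_prod.
  exact: hA.
Qed.

Lemma models_variety F : is_variety (models F).
Proof.
pose P V (s t : term V) := forall d : V -> F, ev d s <= ev d t.
split=> L h V s t hst e.
- have [h1 _ _] := ineq_variety (@P V); apply: (h1 L) hst e.
  by case: h => S [hS hf]; exists S; split=> // ? ?; exact: hS.
- have [_ h1 _] := ineq_variety (@P V); apply: (h1 L) hst e.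
  by case: h => S [hS hf]; exists S; split=> // ? ?; exact: hS.
- have [_ _ h1] := ineq_variety (@P V); apply: (h1 L) hst e.
  by case: h => I [A [hA hf]]; exists I, A; split=> // i ? ?; exact: hA.
Qed.

(** Birkhoff's theorem: [L] is a quotient of the term algebra over [L], which,
    modulo the inequalities valid in [F], embeds in a power of [F]. *)
Lemma gen_models F L : gen F L <-> models F L.
Proof.
split; first by apply: variety_HSP; [exact: models_variety|move=> _ -> V s t].
move=> h; apply: (@HSP_eval _ _ L id (L -> F) (fun=> F) (fun d => d)) => //.
  by move=> y; exists (Var y).
by move=> s t hst; exact: (h L s t hst id).
Qed.

Lemma gen_variety F : is_variety (gen F).
Proof.
have -> : gen F = models F by apply: funext => L; apply: propext; exact: gen_models.
exact: models_variety.
Qed.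

Lemma gen_id F : gen F F.
Proof. exact/gen_models. Qed.

Lemma gen_min F (Y : lattice_class) : is_variety Y -> Y F -> subclass (gen F) Y.
Proof. by move=> hY YF; apply: variety_HSP => // L ->. Qed.

Lemma vjoin_variety X Y : is_variety (vjoin X Y).
Proof.
split=> L h Z hZ XZ YZ; have [hH hS hP] := hZ.
- by apply: hH; case: h => S [hS' hf]; exists S; split=> //; exact: hS'.
- by apply: hS; case: h => S [hS' hf]; exists S; split=> //; exact: hS'.
- by apply: hP; case: h => I [A [hA hf]]; exists I, A; split=> // i; exact: hA.
Qed.

Lemma sub_vjoinl X Y : subclass X (vjoin X Y).
Proof. by move=> L XL Z _ XZ _; exact: XZ. Qed.

Lemma sub_vjoinr X Y : subclass Y (vjoin X Y).
Proof. by move=> L YL Z _ _ YZ; exact: YZ. Qed.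

Lemma vjoin_min X Y Z : is_variety Z -> subclass X Z -> subclass Y Z -> subclass (vjoin X Y) Z.
Proof. by move=> hZ XZ YZ L; apply. Qed.

(** The modular law as an inequality: [x /\ z] stands for an arbitrary element
    below [z]. *)
Lemma modular_variety : is_variety modular.
Proof.
pose x := Var 0%N; pose y := Var 1%N; pose z := Var 2%N.
pose P (s t : term nat) := s = Meet (Join (Meet x z) y) z /\ t = Join (Meet x z) (Meet y z).
have -> : modular = (fun L => forall s t, P s t -> forall e : nat -> L, ev e s <= ev e t).
  apply: funext => L; apply: propext; split=> [h s t [-> ->] e /=|h a b c ac].
    by rewrite -h // leIr.
  apply: le_anti; apply/andP; split.
    by rewrite leUx !lexI leUl ac leIr andbT /= (le_trans (leIl b c)) // leUr.
  have := h _ _ (conj erefl erefl) (fun n => nth a [:: a; b; c] n).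
  by rewrite /= (meet_l ac).
exact: ineq_variety.
Qed.

(** * Finite generation and quotients of finite pieces *)

Inductive gen3 := G0 | G1 | G2.

Definition mk3 T (a b c : T) (v : gen3) : T :=
  match v with G0 => a | G1 => b | G2 => c end.

Lemma mk3_eta T (d : gen3 -> T) : d = mk3 (d G0) (d G1) (d G2).
Proof. by apply: functional_extensionality_dep => -[]. Qed.

Definition listable (T : eqType) : Prop := exists l : seq T, forall x, x \in l.

(** The quotient by [R] is finite. *)
Definition fin_index V (R : lpre V) : Prop :=
  exists l : seq (term V), forall s, exists t, [/\ List.In t l, R s t & R t s].

Lemma choose_list A (Ps : seq (A -> Prop)) :
  exists l : seq A, forall P, List.In P Ps -> (exists x, P x) ->
    exists x, List.In x l /\ P x.
Proof.
elim: Ps => [|P Ps [l hl]]; first by exists [::].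
have [[x Px]|nP] := pselect (exists x, P x).
  exists (x :: l) => Q [<- _|/hl h /h [y [yl Qy]]]; first by exists x; split; [left|].
  by exists y; split; [right|].
by exists l => Q [<- //|]; exact: hl.
Qed.

Lemma In_map A B (f : A -> B) x (l : seq A) : List.In x l -> List.In (f x) (map f l).
Proof. by elim: l => //= a l IH [->|/IH]; [left|right]. Qed.

Lemma In_map_inv A B (f : A -> B) y l : List.In y (map f l) -> exists x, y = f x /\ List.In x l.
Proof.
elim: l => //= a l IH [<-|/IH[x [-> h]]]; first by exists a; split=> //; left.
by exists x; split=> //; right.
Qed.

Lemma In_mem (T : eqType) (x : T) l : List.In x l <-> x \in l.
Proof.
elim: l => //= a l IH; rewrite in_cons; split.
  by move=> [->|/IH ->]; rewrite ?eqxx ?orbT.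
by move=> /orP[/eqP ->|/IH]; [left|right].
Qed.

Lemma In_cat A (x : A) l1 l2 : List.In x (l1 ++ l2) <-> List.In x l1 \/ List.In x l2.
Proof. by elim: l1 => [|a l IH] /=; [split; [right|case]|rewrite IH; tauto]. Qed.

Lemma In_flatmap A B (f : A -> seq B) a x l :
  List.In a l -> List.In x (f a) -> List.In x (flatten (map f l)).
Proof.
elim: l => //= b l IH [->|/IH h] hx; apply/In_cat; [by left|right; exact: h].
Qed.

Lemma fin_index_evle (F : lattice) V (d : V -> F) : listable F -> fin_index (evle d).
Proof.
move=> [l hl]; have [m hm] := choose_list (map (fun x s => ev d s = x) l).
exists m => s; have /(In_map (fun x s => ev d s = x)) : List.In (ev d s) l by apply/In_mem.
by move=> /hm[|t [tm /= ht]]; [exists s|exists t; rewrite /= ht].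
Qed.

(** One term for each realized pair of classes. *)
Lemma fin_index_cap V (R S : lpre V) : fin_index R -> fin_index S -> fin_index (lcap2 R S).
Proof.
move=> [l hl] [l' hl'].
pose P a b s := [/\ R s a, R a s, S s b & S b s].
have [m hm] := choose_list (flatten (map (fun a => map (P a) l') l)).
exists m => s; have [[a [al h1 h2]] [b [bl h3 h4]]] := (hl s, hl' s).
have := hm (P a b) (In_flatmap al (In_map _ bl)).
case; first by exists s.
move=> t [tm [h5 h6 h7 h8]]; exists t; split=> //; apply/lcap2P; split;
  by [apply: lpre_trans h6|apply: lpre_trans h8|apply: lpre_trans h2|apply: lpre_trans h4].
Qed.

Lemma fin_index_sub V (R S : lpre V) : sublpre R S -> fin_index R -> fin_index S.
Proof.
move=> RS [l hl]; exists l => s; have [t [tl h1 h2]] := hl s.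
by exists t; split=> //; exact: RS.
Qed.

Lemma fin_index_linf V (Ss : seq (lpre V)) :
  (forall S, List.In S Ss -> fin_index S) -> (0 < size Ss)%N -> fin_index (linf Ss).
Proof.
case: Ss => // S Ss + _; elim: Ss S => [|S' Ss IH] S h.
  by apply: fin_index_sub (h S (or_introl erefl)) => s t hst; apply/linfP => S' [<-|].
have [|l hl] := IH S'; first by move=> S'' hS''; apply: h; right.
apply: fin_index_sub (fin_index_cap (h S (or_introl erefl)) (ex_intro _ l hl)).
by move=> s t /lcap2P[h1 /linfP h2]; apply/linfP => S'' [<-|/h2].
Qed.

Lemma listable_gen (L : lattice) V (e : V -> L) :
  (forall y, exists s, ev e s = y) -> fin_index (evle e) -> listable L.
Proof.
move=> gen [l hl]; exists (map (ev e) l) => y; have [s <-] := gen y.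
have [t [tl h1 h2]] := hl s.
have -> : ev e s = ev e t by apply: le_anti; apply/andP.
by apply/In_mem/In_map.
Qed.

(** The lattices satisfying every inequality in three variables that is valid
    in all members of [Fs]. *)
Definition sat3 (Fs : seq lattice) : lattice_class := fun L =>
  forall s t : term gen3,
    (forall F, List.In F Fs -> forall d : gen3 -> F, ev d s <= ev d t) ->
  forall e : gen3 -> L, ev e s <= ev e t.

Lemma sat3_variety Fs : is_variety (sat3 Fs).
Proof. exact: ineq_variety. Qed.

Lemma gen_sub_sat3 Fs F : List.In F Fs -> subclass (gen F) (sat3 Fs).
Proof.
by move=> hF; apply: gen_min; [exact: sat3_variety|move=> s t h e; exact: h].
Qed.

Lemma valuations (Fs : seq lattice) : (forall F : lattice, List.In F Fs -> listable F) ->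
  exists Ss : seq (lpre gen3), forall S, List.In S Ss <->
    exists F : lattice, List.In F Fs /\ exists d : gen3 -> F, S = evle d.
Proof.
elim: Fs => [|F Fs IH] hF; first by exists [::] => S; split=> // -[F []].
have [|Ss hSs] := IH; first by move=> F' h; apply: hF; right.
have [l hl] := hF F (or_introl erefl).
exists (flatten [seq flatten [seq [seq evle (mk3 a b c) | c <- l] | b <- l] | a <- l] ++ Ss).
move=> S; rewrite In_cat hSs; split.
  case; last by move=> [F' [h hd]]; exists F'; split=> //; right.
  have aux T (f : F -> seq T) x (m : seq F) :
      List.In x (flatten (map f m)) -> exists a, List.In x (f a).
    by elim: m => //= a m IHm /In_cat[h|/IHm //]; exists a.
  move=> h; have [a {}h] := aux _ _ _ _ h; have [b {h}] := aux _ _ _ _ h; elim: l {hl} => //= c l IHl [<-|//].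
  by exists F; split; [left|exists (mk3 a b c)].
move=> [F' [[<-|h] [d ->]]]; last by right; exists F'; split=> //; exists d.
left; rewrite (mk3_eta d).
have hm (x : F) : List.In x l by apply/In_mem.
apply: (In_flatmap (hm (d G0))); apply: (In_flatmap (hm (d G1))).
exact: (In_map (fun c => evle (mk3 _ _ c)) (hm (d G2))).
Qed.

(** Jonsson's lemma: a three-generated lattice [L] in the variety generated by
    finitely many finite lattices is a subdirect product of quotients of their
    three-generated sublattices. The preorder [lsup (evle e) (evle d)] belongs to
    the largest common quotient of [L] and of the sublattice generated by [d]. *)
Lemma sat3_pieces (Fs : seq lattice) (L : lattice) (e : gen3 -> L) s t :
  (forall F : lattice, List.In F Fs -> listable F) -> sat3 Fs L -> ~~ (ev e s <= ev e t) ->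
  exists F : lattice, List.In F Fs /\ exists d : gen3 -> F, ~ lsup (evle e) (evle d) s t.
Proof.
move=> hF hL /negP; apply: contra_notP => hn.
have [Ss hSs] := valuations hF.
have : chain (evle e) (linf Ss) s t.
  apply: chain_linf => S /hSs[F [hFs [d ->]]]; apply: contrapT => hc.
  by apply: hn; exists F; split=> //; exists d.
apply: chain_absorb => u v /linfP h; apply: (hL u v) => F hFs d.
by apply: (h (evle d)); apply/hSs; exists F; split=> //; exists d.
Qed.

(** The free three-generated lattice of the variety embeds in a finite product,
    one factor for each valuation in a member of [Fs]. *)
Lemma sat3_listable (Fs : seq lattice) (L : lattice) (e : gen3 -> L) :
  (forall F : lattice, List.In F Fs -> listable F) -> sat3 Fs L ->
  (forall y, exists s, ev e s = y) -> listable L.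
Proof.
move=> hF hL gen; apply: (listable_gen gen).
have [Ss hSs] := valuations hF.
have Ss0 S : List.In S Ss -> fin_index S.
  by move=> /hSs[F [hFs [d ->]]]; apply: fin_index_evle; exact: hF.
have sub : sublpre (linf Ss) (evle e).
  move=> u v /linfP h; apply: (hL u v) => F hFs d.
  by apply: (h (evle d)); apply/hSs; exists F; split=> //; exists d.
case: Ss Ss0 sub {hSs} => [|S Ss] Ss0 sub; last first.
  exact: fin_index_sub sub (fin_index_linf Ss0 _).
exists [:: Var G0] => s; exists (Var G0).
by split; [left|apply: sub; apply/linfP..].
Qed.

(** * Non-prime atoms of finite lattices *)

Definition M3 : lattice := hasse_lattice (@Diagram
  (let o := 0%N in let a := 1%N in let b := 2%N in let c := 3%N in let i := 4%N in
   [:: (* o *) [:: a; b; c];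
       (* a *) [:: i];
       (* b *) [:: i];
       (* c *) [:: i];
       (* i *) [::]]) isT).

(** The order-dual of an embedding is an embedding between the duals, up to
    conversion, which is why the morphism is kept unbundled. *)
Definition embeds (S T : lattice) : Prop :=
  exists f : S -> T, [/\ injective f, (forall x y, f (x `&` y) = f x `&` f y)
                        & (forall x y, f (x `|` y) = f x `|` f y)].

Lemma embeds_dual S T : embeds S (dual_lattice T) -> embeds (dual_lattice S) T.
Proof. by move=> [f [h1 h2 h3]]; exists f; split. Qed.

Lemma embeds_in (X : lattice_class) S T : is_variety X -> embeds S T -> X T -> X S.
Proof.
move=> [_ hS _] [f [h1 h2 h3]] XT; apply: hS; exists T; split=> //.
by have [g hg] := lmorphism_of h2 h3; exists g => x y; rewrite !hg; exact: h1.
Qed.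

Lemma lt_hasse (D : diagram) (i : hasse_lattice D) : (val i < size D)%N.
Proof. exact: ltn_ord. Qed.

Section DiagramOps.
Variable D : diagram.
Implicit Types x y : hasse_lattice D.

Lemma hasse_ops_lt (i j : nat) : (i < size D)%N -> (j < size D)%N ->
  (hasse_meet D i j < size D)%N /\ (hasse_join D i j < size D)%N.
Proof.
have /and5P[_ _ /allP h _ _] := diagramP D => hi hj.
have /h/allP/(_ j) : i \in iota 0 (size D) by rewrite mem_iota.
rewrite mem_iota => /(_ hj)/andP[].
by rewrite /hasse_meet /hasse_join !has_find size_iota.
Qed.

Lemma val_hmeet x y : val (x `&` y) = hasse_meet D (val x) (val y).
Proof.
rewrite [_ `&` _](_ : _ = hmeet x y) // /hmeet val_insubd.
by have [-> _] := hasse_ops_lt (lt_hasse x) (lt_hasse y).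
Qed.

Lemma val_hjoin x y : val (x `|` y) = hasse_join D (val x) (val y).
Proof.
rewrite [_ `|` _](_ : _ = hjoin x y) // /hjoin val_insubd.
by have [_ ->] := hasse_ops_lt (lt_hasse x) (lt_hasse y).
Qed.

Definition cover_pairs : seq (nat * nat) :=
  [seq (i, j) | i <- iota 0 (size D), j <- nth [::] D i].

(* Pairs of incomparable elements with their meet and join. *)
Definition incomparable_pairs : seq ((nat * nat) * (nat * nat)) :=
  [seq (p, (hasse_meet D p.1 p.2, hasse_join D p.1 p.2)) |
    p <- [seq (i, j) | i <- iota 0 (size D), j <- iota 0 (size D)] &
    [&& (p.1 < p.2)%N, ~~ hasse_le D p.1 p.2 & ~~ hasse_le D p.2 p.1]].

Fixpoint all_prop A (P : A -> Prop) (l : seq A) : Prop :=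
  if l is x :: l' then P x /\ all_prop P l' else True.

Lemma all_propP (A : eqType) (P : A -> Prop) l :
  all_prop P l -> forall a, a \in l -> P a.
Proof.
by elim: l => //= a l IH [h1 /IH h2] c; rewrite in_cons => /orP[/eqP ->|/h2].
Qed.

(** It suffices to check covering pairs and the meets and joins of incomparable
    pairs. Injectivity holds since a map preserving meets that is strictly
    monotone separates [x] from [x /\ y] unless [x <= y]. *)
Lemma diagram_embeds (T : lattice) (f : nat -> T) :
  all_prop (fun p => f p.1 < f p.2) cover_pairs ->
  all_prop (fun p => f p.1.1 `&` f p.1.2 = f p.2.1 /\
                     f p.1.1 `|` f p.1.2 = f p.2.2) incomparable_pairs ->
  embeds (hasse_lattice D) T.
Proof.
move=> /all_propP hlt /all_propP hinc.
have step i i' : (i < size D)%N -> i' \in nth [::] D i -> f i < f i' /\ (i' < size D)%N.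
  move=> hi hi'; split.
    by apply: (hlt (i, i')); apply/allpairsPdep; exists i, i'; rewrite mem_iota.
  have /and5P[_ _ _ /allP h4 _] := diagramP D.
  by have /allP := h4 _ (mem_nth [::] hi); apply.
have mono k i j : (i < size D)%N -> reach D k i j -> f i <= f j.
  elim: k i => [|k IH] i hi /=; first by rewrite orbF => /eqP ->.
  move=> /orP[/eqP -> //|/hasP[i' /(step _ _ hi)[c hi'] h]].
  exact: le_trans (ltW c) (IH _ hi' h).
have smono k i j : (i < size D)%N -> i != j -> reach D k i j -> f i < f j.
  case: k => [|k] hi /negPf nij /=; rewrite nij //=.
  move=> /hasP[i' /(step _ _ hi)[c hi'] h].
  exact: lt_le_trans c (mono _ _ _ hi' h).
pose g (x : hasse_lattice D) := f (val x).
have lemono (x y : hasse_lattice D) : x <= y -> g x <= g y.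
  by apply: mono; exact: lt_hasse.
have ltmono (x y : hasse_lattice D) : x < y -> g x < g y.
  by rewrite lt_neqAle => /andP[nxy]; apply: smono => //; exact: lt_hasse.
have inc (x y : hasse_lattice D) : (val x < val y)%N -> ~~ (x <= y) -> ~~ (y <= x) ->
    g x `&` g y = g (x `&` y) /\ g x `|` g y = g (x `|` y).
  move=> h1 h2 h3; rewrite /g val_hmeet val_hjoin.
  pose p := (val x, val y); apply: (hinc (p, (_, _))); apply/mapP; exists p => //.
  rewrite mem_filter; apply/andP; split; first by apply/and3P.
  by apply/allpairsPdep; exists (val x), (val y); rewrite !mem_iota !lt_hasse.
have both (x y : hasse_lattice D) : g x `&` g y = g (x `&` y) /\ g x `|` g y = g (x `|` y).
  have [xy|nxy] := boolP (x <= y).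
    by have gxy := lemono _ _ xy; rewrite !meet_l // !join_r.
  have [yx|nyx] := boolP (y <= x).
    by have gxy := lemono _ _ yx; rewrite !meet_r // !join_l.
  have [h|h|/val_inj h] := ltngtP (val x) (val y); [exact: inc| |].
    by have := inc _ _ h nyx nxy; rewrite ![_ `&` g x]meetC ![_ `&` x]meetC ![_ `|` g x]joinC ![_ `|` x]joinC.
  by move: nxy; rewrite h lexx.
exists g; split=> [x y gxy|x y|x y]; [|by have [-> _] := both x y|by have [_ ->] := both x y].
have [h _] := both x y; apply: contrapT => /eqP nxy.
have : x `&` y < x \/ x < y.
  have [xy|nle] := boolP (x <= y); first by right; rewrite lt_neqAle nxy.
  by left; rewrite lt_neqAle leIl andbT eq_meetl.
by case=> /ltmono; rewrite -?h gxy ?meetxx ltxx.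
Qed.
End DiagramOps.

Lemma count_lt (A : eqType) (p r : pred A) y l : (forall x, p x -> r x) ->
  y \in l -> ~~ p y -> r y -> (count p l < count r l)%N.
Proof.
move=> pr + npy ry; elim: l => //= a l IH.
rewrite in_cons => /predU1P[<-|/IH h]; last first.
  by rewrite -addnS; apply: leq_add => //; case: (boolP (p a)) => // /pr ->.
by rewrite (negPf npy) ry add0n add1n ltnS; apply: sub_count.
Qed.

Lemma ex_maximal (T : lattice) (P : T -> Prop) x0 : listable T -> P x0 ->
  exists x, [/\ P x, x0 <= x & forall y, P y -> x <= y -> y = x].
Proof.
move=> [l hl]; have [n] := ubnP (count (fun y => x0 < y) l).
elim: n x0 => // n IH x0 hn Px0.
have [[y [Py xy]]|h] := pselect (exists y, P y /\ x0 < y); last first.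
  exists x0; split=> // y Py; rewrite le_eqVlt => /orP[/eqP//|xy].
  by case: h; exists y.
have [|//|x [Px yx hx]] := IH y; last by exists x; split=> //; exact: le_trans (ltW xy) yx.
rewrite ltnS in hn; apply: leq_trans hn; apply: (count_lt (y := y)) => //.
- by move=> w; exact: lt_trans.
- by rewrite ltxx.
Qed.

Lemma listable_dual (T : lattice) : listable T -> listable (dual_lattice T).
Proof. by move=> [l hl]; exists l. Qed.

Lemma ex_minimal (T : lattice) (P : T -> Prop) x0 : listable T -> P x0 ->
  exists x, [/\ P x, x <= x0 & forall y, P y -> y <= x -> y = x].
Proof. by move=> hT; apply: (@ex_maximal (dual_lattice T)); exact: listable_dual. Qed.

(** Whitman's procedure for goals [x <= y] between lattice polynomials, extended
    by transitivity through inequalities of the context; [n] bounds the nesting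
    of such uses. *)
Ltac lat n :=
  first [ exact: lexx | assumption
  | rewrite leUx; apply/andP; split; lat n
  | rewrite lexI; apply/andP; split; lat n
  | match goal with
    | |- is_true (_ <= Order.join ?a ?b) =>
        first [ apply: (le_trans _ (leUl a b)); lat n
              | apply: (le_trans _ (leUr b a)); lat n ]
    end
  | match goal with
    | |- is_true (Order.meet ?a ?b <= _) =>
        first [ apply: (le_trans (leIl a b)); lat n
              | apply: (le_trans (leIr b a)); lat n ]
    end
  | lazymatch n with
    | S ?m => match goal with
       | H : is_true (?u <= ?v) |- is_true (?x <= ?y) =>
         apply: (@le_trans _ _ u x y); [lat m|apply: (le_trans H); lat m]
       end
    end ].

Ltac lateq n := apply: le_anti; apply/andP; split; lat n.

Ltac diagram_emb :=
  match goal with |- all_prop _ ?l =>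
    let l' := eval vm_compute in l in
    rewrite (_ : l = l'); [rewrite /= | by vm_compute] end.

Lemma lt_of (T : lattice) (x y : T) : x <= y -> ~~ (y <= x) -> x < y.
Proof. by rewrite lt_leAnge => -> ->. Qed.

Lemma lt_both (T : lattice) (x y : T) : x < y -> x <= y /\ x < y.
Proof. by move=> h; rewrite ltW. Qed.

Section SmallSublattices.
Variable T : lattice.
Implicit Types o a b c d e p q i : T.

Lemma embeds_M3 o a b c i :
  o < a -> o < b -> o < c -> a < i -> b < i -> c < i ->
  a `&` b <= o -> a `&` c <= o -> b `&` c <= o ->
  i <= a `|` b -> i <= a `|` c -> i <= b `|` c -> embeds M3 T.
Proof.
do 6 move/lt_both => [? ?]; move=> *.
apply: (diagram_embeds (f := nth o [:: o; a; b; c; i])); diagram_emb => //.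
by do ?split; lateq 0.
Qed.

Lemma embeds_L4 o a b c d i :
  o < a -> o < b -> o < c -> a < d -> b < d -> c < i -> d < i ->
  a `&` b <= o -> a `&` c <= o -> b `&` c <= o -> d `&` c <= o ->
  d <= a `|` b -> i <= a `|` c -> i <= b `|` c -> embeds L4 T.
Proof.
do 7 move/lt_both => [? ?]; move=> *.
apply: (diagram_embeds (f := nth o [:: o; a; b; c; d; i])); diagram_emb => //.
by do ?split; lateq 1.
Qed.

Lemma embeds_L3 o e a p b c i :
  o < e -> o < b -> e < a -> e < c -> a < p -> p < i -> b < p -> c < i ->
  a `&` b <= o -> c `&` b <= o -> p `&` c <= e ->
  p <= e `|` b -> i <= a `|` c -> i <= b `|` c -> embeds L3 T.
Proof.
do 8 move/lt_both => [? ?]; move=> *.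
apply: (diagram_embeds (f := nth o [:: o; e; a; p; b; c; i])); diagram_emb => //.
by do ?split; lateq 1.
Qed.

Lemma embeds_L1 o a b c p q i :
  o < a -> o < b -> o < c -> a < p -> b < p -> b < q -> c < q -> p < i -> q < i ->
  a `&` q <= o -> c `&` p <= o -> p `&` q <= b ->
  p <= a `|` b -> q <= b `|` c -> i <= a `|` c -> embeds L1 T.
Proof.
do 9 move/lt_both => [? ?]; move=> *.
apply: (diagram_embeds (f := nth o [:: o; a; b; c; p; q; i])); diagram_emb => //.
by do ?split; lateq 1.
Qed.

End SmallSublattices.

Lemma embeds_L5 (T : lattice) (o d a b c i : T) :
  a < i -> b < i -> c < i -> d < a -> d < b -> o < c -> o < d ->
  i <= a `|` b -> i <= a `|` c -> i <= b `|` c -> i <= d `|` c ->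
  a `&` b <= d -> a `&` c <= o -> b `&` c <= o -> embeds L5 T.
Proof.
move=> h1 h2 h3 h4 h5 h6 h7 h8 h9 h10 h11 h12 h13 h14.
by apply: embeds_dual; apply: (@embeds_L4 (dual_lattice T) i a b c d o).
Qed.

Section NonprimeAtom.
Variables (T : lattice) (z q s0 t0 : T).
Hypotheses (finT : listable T) (zP : forall x, z <= x).
Hypothesis (qP : forall x, q <= x \/ q `&` x <= z).
Hypotheses (nqs0 : ~~ (q <= s0)) (nqt0 : ~~ (q <= t0)) (qst0 : q <= s0 `|` t0).

(** The argument of Davey, Poguntke and Rival. Choose [s] maximal among the
    elements not above [q], then [m] maximal among the meets [s /\ x] with [x]
    neither above [q] nor below [s], then [t] minimal among the [x] realizing
    [m]. Every [x >= m] is then above [t] or meets [t] in [m], and a join of [t]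
    with an element of [s] that is not below [m] is above [q], by maximality of
    [m]. These two facts force one of the five sublattices, according to the
    positions of [t] with respect to [q \/ m] and [q \/ s], and of [s] with
    respect to [q \/ m] and [q \/ t]. *)
Theorem nonprime_atom :
  embeds M3 T \/ embeds L1 T \/ embeds L3 T \/ embeds L4 T \/ embeds L5 T.
Proof.
have [s [nqs s0s smax]] := ex_maximal (P := fun x => ~~ (q <= x)) finT nqs0.
have above x : ~~ (x <= s) -> q <= s `|` x.
  move=> xs; apply: contrapT => /negP /smax h; have := h (leUl _ _).
  by move=> e; case/negP: xs; rewrite -e leUr.
have ts0 : ~~ (t0 <= s).
  by apply: contra nqs => h; apply: le_trans qst0 _; lat 0.
pose P y := exists x, [/\ ~~ (q <= x), ~~ (x <= s) & y = s `&` x].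
have [|m [[x0 [nqx0 nx0s mE]] _ mmax]] := @ex_maximal _ P (s `&` t0) finT.
  by exists t0.
have mtop x : ~~ (q <= x) -> ~~ (x <= s) -> m <= x -> s `&` x <= m.
  move=> h1 h2 mx; rewrite (mmax (s `&` x)) //; first by exists x.
  by rewrite lexI mx mE leIl.
pose Q x := [/\ ~~ (q <= x), ~~ (x <= s) & m = s `&` x].
have [|t [[nqt nts mst] _ tmin]] := @ex_minimal _ Q x0 finT; first by split.
have mt : m <= t by rewrite mst leIr.
have ms : m <= s by rewrite mst leIl.
have stm : s `&` t <= m by rewrite -mst.
have cov x : m <= x -> ~~ (t <= x) -> x `&` t <= m.
  move=> mx ntx; have [h|h] := boolP (x `&` t <= s); first by apply: le_trans stm; lat 0.
  have mxt : m <= x `&` t by lat 0.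
  have nq : ~~ (q <= x `&` t) by apply: contra nqt => hq; lat 1.
  have e : x `&` t = t.
    apply: tmin; last exact: leIr.
    by split=> //; apply: le_anti; apply/andP; split; [lat 0|exact: mtop].
  by case/negP: ntx; rewrite -e leIl.
have qs : q `&` s <= z by case: (qP s) => // h; rewrite h in nqs.
have qt : q `&` t <= z by case: (qP t) => // h; rewrite h in nqt.
have zq : z < q.
  by apply: lt_of => //; apply: contra nqs => h; apply: le_trans h (zP _).
have zs := zP s; have zt := zP t; have zm := zP m; have zq' := zP q.
have qst := above _ nts.
have nst : ~~ (s <= t).
  by apply: contra nqt => h; apply: le_trans qst _; lat 0.
have nqm : ~~ (q <= m) by apply: contra nqs => h; lat 1.
have ms' : m < s by apply: lt_of => //; apply: contra nst => h; lat 1.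
have mt' : m < t by apply: lt_of => //; apply: contra nts => h; lat 1.
have mq_z : m <= q -> m <= z by move=> h; lat 1.
have [tn|ntn] := boolP (t <= q `|` m).
  have nmz : ~~ (m <= z).
    apply: contra nts => mz; have tq : t <= q by lat 2.
    by lat 1.
  have nmq : ~~ (m <= q) by apply: contra nmz.
  have zm' : z < m by apply: lt_of.
  have nnt : ~~ (q `|` m <= t) by apply: contra nqt => h; lat 1.
  have [qta|nqta] := boolP (q <= t `|` s `&` (q `|` m)).
    do 4 right; apply: (@embeds_L5 T z m (s `&` (q `|` m)) t q (q `|` m)) => //;
      try by lat 1.
    - by apply: lt_of; [lat 0|apply: contra nqs => h; lat 1].
    - by apply: lt_of; [lat 0|].
    - by apply: lt_of; [lat 0|apply: contra nmq => h; lat 1].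
    - apply: lt_of; first by lat 0.
      apply: contra nqt => h; apply: le_trans qta _; lat 1.
  have qv : (t `|` s `&` (q `|` m)) `&` q <= z.
    by rewrite meetC; case: (qP (t `|` s `&` (q `|` m))) => // h; rewrite h in nqta.
  right; right; left.
  apply: (@embeds_L3 T z (s `&` (q `|` m)) (t `|` s `&` (q `|` m)) (q `|` m) q s (q `|` s)) => //;
    try by lat 1.
  - by apply: lt_of; [lat 0|apply: contra nmz => h; lat 1].
  - by apply: lt_of; [lat 0|apply: contra nts => h; lat 1].
  - by apply: lt_of; [lat 0|apply: contra nqta => h; apply: le_trans qst _; lat 1].
  - by apply: lt_of; [lat 0|apply: contra nqta => h; lat 1].
  - by apply: lt_of; [lat 0|apply: contra nqta => h; apply: le_trans qst _; lat 1].
  - by apply: lt_of; [lat 0|apply: contra nmq => h; lat 1].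
  - by apply: lt_of; [lat 0|apply: contra nqs => h; lat 1].
have nt : (q `|` m) `&` t <= m by apply: cov => //; lat 0.
have wE : q `|` m `|` t <= q `|` t by lat 0.
have [bm|nbm] := boolP (s `&` (q `|` m) <= m); last first.
  have nmz : ~~ (m <= z) by apply: contra nbm => mz; apply: (le_trans _ (le_trans qs zm)); lat 2.
  have qtb : q <= t `|` s `&` (q `|` m).
    apply: contrapT => /negP h; case/negP: nbm; apply: le_trans (mtop _ h _ _); try by lat 0.
    by apply: contra nts => h'; lat 1.
  have nmq : ~~ (m <= q) by apply: contra nmz.
  right; right; left.
  apply: (@embeds_L3 T z m (s `&` (q `|` m)) (q `|` m) q t (q `|` t)) => //;
    try by lat 1.
  - by apply: lt_of.
  - by apply: lt_of; [lat 0|].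
  - by apply: lt_of; [lat 0|apply: contra nqs => h; lat 1].
  - by apply: lt_of; [lat 0|apply: contra ntn => h; lat 1].
  - by apply: lt_of; [lat 0|apply: contra nmq => h; lat 1].
  - by apply: lt_of; [lat 0|apply: contra nqt => h; lat 1].
have mn : m < q `|` m by apply: lt_of; [lat 0|apply: contra nqm => h; lat 1].
have nw : q `|` m < q `|` t by apply: lt_of; [lat 0|apply: contra ntn => h; lat 1].
have tw : t < q `|` t by apply: lt_of; [lat 0|apply: contra nqt => h; lat 1].
have nwm : ~~ (s <= m) by apply: contra nst => h; lat 1.
have [am|nam] := boolP ((q `|` t) `&` s <= m); last first.
  have qta : q <= t `|` (q `|` t) `&` s.
    apply: contrapT => /negP h; case/negP: nam; apply: le_trans (mtop _ h _ _); try by lat 0.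
    by apply: contra nts => h'; lat 1.
  have ma : m < (q `|` t) `&` s by apply: lt_of; [lat 0|].
  have aw : (q `|` t) `&` s < q `|` t.
    by apply: lt_of; [lat 0|apply: contra nqs => h; lat 1].
  have [tna|ntna] := boolP (t <= q `|` m `|` (q `|` t) `&` s).
    left; apply: (@embeds_M3 T m (q `|` m) t ((q `|` t) `&` s) (q `|` t)) => //;
      by lat 1.
  have tv : (q `|` m `|` (q `|` t) `&` s) `&` t <= m by apply: cov => //; lat 0.
  do 3 right; left.
  apply: (@embeds_L4 T m (q `|` m) ((q `|` t) `&` s) t (q `|` m `|` (q `|` t) `&` s) (q `|` t)) => //;
    try by lat 1.
  - by apply: lt_of; [lat 0|apply: contra nam => h; apply: le_trans bm; lat 1].
  - by apply: lt_of; [lat 0|apply: contra nqs => h; lat 1].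
  - by apply: lt_of; [lat 0|apply: contra ntna => h; lat 1].
have sw : q `|` t < s `|` t.
  by apply: lt_of; [lat 0|apply: contra nwm => h; apply: le_trans am; lat 1].
have si : s < s `|` t by apply: lt_of; [lat 0|apply: contra nts => h; lat 1].
have [ts1|nts1] := boolP (t <= q `|` s).
  do 3 right; left.
  apply: (@embeds_L4 T m (q `|` m) t s (q `|` t) (s `|` t)) => //; by lat 1.
have ts1 : (q `|` s) `&` t <= m by apply: cov => //; lat 0.
have nsw : ~~ (s <= q `|` t) by apply: contra nwm => h; apply: le_trans am; lat 1.
right; left.
apply: (@embeds_L1 T m t ((q `|` t) `&` (q `|` s)) s (q `|` t) (q `|` s) (s `|` t)) => //;
  try by lat 1.
- by apply: lt_of; [lat 1|apply: contra nqm => h; lat 1].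
- by apply: lt_of; [lat 0|apply: contra nts1 => h; lat 1].
- by apply: lt_of; [lat 0|apply: contra nsw => h; lat 1].
- by apply: lt_of; [lat 0|apply: contra nqs => h; lat 1].
- by apply: lt_of; [lat 0|apply: contra nts1 => h; lat 1].
Qed.
End NonprimeAtom.

(** * Operation tables *)

(** Meet and join tables of a lattice on [0, ..., n.-1]. *)
Definition model : Type := seq (seq nat) * seq (seq nat).

Definition mmeet (M : model) (a b : nat) : nat := nth 0%N (nth [::] M.1 a) b.
Definition mjoin (M : model) (a b : nat) : nat := nth 0%N (nth [::] M.2 a) b.
Definition mle (M : model) (a b : nat) : bool := mmeet M a b == a.
Definition mdual (M : model) : model := (M.2, M.1).
Definition msize (M : model) : nat := size M.1.

Fixpoint mev (M : model) (g : gen3 -> nat) (s : term gen3) : nat :=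
  match s with
  | Var v => g v
  | Meet s t => mmeet M (mev M g s) (mev M g t)
  | Join s t => mjoin M (mev M g s) (mev M g t)
  end.

Record codes (F : lattice) (M : model) (c : F -> nat) : Prop := Codes {
  codes_inj : injective c;
  codes_size : size M.2 = size M.1;
  codes_lt : forall x, (c x < msize M)%N;
  codes_onto : forall k, (k < msize M)%N -> exists x, c x = k;
  codes_meet : forall x y, c (x `&` y) = mmeet M (c x) (c y);
  codes_join : forall x y, c (x `|` y) = mjoin M (c x) (c y) }.

Definition coded F M : Prop := exists c, @codes F M c.

Section Codes.
Variables (F : lattice) (M : model) (c : F -> nat).
Hypothesis cP : codes M c.

Lemma codes_ev (d : gen3 -> F) s : c (ev d s) = mev M (c \o d) s.
Proof.
by elim: s => //= s IHs t IHt; rewrite ?(codes_meet cP) ?(codes_join cP) IHs IHt.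
Qed.

Lemma codes_le x y : (x <= y) = mle M (c x) (c y).
Proof. by rewrite /mle -(codes_meet cP) (inj_eq (codes_inj cP)) eq_meetl. Qed.

Lemma codes_listable : listable F.
Proof.
have [x0|nF] := pselect (exists x : F, True); last first.
  by exists [::] => x; case: nF; exists x.
have [x _] := x0.
have /choice[f fP] : forall k, exists y, (k < msize M)%N -> c y = k.
  move=> k; case: (ltnP k (msize M)) => [/(codes_onto cP)[y]|_]; last by exists x.
  by exists y.
exists (map f (iota 0 (msize M))) => y; apply/mapP; exists (c y).
  by rewrite mem_iota; exact: (codes_lt cP).
by apply: (codes_inj cP); rewrite fP //; exact: (codes_lt cP).
Qed.

Lemma codes_dual : codes (F := dual_lattice F) (mdual M) c.
Proof.
split=> //; rewrite /msize /= ?(codes_size cP) //.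
- exact: codes_inj cP.
- exact: codes_lt cP.
- exact: codes_onto cP.
- exact: codes_join cP.
- exact: codes_meet cP.
Qed.

End Codes.

Lemma coded_listable F M : coded F M -> listable F.
Proof. by move=> [c /codes_listable]. Qed.

Lemma coded_dual F M : coded F M -> coded (dual_lattice F) (mdual M).
Proof. by move=> [c /codes_dual]; exists c. Qed.

Definition model_of (D : seq (seq nat)) : model :=
  ([seq [seq hasse_meet D i j | j <- iota 0 (size D)] | i <- iota 0 (size D)],
   [seq [seq hasse_join D i j | j <- iota 0 (size D)] | i <- iota 0 (size D)]).

Lemma hasse_codes (D : diagram) : codes (F := hasse_lattice D) (model_of D) val.
Proof.
split.
- exact: val_inj.
- by rewrite /= !size_map.
- by move=> x; rewrite /msize /= size_map size_iota; exact: lt_hasse.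
- by move=> k; rewrite /msize /= size_map size_iota => kD; exists (Ordinal kD).
- move=> x y; rewrite val_hmeet /mmeet /=.
  by rewrite !(nth_map 0%N, nth_iota) ?size_iota ?add0n //; exact: lt_hasse.
- move=> x y; rewrite val_hjoin /mjoin /=.
  by rewrite !(nth_map 0%N, nth_iota) ?size_iota ?add0n //; exact: lt_hasse.
Qed.

Lemma hasse_coded (D : diagram) (M : model) :
  model_of D = M -> coded (hasse_lattice D) M.
Proof. by move=> <-; exists val; exact: hasse_codes. Qed.

Definition triples (n : nat) : seq (nat * nat * nat) :=
  [seq (ab, c) | ab <- [seq (a, b) | a <- iota 0 n, b <- iota 0 n], c <- iota 0 n].

Definition at3 (T : Type) (p : T * T * T) : gen3 -> T := mk3 p.1.1 p.1.2 p.2.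

Lemma mem_triples n (g : gen3 -> nat) : (forall v, (g v < n)%N) ->
  (g G0, g G1, g G2) \in triples n.
Proof.
move=> h; apply/allpairsPdep; exists (g G0, g G1), (g G2).
by rewrite mem_iota h; split=> //; apply/allpairsPdep; exists (g G0), (g G1); rewrite !mem_iota !h.
Qed.

Definition mvalid (M : model) (s t : term gen3) : bool :=
  all (fun p => mle M (mev M (at3 p) s) (mev M (at3 p) t)) (triples (msize M)).

Lemma mvalidP F M s t : coded F M ->
  mvalid M s t <-> (forall d : gen3 -> F, ev d s <= ev d t).
Proof.
move=> [c cP]; split=> [/allP h d|h].
  rewrite (codes_le cP) !(codes_ev cP) (mk3_eta (c \o d)).
  by have := h _ (@mem_triples _ (c \o d) (fun v => codes_lt cP (d v))).
apply/allP => -[[x y] w] /allpairsPdep[[x' y'] [w' [/allpairsPdep[x'' [y'' [h1 h2 [-> ->]]]] h3 [-> -> ->]]]].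
move: h1 h2 h3; rewrite !mem_iota !add0n /= => /(codes_onto cP)[a <-] /(codes_onto cP)[b <-] /(codes_onto cP)[e <-].
have -> : at3 (c a, c b, c e) = c \o mk3 a b e by apply: functional_extensionality_dep => -[].
by rewrite -!(codes_ev cP) -(codes_le cP).
Qed.

Definition mM3 : model := Eval vm_compute in model_of [:: [:: 1; 2; 3]; [:: 4]; [:: 4]; [:: 4]; [::]]%N.
Definition mN5 : model := Eval vm_compute in model_of [:: [:: 1; 3]; [:: 2]; [:: 4]; [:: 4]; [::]]%N.
Definition m2 : model := Eval vm_compute in model_of [:: [:: 1]; [::]]%N.
Definition mL1 : model := Eval vm_compute in
  model_of [:: [:: 1; 2; 3]; [:: 4]; [:: 4; 5]; [:: 5]; [:: 6]; [:: 6]; [::]]%N.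
Definition mL3 : model := Eval vm_compute in
  model_of [:: [:: 1; 4]; [:: 2; 5]; [:: 3]; [:: 6]; [:: 3]; [:: 6]; [::]]%N.
Definition mL4 : model := Eval vm_compute in
  model_of [:: [:: 1; 2; 3]; [:: 4]; [:: 4]; [:: 5]; [:: 5]; [::]]%N.
Definition mV1 : model := Eval vm_compute in
  model_of [:: [:: 1; 3; 4]; [:: 2]; [:: 5]; [:: 5]; [:: 5]; [::]]%N.
Definition mV2 : model := Eval vm_compute in
  model_of [:: [:: 1; 2]; [:: 7]; [:: 3; 4; 5]; [:: 6]; [:: 6]; [:: 6]; [:: 7]; [::]]%N.
Definition mV3 : model := Eval vm_compute in
  model_of [:: [:: 1; 2; 3]; [:: 4; 5]; [:: 4]; [:: 4]; [:: 7]; [:: 6]; [:: 7]; [::]]%N.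
Definition mV5 : model := Eval vm_compute in
  model_of [:: [:: 1; 2; 3]; [:: 4; 6]; [:: 4]; [:: 4]; [:: 5]; [:: 7]; [:: 7]; [::]]%N.
Definition mV6 : model := Eval vm_compute in
  model_of [:: [:: 1; 3]; [:: 2; 4]; [:: 8]; [:: 4; 5; 6]; [:: 7]; [:: 7]; [:: 7]; [:: 8]; [::]]%N.

Definition Two : lattice := hasse_lattice (@Diagram [:: [:: 1%N]; [::]] isT).

Lemma coded_Two : coded Two m2. Proof. by apply: hasse_coded; vm_compute. Qed.
Lemma coded_M3 : coded M3 mM3. Proof. by apply: hasse_coded; vm_compute. Qed.
Lemma coded_N5 : coded N5 mN5. Proof. by apply: hasse_coded; vm_compute. Qed.
Lemma coded_L1 : coded L1 mL1. Proof. by apply: hasse_coded; vm_compute. Qed.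
Lemma coded_L2 : coded L2 (mdual mL1). Proof. exact: coded_dual coded_L1. Qed.
Lemma coded_L3 : coded L3 mL3. Proof. by apply: hasse_coded; vm_compute. Qed.
Lemma coded_L4 : coded L4 mL4. Proof. by apply: hasse_coded; vm_compute. Qed.
Lemma coded_L5 : coded L5 (mdual mL4). Proof. exact: coded_dual coded_L4. Qed.
Lemma coded_V1 : coded V1 mV1. Proof. by apply: hasse_coded; vm_compute. Qed.
Lemma coded_V2 : coded V2 mV2. Proof. by apply: hasse_coded; vm_compute. Qed.
Lemma coded_V3 : coded V3 mV3. Proof. by apply: hasse_coded; vm_compute. Qed.
Lemma coded_V4 : coded V4 (mdual mV3). Proof. exact: coded_dual coded_V3. Qed.
Lemma coded_V5 : coded V5 mV5. Proof. by apply: hasse_coded; vm_compute. Qed.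
Lemma coded_V6 : coded V6 mV6. Proof. by apply: hasse_coded; vm_compute. Qed.
Lemma coded_V7 : coded V7 (mdual mV6). Proof. exact: coded_dual coded_V6. Qed.
Lemma coded_V8 : coded V8 (mdual mV5). Proof. exact: coded_dual coded_V5. Qed.

(** * The free modular lattice on three generators *)

Definition eq3 (u v : gen3) : bool :=
  match u, v with G0, G0 | G1, G1 | G2, G2 => true | _, _ => false end.

Fact eq3P : Equality.axiom eq3.
Proof. by move=> [] []; constructor. Qed.

HB.instance Definition _ := hasDecEq.Build gen3 eq3P.

(** Whitman's procedure for [s <= t]; each pair in [H] may be used once on a
    branch as an additional inequality. Nested conditionals keep the evaluation
    lazy. *)
Fixpoint whitman (H : seq (term gen3 * term gen3)) (n : nat) (s t : term gen3) : bool :=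
  if n is n'.+1 then
    let w := whitman H n' in
    match s with
    | Join s1 s2 => if w s1 t then w s2 t else false
    | _ =>
      match t with
      | Meet t1 t2 => if w s t1 then w s t2 else false
      | _ =>
        if (match t with Join t1 t2 => if w s t1 then true else w s t2 | _ => false end)
        then true else
        if (match s with Meet s1 s2 => if w s1 t then true else w s2 t | _ => false end)
        then true else
        match s, t with
        | Var u, Var v => eq3 u v
        | _, _ =>
          (fix use l := if l is (a, b) :: l' then
            if (if whitman [::] n' s a then whitman [::] n' b t else false) then true
            else use l' else false) H
        end
      end
    end
  else false.

Lemma whitmanP (L : lattice) (e : gen3 -> L) H n s t :
  (forall p, List.In p H -> ev e p.1 <= ev e p.2) ->
  whitman H n s t -> ev e s <= ev e t.
Proof.
elim: n H s t => // n IH H s t hH.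
have IH' := IH H _ _ hH; have IH0 := IH [::] _ _ (fun p (h : List.In p [::]) => False_ind _ h).
have useP l : (forall p, List.In p l -> ev e p.1 <= ev e p.2) ->
    (fix use l := if l is (a, b) :: l' then
            if (if whitman [::] n s a then whitman [::] n b t else false) then true
            else use l' else false) l -> ev e s <= ev e t.
  elim: l => // -[a b] l IHl hl.
  have {}IHl := IHl (fun p hp => hl p (or_intror hp)).
  case: (boolP (if whitman [::] n s a then _ else _)) => [+ _|_]; last by move=> h; apply: IHl; exact: h.
  case: ifP => // /IH0 h1 /IH0 h2; apply: le_trans h1 (le_trans _ h2).
  exact: (hl (a, b) (or_introl erefl)).
have joinr t1 t2 : t = Join t1 t2 -> (if whitman H n s t1 then true else whitman H n s t2) ->
    ev e s <= ev e t.
  move=> ->; case: ifP => [/IH' h _|_ /IH' h]; rewrite /=.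
    exact: le_trans h (leUl _ _).
  exact: le_trans h (leUr _ _).
have meetl s1 s2 : s = Meet s1 s2 -> (if whitman H n s1 t then true else whitman H n s2 t) ->
    ev e s <= ev e t.
  move=> ->; case: ifP => [/IH' h _|_ /IH' h]; rewrite /=.
    exact: le_trans (leIl _ _) h.
  exact: le_trans (leIr _ _) h.
have joinl s1 s2 : s = Join s1 s2 -> (if whitman H n s1 t then whitman H n s2 t else false) ->
    ev e s <= ev e t.
  by move=> ->; case: ifP => // /IH' h1 /IH' h2; rewrite /= leUx h1.
have meetr t1 t2 : t = Meet t1 t2 -> (if whitman H n s t1 then whitman H n s t2 else false) ->
    ev e s <= ev e t.
  by move=> ->; case: ifP => // /IH' h1 /IH' h2; rewrite /= lexI h1.
move: (useP H hH) joinr meetl joinl meetr => {useP IH IH' IH0}.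
case: s t => [u|s1 s2|s1 s2] [v|t1 t2|t1 t2] hu hjr hml hjl hmr /=;
  try (by apply: hjl); try (by apply: hmr).
- by case: u v {hu hjr hml hjl hmr} => -[].
- by case: ifP => [/hjr h _|_]; [exact: h|exact: hu].
- by case: ifP => [/hml h _|_]; [exact: h|exact: hu].
- case: ifP => [/hjr h _|_]; first exact: h.
  by case: ifP => [/hml h _|_]; [exact: h|exact: hu].
Qed.

Definition gens3 : seq gen3 := [:: G0; G1; G2].

(** Consequences of the modular law that relate the lower and upper medians of
    three elements. *)
Definition modular_facts_at (x y z : term gen3) : seq (term gen3 * term gen3) :=
  let m := Join (Meet x y) (Join (Meet y z) (Meet x z)) in
  let M := Meet (Join x y) (Meet (Join y z) (Join x z)) in
  [:: (Meet x (Join y (Meet x z)), Join (Meet x y) (Meet x z));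
      (Meet (Join x (Meet y z)) (Join y (Meet x z)), m);
      (Meet (Join x (Meet y z)) (Join y z), Join (Meet x (Join y z)) (Meet y z));
      (Meet x (Join y z), Join (Meet y (Join x z)) (Meet z (Join x y)));
      (Meet (Join x y) (Join x z), Join x (Meet y (Join x z)));
      (M, Join (Meet x (Join y z)) (Meet y (Join x z)));
      (Meet (Join y (Meet x z)) (Join z (Meet x y)), Join x (Meet y z))].

Lemma modular_facts_atP (L : lattice) (e : gen3 -> L) x y z :
  modular L -> forall p, List.In p (modular_facts_at x y z) -> ev e p.1 <= ev e p.2.
Proof.
move=> hL.
have M1 (u v w : L) : w <= u -> u `&` (v `|` w) <= (u `&` v) `|` w.
  move=> wu; apply: (@le_trans _ _ ((w `|` v) `&` u)); first by lat 0.
  by rewrite -(hL _ v _ wu); lat 0.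
have f1 (a b c : L) : a `&` (b `|` a `&` c) <= a `&` b `|` a `&` c by apply: M1; exact: leIl.
have f1d (a b c : L) : (a `|` b) `&` (a `|` c) <= a `|` b `&` (a `|` c).
  have h : (a `|` c) `&` (b `|` a) <= (a `|` c) `&` b `|` a by apply: M1; exact: leUl.
  by apply: (le_trans _ (le_trans h _)); lat 0.
have f3 (a b c : L) : (a `|` b `&` c) `&` (b `|` c) <= a `&` (b `|` c) `|` b `&` c.
  have h : (b `|` c) `&` (a `|` b `&` c) <= (b `|` c) `&` a `|` b `&` c by apply: M1; lat 0.
  by apply: (le_trans _ (le_trans h _)); lat 0.
have f2 (a b c : L) : (a `|` b `&` c) `&` (b `|` a `&` c) <= a `&` b `|` (b `&` c `|` a `&` c).
  have h : (b `|` a `&` c) `&` (a `|` b `&` c) <= (b `|` a `&` c) `&` a `|` b `&` c.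
    by apply: M1; lat 0.
  have h' := f1 a b c; apply: (le_trans _ (le_trans h _)); lat 1.
have f2d (a b c : L) : (a `|` b) `&` ((b `|` c) `&` (a `|` c)) <= a `&` (b `|` c) `|` b `&` (a `|` c).
  have h : (b `|` c) `&` (a `|` b) <= (b `|` c) `&` a `|` b by apply: M1; lat 0.
  have h' : (a `|` c) `&` (b `|` (b `|` c) `&` a) <= (a `|` c) `&` b `|` (b `|` c) `&` a.
    by apply: M1; lat 0.
  apply: (le_trans _ (le_trans h' _)); last by lat 0.
  rewrite lexI; apply/andP; split; first by lat 0.
  by apply: (le_trans _ (le_trans h _)); lat 0.
move=> p /= [|[|[|[|[|[|[|[]]]]]]]] <- /=; move: (ev e x) (ev e y) (ev e z) => a b c.
- exact: f1.
- exact: f2.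
- exact: f3.
- by apply: le_trans (_ : _ <= _) (le_trans (f2d b c a) _); lat 0.
- exact: f1d.
- exact: f2d.
- by apply: le_trans (le_trans _ (f2 b c a)) _; lat 0.
Qed.

Definition modular_facts : seq (term gen3 * term gen3) :=
  let x := Var G0 in let y := Var G1 in let z := Var G2 in
  modular_facts_at x y z ++ modular_facts_at x z y ++ modular_facts_at y x z ++
  modular_facts_at y z x ++ modular_facts_at z x y ++ modular_facts_at z y x.

(** Representatives of the 28 elements of the free modular lattice: the two
    Boolean intervals below the lower and above the upper median, and four
    elements for each generator. *)
Definition fm28 : seq (term gen3) :=
  let half (x y z : term gen3) (M J : term gen3 -> term gen3 -> term gen3) :=
    [:: M x (M y z); M x y; M y z; M z x; J (M x y) (M x z); J (M y z) (M y x);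
        J (M z x) (M z y); J (M x y) (J (M y z) (M x z))] in
  let side (x y z : term gen3) :=
    [:: x; Meet x (Join y z); Join x (Meet y z); Join (Meet x (Join y z)) (Meet y z)] in
  let x := Var G0 in let y := Var G1 in let z := Var G2 in
  half x y z (@Meet _) (@Join _) ++ half x y z (@Join _) (@Meet _) ++
  side x y z ++ side y z x ++ side z x y.

(* The generators of [M3], and the valuations in its two-element sublattice. *)
Definition fm28_points : seq (nat * nat * nat) :=
  (1, 2, 3)%N :: [seq (4 * p.1.1, 4 * p.1.2, 4 * p.2)%N | p <- triples 2].

Definition fm28_value (s : term gen3) : seq nat :=
  [seq mev mM3 (at3 p) s | p <- fm28_points].

Definition fm28_le (v w : seq nat) : bool :=
  all (fun p => mle mM3 p.1 p.2) (zip v w).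

Definition fm28_nf (s : term gen3) : term gen3 :=
  let v := fm28_value s in nth s fm28 (find (fun t => fm28_value t == v) fm28).

Definition fm28_check : bool :=
  let w := whitman modular_facts 20 in
  [&& all (fun v => has (fun t => if t is Var u then eq3 u v else false) fm28) gens3,
      all (fun s => all (fun t =>
        all (fun u => let nf := fm28_nf u in
               [&& has (fun r => fm28_value r == fm28_value u) fm28, w u nf & w nf u])
            [:: Meet s t; Join s t]) fm28) fm28 &
      all (fun s => all (fun t => if fm28_le (fm28_value s) (fm28_value t) then w s t else true)
                        fm28) fm28].

Lemma fm28_checkE : fm28_check.
Proof. by vm_compute. Qed.

Lemma fm28_valueP s t : fm28_value s = fm28_value t <->
  forall p, p \in fm28_points -> mev mM3 (at3 p) s = mev mM3 (at3 p) t.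
Proof. by rewrite /fm28_value; split=> [/eq_in_map|h]; [|apply/eq_in_map]. Qed.

Lemma fm28_normal (L : lattice) (e : gen3 -> L) s : modular L ->
  exists r, [/\ r \in fm28, fm28_value s = fm28_value r & ev e s = ev e r].
Proof.
move=> hL.
have hH p : List.In p modular_facts -> ev e p.1 <= ev e p.2.
  by rewrite /modular_facts !In_cat; move=> [|[|[|[|[|]]]]]; exact: modular_facts_atP.
have /and3P[/allP h1 /allP h2 _] := fm28_checkE.
have step u : (exists s' t', [/\ s' \in fm28, t' \in fm28 & u = Meet s' t' \/ u = Join s' t']) ->
    exists r, [/\ r \in fm28, fm28_value u = fm28_value r & ev e u = ev e r].
  move=> [s' [t' [hs ht hu]]]; have /allP/(_ t' ht) : all _ fm28 := h2 s' hs.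
  have {hu} : List.In u [:: Meet s' t'; Join s' t'] by case: hu => ->; [left|right; left].
  move=> hu /and3P[ha hb _].
  have : [&& has (fun r => fm28_value r == fm28_value u) fm28,
          whitman modular_facts 20 u (fm28_nf u) & whitman modular_facts 20 (fm28_nf u) u].
    by case: hu => [<-|[<-|//]].
  case/and3P=> hr /(whitmanP hH) h3 /(whitmanP hH) h4; exists (fm28_nf u); split.
  - by rewrite /fm28_nf mem_nth // -has_find.
  - by rewrite /fm28_nf; have /eqP -> := nth_find u hr.
  - by apply: le_anti; apply/andP.
elim: s => [v|s [s' [hs vs es]] t [t' [ht vt et]]|s [s' [hs vs es]] t [t' [ht vt et]]].
- have /h1/hasP[[u|//|//] hu] : v \in gens3 by case: v; rewrite !inE ?eqxx ?orbT.
  by move=> huv; exists (Var u); split=> //; case: u v huv {hu} => -[].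
- have [|r [hr vr er]] := step (Meet s' t'); first by exists s', t'; split=> //; left.
  exists r; split=> //; last by rewrite -er /= es et.
  rewrite -vr; apply/fm28_valueP => p hp /=.
  by rewrite ((fm28_valueP _ _).1 vs) // ((fm28_valueP _ _).1 vt).
- have [|r [hr vr er]] := step (Join s' t'); first by exists s', t'; split=> //; right.
  exists r; split=> //; last by rewrite -er /= es et.
  rewrite -vr; apply/fm28_valueP => p hp /=.
  by rewrite ((fm28_valueP _ _).1 vs) // ((fm28_valueP _ _).1 vt).
Qed.

(** The representatives [fm28] are pairwise distinguished by their values in
    [M3], and the modular facts reduce every term to one of them. *)
Lemma modular_M3 (L : lattice) (e : gen3 -> L) s t : modular L ->
  (forall d : gen3 -> M3, ev d s <= ev d t) -> ev e s <= ev e t.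
Proof.
move=> hL /(mvalidP s t coded_M3)/allP hst.
have [[s' [hs vs ->]] [t' [ht vt ->]]] := (fm28_normal e s hL, fm28_normal e t hL).
have /and3P[_ _ /allP h] := fm28_checkE.
have /allP/(_ t' ht) : all _ fm28 := h s' hs.
case: ifP => [_|/negP[]]; last first.
  rewrite -vs -vt; apply/allP => -[a b]; rewrite /fm28_value.
  have : {subset fm28_points <= triples 5} by apply/allP; vm_compute.
  elim: fm28_points => // p l IH hp; rewrite [zip _ _]/=; rewrite in_cons => /orP[/eqP[-> ->]|]; last first.
    by apply: IH => r hr; apply: hp; rewrite in_cons hr orbT.
  by apply: hst; apply: hp; rewrite in_cons eqxx.
apply: whitmanP => p; rewrite /modular_facts !In_cat; move=> [|[|[|[|[|]]]]]; exact: modular_facts_atP.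
Qed.

Lemma modular_sub_sat3 Fs : List.In M3 Fs -> subclass modular (sat3 Fs).
Proof. by move=> hM L hL s t hst e; apply: modular_M3 => //; exact: hst. Qed.

(** * Join-irreducible covers of the variety generated by the pentagon *)

(** An iterated form of meet-semidistributivity, which [N5] satisfies together
    with its dual, whereas each of [M3], [L1], ..., [L5] violates one of them. *)
Definition sd_lhs : term gen3 :=
  let x := Var G0 in let y := Var G1 in let z := Var G2 in Meet x (Join y z).
Definition sd_rhs : term gen3 :=
  let x := Var G0 in let y := Var G1 in let z := Var G2 in
  Join y (Meet x (Join z (Meet x y))).

Fixpoint tdual V (s : term V) : term V :=
  match s with
  | Var v => Var v
  | Meet s t => Join (tdual s) (tdual t)
  | Join s t => Meet (tdual s) (tdual t)
  end.

Lemma tdualK V : involutive (@tdual V).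
Proof. by elim=> //= s -> t ->. Qed.

Lemma ev_dual (L : lattice) V (e : V -> L) (s : term V) :
  ev (e : V -> dual_lattice L) s = ev e (tdual s).
Proof. by elim: s => //= s IHs t IHt; [rewrite -IHs -IHt|rewrite -IHs -IHt]. Qed.

Lemma mev_dual M g s : mev (mdual M) g s = mev M g (tdual s).
Proof. by elim: s => //= s IHs t IHt; rewrite IHs IHt. Qed.

Lemma not_gen_N5 S M : coded S M ->
  ~~ mvalid M sd_lhs sd_rhs || ~~ mvalid M (tdual sd_rhs) (tdual sd_lhs) -> ~ gen N5 S.
Proof.
move=> cS h /gen_models hS; move: h; apply/negP; rewrite negb_or !negbK.
by apply/andP; split; apply/(mvalidP _ _ cS)/hS/(mvalidP _ _ coded_N5); vm_compute.
Qed.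

(** The join of the varieties of [N5] and [S] would lie strictly above the former
    and below its cover, hence equal the cover, against join-irreducibility. *)
Lemma cover_excludes F S : vcovers (gen N5) (gen F) -> vjoin_irreducible (gen F) ->
  ~ gen N5 S -> ~ eqclass (gen F) (gen S) -> ~ gen F S.
Proof.
move=> [vN vF [NF nFN] between] irr nS neq FS.
pose Y := vjoin (gen N5) (gen S).
have YF : subclass Y (gen F).
  by apply: vjoin_min => //; apply: gen_min.
have NY : psubclass (gen N5) Y.
  split; first exact: sub_vjoinl.
  by move=> h; apply: nS; apply: h; apply: sub_vjoinr; exact: gen_id.
have FY : subclass (gen F) Y.
  by apply: contrapT => h; apply: (between Y (vjoin_variety _ _) NY).
have [] := irr _ _ vN (gen_variety S) (fun L => conj (FY L) (YF L)) => h.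
  by apply: nFN => L /h.
exact: neq.
Qed.

Lemma M3_modular : modular M3.
Proof.
move=> x y z xz; apply: le_anti; apply/andP; split; first by lat 1.
have := (mvalidP (Meet (Join (Meet (Var G0) (Var G2)) (Var G1)) (Var G2))
  (Join (Meet (Var G0) (Var G2)) (Meet (Var G1) (Var G2))) coded_M3).1 isT (mk3 x y z).
by rewrite /= (meet_l xz).
Qed.

Lemma N5_not_modular : ~ modular N5.
Proof.
move=> /modular_M3 h.
have : mvalid mN5 (Meet (Join (Meet (Var G0) (Var G2)) (Var G1)) (Var G2))
  (Join (Meet (Var G0) (Var G2)) (Meet (Var G1) (Var G2))).
  by apply/(mvalidP _ _ coded_N5) => d; apply: h; apply/(mvalidP _ _ coded_M3).
by vm_compute.
Qed.

Lemma jonsson_rival_excludes (K : 'I_10 -> lattice) : jonsson_rival_rest K ->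
  forall k S, List.In S [:: M3; L1; L2; L3; L4; L5] -> ~ gen (K k) S.
Proof.
move=> [_ hcov hneq _] k S hS; have [cov irr] := hcov k; apply: cover_excludes => //.
  by case: hS => [<-|[<-|[<-|[<-|[<-|[<-|//]]]]]]; [apply: (not_gen_N5 coded_M3)
   | apply: (not_gen_N5 coded_L1) | apply: (not_gen_N5 coded_L2) | apply: (not_gen_N5 coded_L3)
   | apply: (not_gen_N5 coded_L4) | apply: (not_gen_N5 coded_L5)]; vm_compute.
case: hS => [<-|hS]; last exact: hneq.
have [_ _ [NF _] _] := cov => h; apply: N5_not_modular.
apply: (gen_min modular_variety M3_modular); apply/h/NF; exact: gen_id.
Qed.

(** * Types of atoms *)

(** Three generators of a lattice given by its tables. A type is such a pointed
    lattice [P] together with an atom of it; in a lattice having [P] as a quotient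
    it determines the filter of the elements mapped above that atom. *)
Definition pointed : Type := model * (nat * nat * nat).
Definition ptype : Type := pointed * nat.

Definition peval (P : pointed) (s : term gen3) : nat := mev P.1 (at3 P.2) s.
Definition ple (P : pointed) (s t : term gen3) : bool := mle P.1 (peval P s) (peval P t).

(** The lattice presented by [R] maps onto the pointed lattice [P]. *)
Definition present (R : lpre gen3) (P : pointed) : Prop := forall s t, R s t -> ple P s t.

Definition above (a : ptype) (s : term gen3) : bool := mle a.1.1 a.2 (peval a.1 s).

(** [s] is an atom in the quotient by [R]. *)
Definition atom_term (R : lpre gen3) (s : term gen3) : Prop :=
  exists z, [/\ forall u, R z u, ~ R s z & forall u, R s u \/ R (Meet s u) z].

(** Every atom of a quotient of a three-generated sublattice of [F] is mapped
    above the atom of a type in [T], by a homomorphism onto its pointed lattice. *)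
Definition atoms_typed (T : seq ptype) (F : lattice) : Prop :=
  forall (d : gen3 -> F) (R : lpre gen3), sublpre (evle d) R ->
  forall s, atom_term R s -> exists a, [/\ a \in T, present R a.1 & above a s].

Definition two_points : seq pointed :=
  [seq (m2, p) | p <- [:: (0, 0, 1); (0, 1, 0); (0, 1, 1); (1, 0, 0); (1, 0, 1); (1, 1, 0)]%N].

Definition two_types : seq ptype := [seq (P, 1%N) | P <- two_points].

(** A join-prime atom [s] gives the homomorphism onto the two-element chain that
    sends [x] to the truth value of [s <= x]. *)
Lemma prime_atom_typed (R : lpre gen3) s : atom_term R s ->
  (forall u v, R s (Join u v) -> R s u \/ R s v) ->
  exists a, [/\ a \in two_types, present R a.1 & above a s].
Proof.
move=> [z [zP nsz _]] prime.
pose g v : nat := `[< R s (Var v) >].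
have gE u : mev m2 g u = `[< R s u >] :> nat.
  elim: u => //= u -> v ->.
    have -> : `[< R s (Meet u v) >] = `[< R s u >] && `[< R s v >].
      by rewrite -asbool_and; apply: asbool_equiv_eq; exact: lpre_meetP.
    by case: asboolP => _; case: asboolP => _; vm_compute.
  have -> : `[< R s (Join u v) >] = `[< R s u >] || `[< R s v >].
    rewrite -asbool_or; apply: asbool_equiv_eq; split; first exact: prime.
    case=> h; apply: lpre_trans h _; [exact: lpre_joinl|exact: lpre_joinr].
  by case: asboolP => _; case: asboolP => _; vm_compute.
pose p := (g G0, g G1, g G2).
have pg : at3 p = g by rewrite (mk3_eta g).
exists ((m2, p), 1%N); split.
- apply: map_f; apply: (map_f (fun q => (m2, q))).
  have : p != (0, 0, 0)%N /\ p != (1, 1, 1)%N.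
    split; apply/eqP => h.
      have : mev m2 (at3 p) s = 0%N.
        rewrite h; elim: (s) => [[]|u /= -> v ->|u /= -> v ->] //; by vm_compute.
      by rewrite pg gE; case: asboolP => // -[]; exact: lpre_refl.
    have : mev m2 (at3 p) z = 1%N.
      rewrite h; elim: (z) => [[]|u /= -> v ->|u /= -> v ->] //; by vm_compute.
    by rewrite pg gE; case: asboolP.
  by rewrite /p /g; do 3 case: asboolP => _; rewrite !inE; case.
- move=> u v huv; rewrite /ple /peval /= pg !gE.
  case: asboolP => [hu|_]; last by case: asboolP => _; vm_compute.
  by case: asboolP => [_|[]]; [vm_compute|exact: lpre_trans huv].
- by rewrite /above /peval /= pg gE; case: asboolP => [_|[]]; [vm_compute|exact: lpre_refl].
Qed.

(** By [nonprime_atom] all the atoms involved are join-prime. *)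
Lemma atoms_typed_two (F : lattice) : listable F ->
  (forall S T, List.In S [:: M3; L1; L3; L4; L5] -> embeds S T -> ~ gen F T) ->
  atoms_typed two_types F.
Proof.
move=> finF hF d R dR s hs; have [z [zP nsz atm]] := hs.
apply: prime_atom_typed => // u v suv; apply: contrapT => /not_orP[nu nv].
have finT : listable (quot R).
  by apply: (listable_gen (qvar_gen (R := R))); apply: fin_index_sub (fin_index_evle d finF) => a b /dR h; apply/qvarP.
have inF : gen F (quot R).
  apply: (@HSP_eval _ _ _ (qvar R) unit (fun=> F) (fun=> d)) => //; first exact: qvar_gen.
  by move=> a b /(_ tt) h; apply/qvarP; exact: dR.
pose h := ev (qvar R).
have h1 x : h z <= x by have [a <-] := qvar_gen x; apply/qvarP.
have h2 x : h s <= x \/ h s `&` x <= h z.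
  have [a <-] := qvar_gen x; have [] := atm a => ha; [left|right]; first by apply/qvarP.
  by apply: (qvarP R (Meet s a) z).2.
have h3 : ~~ (h s <= h u) by apply/negP => /qvarP.
have h4 : ~~ (h s <= h v) by apply/negP => /qvarP.
have h5 : h s <= h u `|` h v by apply: (qvarP R s (Join u v)).2.
have [|[|[|[|]]]] := nonprime_atom finT h1 h2 h3 h4 h5;
  move=> /hF; apply => //; rewrite /=; tauto.
Qed.

Lemma embeds_codes (F F' : lattice) M M' c c' (f : seq nat) :
  codes (F := F) M c -> codes (F := F') M' c' ->
  size f = msize M -> uniq f -> all (fun k => (k < msize M')%N) f ->
  all (fun a => all (fun b => (nth 0%N f (mmeet M a b) == mmeet M' (nth 0%N f a) (nth 0%N f b)) &&
    (nth 0%N f (mjoin M a b) == mjoin M' (nth 0%N f a) (nth 0%N f b)))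
    (iota 0 (msize M))) (iota 0 (msize M)) ->
  embeds F F'.
Proof.
move=> cP cP' sf uf /allP ltf /allP hf.
have /choice[g gP] x : exists y, c' y = nth 0%N f (c x).
  by apply: (codes_onto cP'); apply: ltf; rewrite mem_nth // sf; exact: codes_lt cP _.
have ops x y : nth 0%N f (mmeet M (c x) (c y)) = mmeet M' (nth 0%N f (c x)) (nth 0%N f (c y)) /\
    nth 0%N f (mjoin M (c x) (c y)) = mjoin M' (nth 0%N f (c x)) (nth 0%N f (c y)).
  have mem w : c w \in iota 0 (msize M) by rewrite mem_iota; exact: codes_lt cP _.
  have /allP h : all _ _ := hf _ (mem x).
  by have /andP[/eqP -> /eqP ->] := h _ (mem y).
exists g; split=> [x y|x y|x y].
- move=> /(congr1 c'); rewrite !gP => /eqP; rewrite nth_uniq ?sf //; try exact: codes_lt cP _.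
  by move=> /eqP/(codes_inj cP).
- apply: (codes_inj cP'); rewrite (codes_meet cP') !gP (codes_meet cP).
  by have [] := ops x y.
- apply: (codes_inj cP'); rewrite (codes_join cP') !gP (codes_join cP).
  by have [] := ops x y.
Qed.

Lemma M3_selfdual : embeds M3 (dual_lattice M3).
Proof.
have [c cP] := coded_M3.
by apply: (@embeds_codes _ _ _ _ _ _ [:: 4; 1; 2; 3; 0]%N cP (codes_dual cP)); vm_compute.
Qed.

Lemma L3_selfdual : embeds L3 (dual_lattice L3).
Proof.
have [c cP] := coded_L3.
by apply: (@embeds_codes _ _ _ _ _ _ [:: 6; 3; 2; 1; 5; 4; 0]%N cP (codes_dual cP)); vm_compute.
Qed.

Lemma gen_dual (F L : lattice) : gen F L -> gen (dual_lattice F) (dual_lattice L).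
Proof.
move=> /gen_models h; apply/gen_models => V s t hst e.
rewrite (ev_dual (e : V -> L)) (ev_dual (e : V -> L) t).
apply: (h V (tdual t) (tdual s)) => d.
have := hst (d : V -> dual_lattice F); by rewrite !ev_dual.
Qed.

Section CoverAtoms.
Variable K : 'I_10 -> lattice.
Hypothesis hK : jonsson_rival_rest K.

Lemma cover_listable k : listable (K k).
Proof.
have [h _ _ _] := hK; have [/finite_seqP[l hl] _] := h k.
by exists l => x; have : [set: K k]%classic x by []; rewrite hl.
Qed.

Lemma cover_atoms k : atoms_typed two_types (K k).
Proof.
apply: atoms_typed_two; first exact: cover_listable.
move=> S T hS ST KT; apply: (jonsson_rival_excludes hK (k := k) (S := S)).
  by move: hS => /=; tauto.
exact: embeds_in (gen_variety _) ST KT.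
Qed.

Lemma cover_coatoms k : atoms_typed two_types (dual_lattice (K k)).
Proof.
apply: atoms_typed_two; first exact/listable_dual/cover_listable.
move=> S T hS ST /gen_dual KT.
have {ST} ST' : embeds (dual_lattice S) (dual_lattice T) by apply: embeds_dual.
have {}KT : gen (K k) (dual_lattice T).
  move: KT => /gen_models h; apply/gen_models => V s t hst; apply: h => d.
  rewrite (ev_dual (d : V -> dual_lattice (K k))) (ev_dual (d : V -> dual_lattice (K k)) t).
  by rewrite !(ev_dual (d : V -> K k)) !tdualK; exact: hst.
have {KT ST'} : gen (K k) (dual_lattice S) by exact: embeds_in (gen_variety _) ST' KT.
have excl := jonsson_rival_excludes hK (k := k).
case: hS => [<-|[<-|[<-|[<-|[<-|//]]]]].
- by move=> /(embeds_in (gen_variety _) M3_selfdual); apply: excl; rewrite /=; tauto.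
- by apply: (excl L2); rewrite /=; tauto.
- by move=> /(embeds_in (gen_variety _) L3_selfdual); apply: excl; rewrite /=; tauto.
- by apply: (excl L5); rewrite /=; tauto.
- by apply: (excl L4); rewrite /=; tauto.
Qed.

End CoverAtoms.

(** * Sublattices generated by three elements of a finite lattice *)

Section Closure.
Variables (A : eqType) (opm opj : A -> A -> A) (g : gen3 -> A).

Fixpoint kev (s : term gen3) : A :=
  match s with
  | Var v => g v
  | Meet s t => opm (kev s) (kev t)
  | Join s t => opj (kev s) (kev t)
  end.

Definition insert_entry (l : seq (A * term gen3)) x := if x.1 \in map fst l then l else x :: l.

Fixpoint close_up (n : nat) (l : seq (A * term gen3)) :=
  if n is n'.+1 then
    let l' := foldl (fun acc x => foldl (fun acc y =>
       insert_entry (insert_entry acc (opm x.1 y.1, Meet x.2 y.2)) (opj x.1 y.1, Join x.2 y.2))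
         acc l) l l in
    if size l' == size l then l else close_up n' l'
  else l.

(** The elements of the generated sublattice, each with a term for it. Only the
    result is verified, by [generated_ok]. *)
Definition generated : seq (A * term gen3) :=
  close_up 20 (foldl insert_entry [::] [seq (g v, Var v) | v <- gens3]).

Definition generated_ok (l : seq (A * term gen3)) : bool :=
  let k := map fst l in
  [&& all (fun v => g v \in k) gens3,
      all (fun x => all (fun y => (opm x y \in k) && (opj x y \in k)) k) k &
      all (fun x => kev x.2 == x.1) l].

Lemma generated_okP l : generated_ok l ->
  (forall s, kev s \in map fst l) /\ (forall x, x \in l -> kev x.2 = x.1).
Proof.
case/and3P=> /allP h1 /allP h2 /allP h3; split=> [s|x /h3/eqP //].
have h4 x y : x \in map fst l -> y \in map fst l -> (opm x y \in map fst l) /\ (opj x y \in map fst l).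
  by move=> hx hy; have /allP h : all _ _ := h2 _ hx; have /andP := h _ hy.
elim: s => [v|s hs t ht|s hs t ht] /=; first by apply: h1; case: v.
- by have [] := h4 _ _ hs ht.
- by have [] := h4 _ _ hs ht.
Qed.

Definition entry (l : seq (A * term gen3)) (k : A) : A * term gen3 :=
  nth (k, Var G0) l (find (fun x => x.1 == k) l).

End Closure.

Lemma mevE M p s : mev M (at3 p) s = kev (mmeet M) (mjoin M) (at3 p) s.
Proof. by elim: s => //= s -> t ->. Qed.

Definition gen_entries (M : model) p := generated (mmeet M) (mjoin M) (at3 p).
Definition gen_ok (M : model) p l := generated_ok (mmeet M) (mjoin M) (at3 p) l.

Definition related (B : seq (seq bool)) (x y : nat) : bool := nth false (nth [::] B x) y.

Definition relation_table (M : model) (keys : seq nat) (f : nat -> nat -> bool) : seq (seq bool) :=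
  [seq if x \in keys then [seq f x y | y <- iota 0 (msize M)] else [::] | x <- iota 0 (msize M)].

Definition translate_step (M : model) (keys : seq nat) (B : seq (seq bool)) :=
  relation_table M keys (fun x y =>
    if related B x y then true else
    has (fun w => related B (mmeet M x w) (mmeet M y w) ||
                  related B (mjoin M x w) (mjoin M y w)) keys).

Fixpoint stabilize (step : seq (seq bool) -> seq (seq bool)) (n : nat) (B : seq (seq bool)) :=
  if n is n'.+1 then
    let B' := step B in if B' == B then B else stabilize step n' B'
  else B.

(** Pairs translated by unary polynomials into a pair with exactly one
    component above [b]; if [b] becomes an atom in a quotient, such a pair
    is not collapsed. *)
Definition translates (M : model) (keys : seq nat) (b : nat) : seq (seq bool) :=
  stabilize (translate_step M keys) 20
    (relation_table M keys (fun x y => mle M b x != mle M b y)).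

Fixpoint has_lazy T (a : T -> bool) (l : seq T) : bool :=
  if l is x :: l' then if a x then true else has_lazy a l' else false.

Lemma has_lazyE T (a : T -> bool) l : has_lazy a l = has a l.
Proof. by elim: l => //= x l ->. Qed.

(* The table of the map sending the value of a term in [M] to its value in
   the pointed lattice [P]. *)
Definition map_table (M : model) (l : seq (nat * term gen3)) (P : pointed) : seq nat :=
  [seq peval P (entry l k).2 | k <- iota 0 (msize M)].

Definition typed_by (M : model) (p : nat * nat * nat) (l : seq (nat * term gen3))
    (r : nat -> nat -> bool) (j : nat) (a : ptype) : bool :=
  let P := a.1 in
  let keys := map fst l in
  let f := map_table M l P in
  let h x := nth 0%N f x in
  if all (fun v => h (at3 p v) == at3 P.2 v) gens3 then
  if mle P.1 a.2 (h j) then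
  if all (fun x => all (fun y => (h (mmeet M x y) == mmeet P.1 (h x) (h y)) &&
             (h (mjoin M x y) == mjoin P.1 (h x) (h y))) keys) keys then
  if all (fun x => all (fun y => if h x == h y then true else r x y) keys) keys then
  all (fun y => if mle P.1 (h j) (h y) then mle P.1 a.2 (h y) else true) keys
  else false else false else false else false.

Definition bottom_term : term gen3 := Meet (Meet (Var G0) (Var G1)) (Var G2).

(** Let [j] be the least element of the sublattice representing an atom of a
    quotient. The elements strictly below [j] are collapsed to the bottom; so is
    their join [js], which therefore differs from [j], while pairs with exactly
    one component above [j], and all that translate to them, stay apart. It is
    enough to find a map onto a pointed lattice that separates only such pairs,
    since it then factors through every quotient in which [j] is an atom. *)
Definition atom_check_at (T : seq ptype) (M : model) (p : nat * nat * nat)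
    (l : seq (nat * term gen3)) : bool :=
  let keys := map fst l in
  let z := mev M (at3 p) bottom_term in
  if gen_ok M p l then
    all (fun j =>
      if j == z then true else
      let js := foldr (mjoin M) z [seq a <- keys | (a != j) && mle M a j] in
      if js == j then true else
      if has_lazy (typed_by M p l (fun x y => mle M j x != mle M j y) j) T then true else
      let B := translates M keys j in
      if related B z js then true else has_lazy (typed_by M p l (related B) j) T) keys
  else false.

Definition atom_check (T : seq ptype) (M : model) : bool :=
  all (fun p => atom_check_at T M p (gen_entries M p)) (triples (msize M)).

Lemma bottom_termP (R : lpre gen3) s : R bottom_term s.
Proof.
elim: s => [v|s hs t ht|s hs t ht].
- case: v; last exact: lpre_meetr.
    by apply: lpre_trans (lpre_meetl _ _ _) (lpre_meetl _ _ _).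
  by apply: lpre_trans (lpre_meetl _ _ _) (lpre_meetr _ _ _).
- exact/lpre_meetP.
- by apply: lpre_trans hs (lpre_joinl _ _ _).
Qed.

Section AtomCheck.
Variables (F : lattice) (M : model) (c : F -> nat).
Hypothesis cP : codes M c.
Variables (T : seq ptype) (d : gen3 -> F) (R : lpre gen3).
Hypothesis dR : sublpre (evle d) R.

Let p := (c (d G0), c (d G1), c (d G2)).

Lemma code_ev s : c (ev d s) = mev M (at3 p) s.
Proof. by rewrite (codes_ev cP) (mk3_eta (c \o d)). Qed.

Lemma code_eqR s t : mev M (at3 p) s = mev M (at3 p) t -> R s t.
Proof.
by rewrite -!code_ev => /(codes_inj cP) h; apply: dR; rewrite /= h.
Qed.

Definition collapsed (a b : nat) : Prop :=
  exists s t, [/\ mev M (at3 p) s = a, mev M (at3 p) t = b, R s t & R t s].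

Lemma translatesP keys b :
  (forall k, k \in keys -> exists s, mev M (at3 p) s = k) ->
  (forall x y, mle M b x != mle M b y -> ~ collapsed x y) ->
  forall x y, related (translates M keys b) x y -> ~ collapsed x y.
Proof.
move=> hk hb; rewrite /translates.
have tableP f x y : related (relation_table M keys f) x y -> f x y.
  rewrite /related /relation_table; case: (ltnP x (msize M)) => hx; last first.
    by rewrite [nth [::] _ x]nth_default ?size_map ?size_iota // nth_nil.
  rewrite (nth_map 0%N) ?size_iota // nth_iota // add0n; case: ifP => _; last by rewrite nth_nil.
  case: (ltnP y (msize M)) => hy; last by rewrite nth_default ?size_map ?size_iota.
  by rewrite (nth_map 0%N) ?size_iota // nth_iota.
set B0 := relation_table _ _ _.
have : forall x y, related B0 x y -> ~ collapsed x y.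
  by move=> x y /tableP; exact: hb.
elim: 20%N B0 => // n IH B hB /=; case: ifP => // _; apply: IH => x y /tableP.
case: ifP => [h _|_]; first exact: hB.
move=> /hasP[w /hk[sw hw]] h [s [t [h1 h2 h3 h4]]]; case/orP: h => /hB; apply.
  exists (Meet s sw), (Meet t sw); rewrite /= h1 h2 hw; split=> //; exact: lpre_meet_mono.
exists (Join s sw), (Join t sw); rewrite /= h1 h2 hw; split=> //; exact: lpre_join_mono.
Qed.

Lemma typed_byP l r j a s1 : gen_ok M p l -> typed_by M p l r j a ->
  (forall x y, r x y -> ~ collapsed x y) -> mev M (at3 p) s1 = j ->
  present R a.1 /\ forall s, R s1 s -> above a s.
Proof.
move=> /generated_okP[keysP evP]; rewrite /typed_by.
case: ifP => // /allP h1; case: ifP => // h3; case: ifP => // /allP h2.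
case: ifP => // /allP h4 /allP h6 hB sj.
have keysP' s : mev M (at3 p) s \in map fst l by rewrite mevE.
pose h x := nth 0%N (map_table M l a.1) x.
have hE s : peval a.1 s = h (mev M (at3 p) s).
  have h2' x y : x \in map fst l -> y \in map fst l ->
      h (mmeet M x y) = mmeet a.1.1 (h x) (h y) /\ h (mjoin M x y) = mjoin a.1.1 (h x) (h y).
    by move=> hx hy; have /allP hh : all _ _ := h2 _ hx; have /andP[/eqP] := hh _ hy; split=> //; apply/eqP.
  elim: s => [v|s hs t ht|s hs t ht].
  - by symmetry; apply/eqP/(h1 v); case: v.
  - by have [e _] := h2' _ _ (keysP' s) (keysP' t); rewrite /= e -hs -ht.
  - by have [_ e] := h2' _ _ (keysP' s) (keysP' t); rewrite /= e -hs -ht.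
have pres : present R a.1.
  move=> s t Rst; rewrite /ple.
  have /allP h5 : all _ _ := h4 _ (keysP' (Meet s t)).
  have := h5 _ (keysP' s); rewrite -/(h _) -/(h _) -!hE; case: eqP => [e _|_].
    by rewrite /mle -[mmeet _ _ _]/(peval a.1 (Meet s t)) e.
  move=> /hB[]; exists (Meet s t), s; split=> //; first exact: lpre_meetl.
  by apply/lpre_meetP.
split=> // s /pres; rewrite /ple !hE sj => hs.
by have := h6 _ (keysP' s); rewrite -/(h j) -/(h _) hs /above hE.
Qed.

Lemma atom_check_atP s0 l : listable F -> atom_check_at T M p l -> atom_term R s0 ->
  exists a, [/\ a \in T, present R a.1 & above a s0].
Proof.
move=> finF hc [z0 [z0P ns0 atm]].
have zz : R bottom_term z0 by exact: bottom_termP.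
pose P y := exists s, ev d s = y /\ R s0 s.
have [|_ [[s1 [<- Rs1]] _ s1min]] := @ex_minimal _ P (ev d s0) finF; first by exists s0.
have Rs1' : R s1 s0.
  have e : ev d (Meet s1 s0) = ev d s1.
    by apply: s1min; [exists (Meet s1 s0); split=> //; exact/lpre_meetP|exact: leIl].
  by apply: lpre_trans (lpre_meetr _ s1 s0); apply: dR; change (ev d s1 <= ev d (Meet s1 s0)); rewrite e.
have below s : ev d s < ev d s1 -> R s z0.
  move=> hlt; have nR : ~ R s0 s.
    by move=> h; have := s1min (ev d s); rewrite ltW // => /(_ _ isT) e; rewrite e ?ltxx in hlt; [|exists s].
  have [//|h] := atm s; apply: lpre_trans h; apply/lpre_meetP; split=> //.
  by apply: lpre_trans Rs1'; apply: dR; exact: ltW.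
move: hc; rewrite /atom_check_at; case: ifP => // lok.
have [keysP evP] := generated_okP lok.
have keysP' s : mev M (at3 p) s \in map fst l by rewrite mevE.
have onto k : k \in map fst l -> exists s, mev M (at3 p) s = k.
  by move=> /mapP[x xl ->]; exists x.2; rewrite mevE evP.
set z := mev _ _ _; pose j := mev M (at3 p) s1.
move/allP/(_ j (keysP' s1)); case: eqP => [e _|_].
  by case: ns0; apply: lpre_trans Rs1 (lpre_trans (code_eqR e) zz).
set js := foldr _ _ _.
have [sj [sjE Rsj]] : exists sj, mev M (at3 p) sj = js /\ R sj z0.
  rewrite /js; have : {subset [seq a <- map fst l | (a != j) && mle M a j] <=
      [seq a <- map fst l | (a != j) && mle M a j]} by [].
  elim: {1 3}[seq a <- _ | _] => [|a m IH] hm; first by exists bottom_term.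
  have [|s [sE Rs]] := IH; first by move=> b hb; apply: hm; rewrite in_cons hb orbT.
  have := hm a (mem_head _ _); rewrite mem_filter => /andP[/andP[naj laj] /onto[sa saE]].
  exists (Join sa s); rewrite /= sE saE; split=> //; apply/lpre_joinP; split=> //.
  apply: below; rewrite lt_neqAle (codes_le cP) !code_ev saE laj andbT.
  by rewrite -(inj_eq (codes_inj cP)) !code_ev saE.
case: eqP => [e _|_].
  by case: ns0; apply: lpre_trans Rs1 (lpre_trans _ Rsj); apply: code_eqR; rewrite sjE.
have hj x y : mle M j x != mle M j y -> ~ collapsed x y.
  wlog [jx jy] : x y / mle M j x /\ ~~ mle M j y.
    move=> W; case jx: (mle M j x); case jy: (mle M j y) => // _.
      by apply: W; rewrite jx jy.
    have h : mle M j y != mle M j x by rewrite jx jy.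
    have hyx : ~ collapsed y x by apply: W h; rewrite jx jy.
    by move=> [s [t [h1 h2 h3 h4]]]; apply: hyx; exists t, s.
  move=> _ [s [t [h1 h2 h3 h4]]]; case: ns0; apply: lpre_trans Rs1 _.
  apply: (@lpre_trans _ _ (Meet s1 s)).
    apply: dR; rewrite /= lexI lexx /=.
    by rewrite (codes_le cP) !code_ev h1.
  apply: (@lpre_trans _ _ (Meet s1 t)); first exact: lpre_meet_mono.
  apply: below; rewrite /= lt_neqAle leIl andbT eq_meetl (codes_le cP) !code_ev h2.
  exact: jy.
case: ifP => [|_].
  rewrite has_lazyE => /hasP[a aT ta _]; have [_ h2] := typed_byP lok ta hj (erefl j).
  have [h1 _] := typed_byP lok ta hj (erefl j); exists a; split=> //; exact: h2.
have hB x y : related (translates M (map fst l) j) x y -> ~ collapsed x y.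
  by move=> h; exact: (translatesP onto hj h).
case: ifP => [/hB[]|_]; last rewrite has_lazyE => /hasP[a aT ta].
  by exists bottom_term, sj; split=> //; apply: lpre_trans (z0P _).
have [h1 h2] := typed_byP lok ta hB (erefl j); exists a; split=> //.
exact: h2.
Qed.
End AtomCheck.

Theorem atom_checkP F M T : coded F M -> atom_check T M -> atoms_typed T F.
Proof.
move=> [c cP] /allP hc d R dR s hs; apply: (atom_check_atP cP dR) hs.
  exact: codes_listable cP.
exact: (hc _ (mem_triples (fun v => codes_lt cP (d v)))).
Qed.

(** * The atom types of the generating lattices *)

Definition M3_points : seq pointed := [:: (mM3, (1, 2, 3)%N)].
Definition L1_points : seq pointed := [seq (mL1, p) | p <- [:: (1, 2, 3); (1, 3, 2); (2, 1, 3)]%N].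
Definition L3_points : seq pointed :=
  [seq (mL3, p) | p <- [:: (2, 4, 5); (2, 5, 4); (4, 2, 5); (4, 5, 2); (5, 2, 4); (5, 4, 2)]%N].
Definition L4_points : seq pointed := [seq (mL4, p) | p <- [:: (1, 2, 3); (1, 3, 2); (3, 1, 2)]%N].
Definition V6_points : seq pointed := [seq (mV6, p) | p <- [:: (2, 5, 6); (5, 2, 6); (5, 6, 2)]%N].
Definition dual_points (Ps : seq pointed) : seq pointed := [seq (mdual P.1, P.2) | P <- Ps].
Definition L2_points := dual_points L1_points.
Definition L5_points := dual_points L4_points.
Definition V7_points := dual_points V6_points.

Definition model_atoms (M : model) : seq nat :=
  let n := iota 0 (msize M) in let o := foldr (mmeet M) 0%N n in
  [seq q <- n | (q != o) && all (fun x => mmeet M q x \in [:: o; q]) n].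

Definition join_prime (M : model) (q : nat) : bool :=
  let n := iota 0 (msize M) in
  all (fun x => all (fun y => mle M q (mjoin M x y) ==> mle M q x || mle M q y) n) n.


(** * Counting atoms *)

Lemma has_card_seq (T : choiceType) (A : set T) (l : seq T) :
  uniq l -> (forall x, A x <-> x \in l) -> has_card A (Some (size l)).
Proof.
move=> ul hA; rewrite /has_card.
have -> : A = [set` [fset x in l]%fset]%classic.
  by apply: funext => x; apply: propext; rewrite hA /= inE.
by apply/card_eq_fsetP; rewrite card_fseq undup_id.
Qed.

Lemma has_card_inj T (A : set T) n c : has_card A (Some n) -> has_card A c -> c = Some n.
Proof.
case: c => [m|] /= h h'; last by case: h'; exists n.
congr Some; apply/card_eq_II; apply: card_eq_trans h; exact: card_esym.
Qed.

Section CountAtoms.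
Variables (L : lattice) (e : gen3 -> L) (I : eqType) (U : I -> term gen3 -> Prop).
Hypotheses (gen : forall y, exists s, ev e s = y) (finL : listable L).

Variable A : seq I.

(* The sets [U a] are proper filters. *)
Hypothesis U_mono : forall a s t, a \in A -> evle e s t -> U a s -> U a t.
Hypothesis U_meet : forall a s t, a \in A -> U a s -> U a t -> U a (Meet s t).
Hypothesis U_top : forall a, a \in A -> exists s, U a s.
Hypothesis U_bot : forall a, a \in A -> ~ U a bottom_term.

Lemma filter_min a : a \in A -> exists s, U a s /\ forall t, U a t -> evle e s t.
Proof.
move=> aA; have [s0 Us0] := U_top aA.
have [|_ [[s [<- Us]] _ smin]] := @ex_minimal L (fun y => exists s, ev e s = y /\ U a s) (ev e s0) finL.
  by exists s0.
exists s; split=> // t Ut; have h := smin (ev e (Meet s t)).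
apply/meet_idPl; apply: h; last exact: leIl.
by exists (Meet s t); split=> //; exact: U_meet.
Qed.

Lemma atom_termP s : atom_term (evle e) s <-> At (ev e s).
Proof.
split=> [[z [zP nsz atm]]|[z [zP [zs cov]]]].
  exists (ev e z); split=> [y|]; first by have [t <-] := gen y; exact: zP.
  split; first by rewrite lt_leAnge (zP s) /=; exact/negP.
  move=> y; have [t <-] := gen y => -[h1 h2]; have [h|h] := atm t.
    by have := lt_geF h2; rewrite [_ <= _]h.
  by move: h; rewrite /= meet_r ?(lt_geF h1) // ltW.
have [t ht] := gen z; exists t; split=> [u|/=|u /=].
- by rewrite /= ht.
- by rewrite ht; apply/negP; rewrite lt_geF.
- rewrite ht; have := cov (ev e s `&` ev e u).
  have [h _|h] := boolP (ev e s <= ev e u); first by left.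
  move=> nc; right; have := zP (ev e s `&` ev e u); rewrite le_eqVlt => /orP[/eqP <- //|h'].
  by case: nc; split=> //; rewrite lt_neqAle leIl andbT eq_meetl.
Qed.

Hypotheses (uA : uniq A)
  (anti : forall a b, a \in A -> b \in A -> (forall s, U b s -> U a s) -> a = b)
  (cover : forall s, atom_term (evle e) s -> exists a, a \in A /\ U a s).

(** Distinct filters of an antichain have distinct least elements. Such a least
    element lies above some atom, whose own filter in [A] is then comparable, hence
    equal; so the least elements are exactly the atoms. *)
Theorem count_atoms : has_card (@At L) (Some (size A)).
Proof.
have /choice[m mP] : forall a, exists s, a \in A -> U a s /\ forall t, U a t -> evle e s t.
  move=> a; have [/filter_min[s hs]|_] := boolP (a \in A); first by exists s.
  by exists bottom_term.
have botP y : ev e bottom_term <= y by have [t <-] := gen y; exact: (bottom_termP (evle e)).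
have below a : a \in A -> exists s, At (ev e s) /\ evle e s (m a).
  move=> aA.
  have nb : ~~ (ev e (m a) <= ev e bottom_term).
    by apply/negP => h; apply: (@U_bot a) => //; apply: (U_mono aA h); have [] := mP a aA.
  have [|y [nby yma ymin]] := @ex_minimal L (fun y => ~~ (y <= ev e bottom_term)) (ev e (m a)) finL.
    by [].
  have [s sy] := gen y; exists s; rewrite /= sy; split=> //.
  exists (ev e bottom_term); split=> //; split.
    by rewrite lt_leAnge botP.
  move=> z [h1 h2]; have zy := ymin z; rewrite (lt_geF h1) (ltW h2) in zy.
  by have e1 := zy isT isT; rewrite e1 ltxx in h2.
have atA a : a \in A -> At (ev e (m a)).
  move=> aA; have [s [sat sma]] := below a aA; have [b [bA bs]] := cover ((atom_termP s).2 sat).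
  have ab : b = a.
    apply: anti => // t Ut; have [_ h] := mP a aA; have ht := h _ Ut.
    by apply: (U_mono bA ht); apply: (U_mono bA sma).
  rewrite ab in bs; have [_ h] := mP a aA; have -> : ev e (m a) = ev e s; last by [].
  by apply: le_anti; rewrite (h _ bs) sma.
rewrite -(size_map (fun a => ev e (m a))); apply: has_card_seq.
  rewrite map_inj_in_uniq // => a b aA bA h; apply: anti => // s Us.
  apply: (@U_mono _ (m a)) => //; last by have [] := mP a aA.
  by rewrite /= h; have [_ hh] := mP b bA; exact: hh.
move=> y; split=> [hy|/mapP[a aA ->]]; last exact: atA.
have [s sy] := gen y; rewrite -sy in hy *; have [a [aA as_]] := cover ((atom_termP s).2 hy).
apply/mapP; exists a => //; have [_ h] := mP a aA.
have [z [zP [zs cov]]] := hy; have le := h _ as_.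
have := le; rewrite /= le_eqVlt => /orP[/eqP-> //|hlt].
have [z' [z'P [zm' _]]] := atA a aA; case: (cov (ev e (m a))); split=> //.
by apply: le_lt_trans zm'.
Qed.

End CountAtoms.

(** * Comparing atom types *)

Definition realizes (P : pointed) (F : lattice) (d : gen3 -> F) : Prop :=
  exists c, codes P.1 c /\ forall v, at3 P.2 v = c (d v).

Lemma realizes_peval P F d c s : codes P.1 c -> (forall v, at3 P.2 v = c (d v)) ->
  peval P s = c (ev (L := F) d s).
Proof.
move=> cP h; rewrite (codes_ev cP) /peval; congr (mev _ _ s).
exact: functional_extensionality_dep.
Qed.

Lemma realizes_ple P F d s t : realizes P (F := F) d -> ple P s t = (ev d s <= ev d t).
Proof.
by move=> [c [cP h]]; rewrite (codes_le cP) /ple !(realizes_peval _ cP h).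
Qed.

Lemma realizes_dual P F d : realizes P (F := F) d ->
  realizes (mdual P.1, P.2) (F := dual_lattice F) d.
Proof. by move=> [c [cP h]]; exists c; split=> //; exact: codes_dual. Qed.

Lemma coded_realizes F M p : coded F M ->
  [&& p.1.1 < msize M, p.1.2 < msize M & p.2 < msize M]%N ->
  exists d, realizes (M, p) (F := F) d.
Proof.
move=> [c cP] /and3P[/(codes_onto cP)[x hx] /(codes_onto cP)[y hy] /(codes_onto cP)[z hz]].
exists (mk3 x y z), c; split=> //; case: p hx hy hz => [[p0 p1] p2] /= hx hy hz.
by case=> /=.
Qed.

Definition top_term : term gen3 := Join (Join (Var G0) (Var G1)) (Var G2).

Definition type_ok (a : ptype) : bool :=
  [&& (a.2 < msize a.1.1)%N, above a top_term & ~~ above a bottom_term].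

Section Filters.
Variables (a : ptype) (F : lattice) (d : gen3 -> F).
Hypotheses (aF : realizes a.1 d) (aok : type_ok a).

Lemma aboveP : exists y, forall s, above a s = (y <= ev d s).
Proof.
have [c [cP h]] := aF; have /and3P[/(codes_onto cP)[y hy] _ _] := aok.
exists y => s; rewrite (codes_le cP) hy /above; congr (mle _ _ _).
exact: realizes_peval.
Qed.

Lemma above_mono (R : lpre gen3) s t : present R a.1 -> R s t -> above a s -> above a t.
Proof.
move=> pr /pr; rewrite (realizes_ple _ _ aF); have [y hy] := aboveP.
by move=> h; rewrite !hy => /le_trans; apply.
Qed.

Lemma above_meet s t : above a s -> above a t -> above a (Meet s t).
Proof. by have [y hy] := aboveP; rewrite !hy /= lexI => -> ->. Qed.

Lemma above_top : exists s, above a s.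
Proof. by exists top_term; have /and3P[_ -> _] := aok. Qed.

Lemma above_bot : ~ above a bottom_term.
Proof. by apply/negP; have /and3P[_ _ ->] := aok. Qed.

End Filters.

(** The sublattice generated in the product of two pointed lattices, with a
    term for each element. *)
Definition pair_entry : Type := (nat * nat) * term gen3.

Definition set_bit (B : seq (seq bool)) (x : nat * nat) : seq (seq bool) :=
  set_nth [::] B x.1 (set_nth false (nth [::] B x.1) x.2 true).

Definition pmeet (P Q : pointed) (x y : nat * nat) := (mmeet P.1 x.1 y.1, mmeet Q.1 x.2 y.2).
Definition pjoin (P Q : pointed) (x y : nat * nat) := (mjoin P.1 x.1 y.1, mjoin Q.1 x.2 y.2).

Definition push_entry (st : seq (seq bool) * seq pair_entry) (x : pair_entry) :=
  if related st.1 x.1.1 x.1.2 then st else (set_bit st.1 x.1, x :: st.2).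

Fixpoint saturate (P Q : pointed) (n : nat) (done : seq pair_entry)
    (st : seq (seq bool) * seq pair_entry) : seq pair_entry :=
  if n is n'.+1 then
    if st.2 is x :: todo then
      saturate P Q n' (x :: done)
        (foldl (fun st y => push_entry (push_entry st (pmeet P Q x.1 y.1, Meet x.2 y.2))
                              (pjoin P Q x.1 y.1, Join x.2 y.2)) (st.1, todo) done)
    else done
  else done.

Definition pair_entries (P Q : pointed) : seq pair_entry :=
  saturate P Q 100 [::] (foldl push_entry ([::], [::])
    [seq ((at3 P.2 v, at3 Q.2 v), Var v) | v <- gens3]).

Definition pair_ok (P Q : pointed) (l : seq pair_entry) : bool :=
  let keys := map fst l in
  let B := foldl set_bit [::] keys in
  let inB x := related B x.1 x.2 in
  [&& all (fun v => inB (at3 P.2 v, at3 Q.2 v)) gens3,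
      all (fun x => all (fun y => inB (pmeet P Q x y) && inB (pjoin P Q x y)) keys) keys &
      all (fun x => (peval P x.2 == x.1.1) && (peval Q x.2 == x.1.2)) l].

Lemma related_set_bits l x y : related (foldl set_bit [::] l) x y -> (x, y) \in l.
Proof.
suff gen B : related (foldl set_bit B l) x y -> related B x y \/ (x, y) \in l.
  by move=> /gen[|//]; rewrite /related nth_nil nth_nil.
elim: l B => [|[a b] l IH] B /=; first by left.
move=> /IH[|h]; last by right; rewrite in_cons h orbT.
rewrite /related /set_bit nth_set_nth /=; case: eqP => [->|_]; last by left.
rewrite nth_set_nth /=; case: eqP => [->|_]; last by left.
by right; rewrite mem_head.
Qed.

Lemma pair_okP P Q l : pair_ok P Q l ->
  (forall s, (peval P s, peval Q s) \in map fst l) /\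
  (forall x, x \in map fst l -> exists s, x = (peval P s, peval Q s)).
Proof.
case/and3P=> /allP h1 /allP h2 /allP h3; split=> [s|x /mapP[y /h3/andP[/eqP e1 /eqP e2] ->]].
  have h4 x y : x \in map fst l -> y \in map fst l ->
      (pmeet P Q x y \in map fst l) /\ (pjoin P Q x y \in map fst l).
    move=> hx hy; have /allP h : all _ _ := h2 _ hx.
    by have /andP[/related_set_bits h5 /related_set_bits h6] := h _ hy.
  elim: s => [v|s hs t ht|s hs t ht]; last by have [] := h4 _ _ hs ht.
    by apply: related_set_bits; apply: (h1 v); case: v.
  by have [] := h4 _ _ hs ht.
by exists y.2; rewrite e1 e2; case: (y.1).
Qed.

Definition pdual (P : pointed) : pointed := (mdual P.1, P.2).

Lemma peval_dual P s : peval (pdual P) s = peval P (tdual s).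
Proof. exact: mev_dual. Qed.

Definition type_le_on (l : seq pair_entry) (a b : ptype) : bool :=
  all (fun x => if mle b.1.1 b.2 x.1.2 then mle a.1.1 a.2 x.1.1 else true) l.

Definition implied_on (l : seq pair_entry) (P Q : pointed) : bool :=
  all (fun x => all (fun y => if mle P.1 x.1.1 y.1.1 then mle Q.1 x.1.2 y.1.2 else true) l) l.

Definition implied (P Q : pointed) : Prop := forall s t, ple P s t -> ple Q s t.

(** Whether the least element of one filter lies below that of another depends
    only on the sublattice generated in the product of the two pointed lattices. *)
Lemma type_le_onP P Q q r l : pair_ok P Q l ->
  type_le_on l (P, q) (Q, r) <-> (forall s, above (Q, r) s -> above (P, q) s).
Proof.
move=> /pair_okP[h1 h2]; split=> [/allP h s|h].
  have /mapP[x xl hx] := h1 s; have := h _ xl.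
  by rewrite -hx /above /=; case: ifP.
apply/allP => x /(map_f fst)/h2[s ->] /=; case: ifP => //; exact: h.
Qed.

Lemma type_le_on_dual P Q q r l : pair_ok P Q l ->
  type_le_on l (pdual P, q) (pdual Q, r) <->
  (forall s, above (pdual Q, r) s -> above (pdual P, q) s).
Proof.
move=> /pair_okP[h1 h2]; split=> [/allP h s|h].
  have /mapP[x xl hx] := h1 (tdual s); have := h _ xl.
  by rewrite -hx /above /= !peval_dual; case: ifP.
apply/allP => x /(map_f fst)/h2[s ->] /=; case: ifP => // hr.
by have := h (tdual s); rewrite /above !peval_dual tdualK; apply.
Qed.

Lemma implied_onP P Q l : pair_ok P Q l -> implied_on l P Q <-> implied P Q.
Proof.
move=> /pair_okP[h1 h2]; split=> [/allP h s t|h].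
  have [/mapP[x xl hx] /mapP[y yl hy]] := (h1 s, h1 t).
  have /allP h' : all _ _ := h _ xl.
  by have := h' _ yl; rewrite -hx -hy /ple /=; case: ifP.
apply/allP => x /(map_f fst)/h2[s hx]; apply/allP => y /(map_f fst)/h2[t hy].
rewrite hx hy /=; case: ifP => //; exact: h.
Qed.

(** Types are given by the index of a pointed lattice and an atom of it, or of its
    dual for the types of coatoms. The two relations compare the filters of types,
    and [tb_implied] lists the quotients of each pointed lattice. *)
Record tables := Tables {
  tb_atoms : seq (nat * nat);
  tb_coatoms : seq (nat * nat);
  tb_atom_le : seq (seq bool);
  tb_coatom_le : seq (seq bool);
  tb_implied : seq (seq nat) }.

Definition no_point : pointed := (([::], [::]), (0, 0, 0)%N).

Definition atom_type (Ps : seq pointed) (a : nat * nat) : ptype := (nth no_point Ps a.1, a.2).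
Definition coatom_type (Ps : seq pointed) (a : nat * nat) : ptype :=
  (pdual (nth no_point Ps a.1), a.2).

(* Join-prime atoms have the same type as some two-element chain. *)
Definition point_types (Ps : seq pointed) : seq (nat * nat) :=
  flatten [seq let P := nth no_point Ps k in
    [seq (k, q) | q <- model_atoms P.1 & (msize P.1 == 2) || ~~ join_prime P.1 q]
    | k <- iota 0 (size Ps)].

Definition compute_tables (Ps : seq pointed) : tables :=
  let T := point_types Ps in
  let Td := point_types (map pdual Ps) in
  let pt := nth no_point Ps in
  Tables T Td
    [seq [seq type_le_on (pair_entries (pt a.1) (pt b.1)) (atom_type Ps a) (atom_type Ps b)
         | b <- T] | a <- T]
    [seq [seq type_le_on (pair_entries (pt a.1) (pt b.1)) (coatom_type Ps a) (coatom_type Ps b)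
         | b <- Td] | a <- Td]
    [seq [seq k' <- iota 0 (size Ps) | implied_on (pair_entries (pt k) (pt k')) (pt k) (pt k')]
      | k <- iota 0 (size Ps)].

(* The part of the table [tb] about types of the lattices [k] and [k']. *)
Definition le_ok (T : seq (nat * nat)) (ty : nat * nat -> ptype) (tb : seq (seq bool))
    (k k' : nat) (l : seq pair_entry) : bool :=
  let n := iota 0 (size T) in
  all (fun i => let a := nth (0, 0)%N T i in
    if a.1 == k then
      all (fun j => let b := nth (0, 0)%N T j in
        if b.1 == k' then related tb i j == type_le_on l (ty a) (ty b) else true) n
    else true) n.

Definition tables_ok (Ps : seq pointed) (tb : tables) : bool :=
  let n := iota 0 (size Ps) in
  [&& all (fun a => (a.1 < size Ps)%N && type_ok (atom_type Ps a)) (tb_atoms tb),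
      all (fun a => (a.1 < size Ps)%N && type_ok (coatom_type Ps a)) (tb_coatoms tb) &
      all (fun k => let P := nth no_point Ps k in
        all (fun k' => let Q := nth no_point Ps k' in
          let l := pair_entries P Q in
          [&& pair_ok P Q l,
              le_ok (tb_atoms tb) (atom_type Ps) (tb_atom_le tb) k k' l,
              le_ok (tb_coatoms tb) (coatom_type Ps) (tb_coatom_le tb) k k' l &
              (k' \in nth [::] (tb_implied tb) k) == implied_on l P Q]) n) n].

Section Tables.
Variables (Ps : seq pointed) (tb : tables).
Hypothesis ok : tables_ok Ps tb.

Lemma tables_pairs k k' : (k < size Ps)%N -> (k' < size Ps)%N ->
  exists l, let P := nth no_point Ps k in let Q := nth no_point Ps k' in
    [/\ pair_ok P Q l,
        le_ok (tb_atoms tb) (atom_type Ps) (tb_atom_le tb) k k' l,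
        le_ok (tb_coatoms tb) (coatom_type Ps) (tb_coatom_le tb) k k' l &
        (k' \in nth [::] (tb_implied tb) k) = implied_on l P Q].
Proof.
move=> hk hk'; have /and3P[_ _ /allP h] := ok.
have hk1 : k \in iota 0 (size Ps) by rewrite mem_iota.
have hk1' : k' \in iota 0 (size Ps) by rewrite mem_iota.
have /allP h' : all _ _ := h _ hk1; have /and4P[h1 h2 h3 /eqP h4] := h' _ hk1'.
by exists (pair_entries (nth no_point Ps k) (nth no_point Ps k')); split.
Qed.

Lemma le_okP T ty le k k' l i j : le_ok T ty le k k' l -> (i < size T)%N -> (j < size T)%N ->
  (nth (0, 0)%N T i).1 = k -> (nth (0, 0)%N T j).1 = k' ->
  related le i j = type_le_on l (ty (nth (0, 0)%N T i)) (ty (nth (0, 0)%N T j)).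
Proof.
move=> /allP h hi hj ki kj.
have hi' : i \in iota 0 (size T) by rewrite mem_iota.
have hj' : j \in iota 0 (size T) by rewrite mem_iota.
have := h _ hi'; rewrite /= ki eqxx => /allP/(_ _ hj').
by rewrite /= kj eqxx => /eqP.
Qed.

Lemma tables_atom i : (i < size (tb_atoms tb))%N ->
  let a := nth (0, 0)%N (tb_atoms tb) i in (a.1 < size Ps)%N /\ type_ok (atom_type Ps a).
Proof. by move=> hi; have /and3P[/allP h _ _] := ok; have /andP := h _ (mem_nth (0, 0)%N hi). Qed.

Lemma tables_coatom i : (i < size (tb_coatoms tb))%N ->
  let a := nth (0, 0)%N (tb_coatoms tb) i in (a.1 < size Ps)%N /\ type_ok (coatom_type Ps a).
Proof. by move=> hi; have /and3P[_ /allP h _] := ok; have /andP := h _ (mem_nth (0, 0)%N hi). Qed.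

Lemma atom_leP i j : (i < size (tb_atoms tb))%N -> (j < size (tb_atoms tb))%N ->
  let ty i := atom_type Ps (nth (0, 0)%N (tb_atoms tb) i) in
  related (tb_atom_le tb) i j <-> (forall s, above (ty j) s -> above (ty i) s).
Proof.
move=> hi hj; have [[ki _] [kj _]] := (tables_atom hi, tables_atom hj).
have [l [h1 h2 _ _]] := tables_pairs ki kj.
by rewrite (le_okP h2 hi hj erefl erefl); exact: type_le_onP.
Qed.

Lemma coatom_leP i j : (i < size (tb_coatoms tb))%N -> (j < size (tb_coatoms tb))%N ->
  let ty i := coatom_type Ps (nth (0, 0)%N (tb_coatoms tb) i) in
  related (tb_coatom_le tb) i j <-> (forall s, above (ty j) s -> above (ty i) s).
Proof.
move=> hi hj; have [[ki _] [kj _]] := (tables_coatom hi, tables_coatom hj).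
have [l [h1 _ h3 _]] := tables_pairs ki kj.
by rewrite (le_okP h3 hi hj erefl erefl); exact: type_le_on_dual.
Qed.

Lemma table_impliedP k k' : (k < size Ps)%N -> (k' < size Ps)%N ->
  k' \in nth [::] (tb_implied tb) k <-> implied (nth no_point Ps k) (nth no_point Ps k').
Proof.
move=> hk hk'; have [l [h1 _ _ ->]] := tables_pairs hk hk'; exact: implied_onP.
Qed.

End Tables.

(** * Antichains of types *)

Section Antichains.
Variables (le : nat -> nat -> bool) (inc : nat -> seq nat).

(** [A] is a list of minimal types, updated by a new type. *)
Definition add_type (A : seq nat) (i : nat) : seq nat :=
  if has (fun j => le j i) A then A else i :: [seq j <- A | ~~ le i j].

Definition add_types (A : seq nat) (l : seq nat) : seq nat := foldl add_type A l.

Definition minimal_types (ks : seq nat) : seq nat :=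
  foldl (fun A k => add_types A (inc k)) [::] ks.

Variables (n : nat) (S : nat -> nat -> Prop).
Hypotheses (Srefl : forall i, S i i) (Strans : forall j i k, S i j -> S j k -> S i k).
Hypothesis leS : forall i j, (i < n)%N -> (j < n)%N -> le i j <-> S i j.

Definition antichain_of (A : seq nat) (B : nat -> Prop) : Prop :=
  [/\ uniq A, forall i, i \in A -> B i /\ (i < n)%N,
      forall i, B i -> exists j, j \in A /\ S j i
    & forall i j, i \in A -> j \in A -> S i j -> i = j].

Lemma add_typeP A B i : (i < n)%N -> antichain_of A B ->
  antichain_of (add_type A i) (fun j => B j \/ j = i).
Proof.
move=> hi [uA AB cov anti]; rewrite /add_type; case: ifP => [/hasP[j jA ji]|/negbT/hasPn hn].
  split=> //; first by move=> k /AB[]; split=> //; left.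
  move=> k [/cov //|->]; exists j; split=> //; apply/leS => //; by have [] := AB _ jA.
split.
- rewrite /= filter_uniq // andbT mem_filter negb_and negbK; apply/orP; left.
  exact/leS.
- move=> k; rewrite in_cons mem_filter => /orP[/eqP ->|/andP[_ /AB[]]]; last by split=> //; left.
  by split=> //; right.
- move=> k [/cov[j [jA jk]]|->]; last by exists i; rewrite mem_head.
  have [ij|nij] := boolP (le i j); last by exists j; rewrite in_cons mem_filter nij jA orbT.
  exists i; rewrite mem_head; split=> //; apply: Strans jk; apply/leS => //.
  by have [] := AB _ jA.
- move=> j k; rewrite !in_cons !mem_filter.
  move=> /orP[/eqP->|/andP[nij jA]] /orP[/eqP->|/andP[nik kA]] //.
  + by move=> /leS h; rewrite h // in nik; have [] := AB _ kA.
  + by move=> /leS h; have := hn _ jA; rewrite h //; have [] := AB _ jA.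
  + exact: anti.
Qed.

Lemma minimal_typesP ks : (forall k, k \in ks -> forall i, i \in inc k -> (i < n)%N) ->
  antichain_of (minimal_types ks) (fun i => exists k, k \in ks /\ i \in inc k).
Proof.
have ext A B B' : (forall i, B i <-> B' i) -> antichain_of A B -> antichain_of A B'.
  move=> h [h1 h2 h3 h4]; split=> // [i /h2[/h]|i /h /h3] //.
have adds l A B : (forall i, i \in l -> (i < n)%N) -> antichain_of A B ->
    antichain_of (add_types A l) (fun i => B i \/ i \in l).
  elim: l A B => [|i l IH] A B hl hA; first by apply: ext hA => i; rewrite in_nil; split; [left|case].
  rewrite /add_types /=; apply: ext (IH _ _ _ (add_typeP (hl i (mem_head _ _)) hA)).
    move=> j; rewrite in_cons; split=> [[[h|->]|h]|[h|/orP[/eqP h|h]]].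
    + by left.
    + by right; rewrite eqxx.
    + by right; rewrite h orbT.
    + by left; left.
    + by left; right.
    + by right.
  by move=> j hj; apply: hl; rewrite in_cons hj orbT.
rewrite /minimal_types => hk.
suff gen A B : antichain_of A B -> antichain_of (foldl (fun A k => add_types A (inc k)) A ks)
    (fun i => B i \/ exists k, k \in ks /\ i \in inc k).
  apply: ext (gen [::] (fun=> False) _); last by split.
  by move=> i; split; [case|right].
elim: ks hk A B => [|k ks IH] hk A B hA; first by apply: ext hA => i; split; [left|case=> [//|[k []]]].
have hk' k' : k' \in ks -> forall i, i \in inc k' -> (i < n)%N.
  by move=> h; apply: hk; rewrite in_cons h orbT.
apply: ext (IH hk' _ _ (adds _ _ _ (hk k (mem_head _ _)) hA)) => i; split.
- move=> [[h|h]|[k' [h1 h2]]]; [by left|right..].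
    by exists k; rewrite mem_head.
  by exists k'; rewrite in_cons h1 orbT.
- move=> [h|[k' []]]; first by left; left.
  rewrite in_cons => /orP[/eqP ->|h1 h2]; first by left; right.
  by right; exists k'.
Qed.

End Antichains.

(** All the values of a fold over a subsequence of a list. *)
Section Subsequences.
Variables (A : eqType) (C : Type) (f : nat -> C) (step : A -> C -> A) (st0 : A).

Definition reachable (ks : seq nat) : seq A :=
  foldl (fun sts k => let x := f k in undup (sts ++ [seq step st x | st <- sts])) [:: st0] ks.

Lemma reachableP (p : pred nat) ks :
  foldl (fun st k => step st (f k)) st0 (filter p ks) \in reachable ks.
Proof.
rewrite /reachable; have : st0 \in [:: st0] by rewrite mem_head.
elim: ks st0 [:: st0] => //= k ks IH st sts h; case: ifP => _ /=; apply: IH;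
  rewrite mem_undup mem_cat; first by rewrite (map_f (fun st => step st (f k))) ?orbT.
by rewrite h.
Qed.
End Subsequences.

(** * Spectra of three-generated lattices *)

Lemma three_generatedP (L : lattice) : three_generated L ->
  exists e : gen3 -> L, e G0 <> e G1 /\ forall y, exists s, ev e s = y.
Proof.
move=> [a [b [c [ab _ _ gen]]]]; exists (mk3 a b c); split=> // y.
pose S : set L := fun y => exists s, ev (mk3 a b c) s = y.
have : S = setT; last by move=> h; have : setT y by []; rewrite -h.
apply: gen.
- by exists (Var G0).
- by exists (Var G1).
- by exists (Var G2).
- move=> x w [s <-] [t <-]; split; by [exists (Meet s t)|exists (Join s t)].
Qed.

Lemma generated_three (L : lattice) (e : gen3 -> L) :
  e G0 <> e G1 -> e G0 <> e G2 -> e G1 <> e G2 ->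
  (forall y, exists s, ev e s = y) -> three_generated L.
Proof.
move=> h01 h02 h12 gen; exists (e G0), (e G1), (e G2); split=> // S h0 h1 h2 hS.
apply: funext => y; apply: propext; split=> // _; have [s <-] := gen y.
elim: s => [[]|s IHs t IHt|s IHs t IHt] //=; by have [] := hS _ _ IHs IHt.
Qed.

Lemma Ct_dual (L : lattice) : @Ct L = @At (dual_lattice L).
Proof.
apply: funext => a; apply: propext.
split=> -[u [h1 [h2 h3]]]; exists u; split=> //; split=> // z [h4 h5];
  by apply: (h3 z); split.
Qed.

Lemma atom_exists (L : lattice) (x y : L) : listable L -> x <> y ->
  (exists z : L, forall w, z <= w) -> exists a, @At L a.
Proof.
move=> finL nxy [z zP].
have [w nw] : exists w, ~~ (w <= z).
  apply: contrapT => h; apply: nxy.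
  have all w : w = z.
    apply: le_anti; rewrite zP andbT; apply: contrapT => /negP nw.
    by apply: h; exists w.
  by rewrite (all x) (all y).
have [a [na _ amin]] := ex_minimal (P := fun w => ~~ (w <= z)) finL nw.
exists a, z; split=> //; split; first by rewrite lt_leAnge zP.
move=> v [h1 h2]; have e := amin v; rewrite (lt_geF h1) (ltW h2) in e.
by have e1 := e isT isT; rewrite e1 ltxx in h2.
Qed.

Section TypesCount.
Variables (L : lattice) (e : gen3 -> L).
Hypotheses (gen : forall y, exists s, ev e s = y) (finL : listable L).
Variables (n : nat) (ty : nat -> ptype) (le : nat -> nat -> bool) (inc : nat -> seq nat).
Variable ks : seq nat.
Hypothesis tyok : forall i, (i < n)%N ->
  type_ok (ty i) /\ exists (F : lattice) (d : gen3 -> F), realizes (ty i).1 d.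
Hypothesis leP : forall i j, (i < n)%N -> (j < n)%N ->
  le i j <-> (forall s, above (ty j) s -> above (ty i) s).
Hypothesis incP : forall k i, k \in ks -> i \in inc k -> (i < n)%N /\ present (evle e) (ty i).1.
Hypothesis cover : forall s, atom_term (evle e) s ->
  exists k i, [/\ k \in ks, i \in inc k & above (ty i) s].

Lemma types_count : has_card (@At L) (Some (size (minimal_types le inc ks))).
Proof.
pose S i j := forall s, above (ty j) s -> above (ty i) s.
have [|||uA AB cov anti] := @minimal_typesP le inc n S _ _ leP ks.
- by move=> i s.
- by move=> j i k h1 h2 s /h2/h1.
- by move=> k hk i hi; have [] := incP hk hi.
have AP i : i \in minimal_types le inc ks ->
    [/\ type_ok (ty i), present (evle e) (ty i).1 & exists (F : lattice) (d : gen3 -> F), realizes (ty i).1 d].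
  by move=> /AB[[k [hk hi]] hin]; have [_ pr] := incP hk hi; have [] := tyok hin.
apply: (@count_atoms L e _ (fun i s => above (ty i) s) gen finL).
- by move=> i s t /AP[ok pr [F [d real]]]; apply: (above_mono real ok pr).
- by move=> i s t /AP[ok pr [F [d real]]]; apply: (above_meet real ok).
- by move=> i /AP[ok pr _]; exact: above_top.
- by move=> i /AP[ok pr _]; exact: above_bot.
- exact: uA.
- by move=> i j hi hj h; exact: anti.
- move=> s /cover[k [i [hk hi ab]]]; have [|j [hj ji]] := cov i; first by exists k.
  by exists j; split=> //; exact: ji.
Qed.
End TypesCount.

Lemma present_dual (L : lattice) (e : gen3 -> L) P (F : lattice) (d : gen3 -> F) : realizes P d ->
  present (evle (e : gen3 -> dual_lattice L)) (pdual P) <-> present (evle e) P.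
Proof.
move=> real; have reald := realizes_dual real.
have h s t : ple (pdual P) s t = ple P (tdual t) (tdual s).
  by rewrite (realizes_ple _ _ reald) (realizes_ple _ _ real) !ev_dual.
split=> pr s t; last first.
  by move=> hst; rewrite h; apply: pr; move: hst; rewrite /= !ev_dual.
move=> hst; rewrite -[s]tdualK -[t]tdualK -h; apply: pr.
by rewrite /= !ev_dual !tdualK.
Qed.

Section Spectrum.
Variables (Ps : seq pointed) (tb : tables).
Hypothesis ok : tables_ok Ps tb.
Hypothesis real : forall k, (k < size Ps)%N ->
  exists (F : lattice) (d : gen3 -> F), realizes (nth no_point Ps k) d.

Local Notation pt := (nth no_point Ps).

Definition incident (T : seq (nat * nat)) (k : nat) : seq nat :=
  [seq i <- iota 0 (size T) | (nth (0, 0)%N T i).1 \in nth [::] (tb_implied tb) k].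

Lemma mem_incident T k i : (i < size T)%N ->
  (i \in incident T k) = ((nth (0, 0)%N T i).1 \in nth [::] (tb_implied tb) k).
Proof. by move=> hi; rewrite mem_filter mem_iota /= add0n hi andbT. Qed.

Definition add_atoms (A : seq nat) (l : seq nat) := add_types (related (tb_atom_le tb)) A l.
Definition add_coatoms (A : seq nat) (l : seq nat) := add_types (related (tb_coatom_le tb)) A l.
Definition add_both (st l : seq nat * seq nat) := (add_atoms st.1 l.1, add_coatoms st.2 l.2).
Definition incident_both (k : nat) := (incident (tb_atoms tb) k, incident (tb_coatoms tb) k).

Definition spectrum_state (ks : seq nat) : seq nat * seq nat :=
  foldl (fun st k => add_both st (incident_both k)) ([::], [::]) ks.

(* The possible antichains of atom types, with those of coatom types. *)
Definition spectrum_states (ks : seq nat) := reachable incident_both add_both ([::], [::]) ks.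
Definition atom_states (ks : seq nat) := reachable (incident (tb_atoms tb)) add_atoms [::] ks.

Lemma spectrum_stateE ks : spectrum_state ks =
  (minimal_types (related (tb_atom_le tb)) (incident (tb_atoms tb)) ks,
   minimal_types (related (tb_coatom_le tb)) (incident (tb_coatoms tb)) ks).
Proof.
rewrite /spectrum_state /minimal_types.
suff gen A B : foldl (fun st k => add_both st (incident_both k)) (A, B) ks =
    (foldl (fun A k => add_types (related (tb_atom_le tb)) A (incident (tb_atoms tb) k)) A ks,
     foldl (fun A k => add_types (related (tb_coatom_le tb)) A (incident (tb_coatoms tb) k)) B ks).
  exact: gen.
by elim: ks A B => //= k ks IH A B; rewrite IH.
Qed.

Definition types_at (ks : seq nat) : seq ptype :=
  [seq atom_type Ps a | a <- tb_atoms tb & a.1 \in ks].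
Definition cotypes_at (ks : seq nat) : seq ptype :=
  [seq coatom_type Ps a | a <- tb_coatoms tb & a.1 \in ks].

(** The atoms and coatoms of three-generated members of the variety of [F] come
    from the pointed lattices with indices in [ks]. *)
Definition controlled (ks : seq nat) (F : lattice) : Prop :=
  [/\ listable F, atoms_typed (types_at ks) F & atoms_typed (cotypes_at ks) (dual_lattice F)].

Lemma atoms_typed_sub T T' (F : lattice) : {subset T <= T'} -> atoms_typed T F -> atoms_typed T' F.
Proof.
by move=> h hF d R dR s /(hF d R dR)[a [aT pr ab]]; exists a; split=> //; exact: h.
Qed.

Lemma controlled_sub ks ks' F : {subset ks <= ks'} -> controlled ks F -> controlled ks' F.
Proof.
move=> h [h1 h2 h3]; split=> //; [apply: atoms_typed_sub h2|apply: atoms_typed_sub h3];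
  move=> _ /mapP[a + ->]; rewrite mem_filter => /andP[/h ak aT]; apply: map_f;
  by rewrite mem_filter ak.
Qed.

Section Lattice.
Variables (L : lattice) (e : gen3 -> L) (ks : seq nat).
Hypotheses (gen : forall y, exists s, ev e s = y) (finL : listable L).
Hypothesis ks_lt : forall k, k \in ks -> (k < size Ps)%N.
Hypothesis ks_present : forall k, k \in ks -> present (evle e) (pt k).

Lemma atoms_spectrum :
  (forall s, atom_term (evle e) s -> exists k a, [/\ k \in ks, a \in tb_atoms tb,
    implied (pt k) (pt a.1) & above (atom_type Ps a) s]) ->
  has_card (@At L) (Some (size (spectrum_state ks).1)).
Proof.
move=> cover; rewrite spectrum_stateE /=.
apply: (@types_count L e gen finL (size (tb_atoms tb))
  (fun i => atom_type Ps (nth (0, 0)%N (tb_atoms tb) i))).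
- by move=> i /(tables_atom ok)[/real hr hok].
- exact: atom_leP ok.
- move=> k i hk; rewrite mem_filter mem_iota /= add0n => /andP[hi hlt]; split=> //.
  have [ka _] := tables_atom ok hlt; move: hi => /(table_impliedP ok (ks_lt hk) ka) imp.
  by move=> s t /(ks_present hk)/imp.
- move=> s /cover[k [a [hk aT imp ab]]]; exists k, (index a (tb_atoms tb)).
  have hlt : (index a (tb_atoms tb) < size (tb_atoms tb))%N by rewrite index_mem.
  rewrite mem_incident // nth_index //; split=> //.
  have [ka _] := tables_atom ok hlt; rewrite nth_index // in ka.
  by apply/(table_impliedP ok (ks_lt hk) ka).
Qed.

Lemma coatoms_spectrum :
  (forall s, atom_term (evle (e : gen3 -> dual_lattice L)) s ->
    exists k a, [/\ k \in ks, a \in tb_coatoms tb,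
    implied (pt k) (pt a.1) & above (coatom_type Ps a) s]) ->
  has_card (@Ct L) (Some (size (spectrum_state ks).2)).
Proof.
move=> cover; rewrite spectrum_stateE /= Ct_dual.
apply: (@types_count (dual_lattice L) e _ _ (size (tb_coatoms tb))
  (fun i => coatom_type Ps (nth (0, 0)%N (tb_coatoms tb) i))).
- by move=> y; have [s <-] := gen y; exists (tdual s); rewrite ev_dual tdualK.
- exact: listable_dual.
- move=> i /(tables_coatom ok)[/real[F [d hr]] hok]; split=> //.
  by exists (dual_lattice F), d; exact: realizes_dual.
- exact: coatom_leP ok.
- move=> k i hk; rewrite mem_filter mem_iota /= add0n => /andP[hi hlt]; split=> //.
  have [ka _] := tables_coatom ok hlt; move: hi => /(table_impliedP ok (ks_lt hk) ka) imp.
  have [F [d hr]] := real ka; apply/(present_dual e hr) => s t.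
  by move=> /(ks_present hk)/imp.
- move=> s /cover[k [a [hk aT imp ab]]]; exists k, (index a (tb_coatoms tb)).
  have hlt : (index a (tb_coatoms tb) < size (tb_coatoms tb))%N by rewrite index_mem.
  rewrite mem_incident // nth_index //; split=> //.
  have [ka _] := tables_coatom ok hlt; rewrite nth_index // in ka.
  by apply/(table_impliedP ok (ks_lt hk) ka).
Qed.

End Lattice.

(** An atom of [L] is separated from the bottom in one of the pieces given by
    Jonsson's lemma, where it is again an atom. *)
Lemma sat3_atom_typed (Fs : seq lattice) (L : lattice) (e : gen3 -> L) T :
  (forall F : lattice, List.In F Fs -> listable F) ->
  (forall F : lattice, List.In F Fs -> atoms_typed T F) -> sat3 Fs L ->
  forall s, atom_term (evle e) s -> exists a, [/\ a \in T, present (evle e) a.1 & above a s].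
Proof.
move=> finF hT hL s [z [zP /negP nsz atm]].
have [F [hF [d nR]]] := sat3_pieces finF hL nsz.
have [|a [aT pr ab]] := hT F hF d (lsup (evle e) (evle d)) (@lsup_subr _ _ _) s.
  exists z; split=> // u; first by apply: lsup_subl; exact: zP.
  by have [h|h] := atm u; [left|right]; exact: lsup_subl.
by exists a; split=> // u v huv; apply: pr; exact: lsup_subl.
Qed.

Lemma sat3_dual (Fs : seq lattice) (L : lattice) :
  sat3 Fs L -> sat3 (map dual_lattice Fs) (dual_lattice L).
Proof.
move=> hL s t hst e; rewrite (ev_dual (e : gen3 -> L)) (ev_dual (e : gen3 -> L) t).
apply: (hL (tdual t) (tdual s)) => F hF d.
have := hst _ (In_map dual_lattice hF) d.
by rewrite (ev_dual (d : gen3 -> F)) (ev_dual (d : gen3 -> F) t).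
Qed.

(** The numbers of atoms and coatoms are determined by the set of the pointed
    lattices that are quotients of [L]. *)
Theorem spectrum_upper (Fs : seq lattice) (ks : seq nat) (L : lattice) :
  (forall k, k \in ks -> (k < size Ps)%N) ->
  (forall F : lattice, List.In F Fs -> controlled ks F) -> sat3 Fs L -> three_generated L ->
  exists st, [/\ st \in spectrum_states ks, st.1 \in atom_states ks, (0 < size st.1)%N,
    has_card (@At L) (Some (size st.1)) & has_card (@Ct L) (Some (size st.2))].
Proof.
move=> ks_lt hFs hL /three_generatedP[e [ne gen]].
have finF (F : lattice) : List.In F Fs -> listable F by case/hFs.
have finL : listable L by exact: sat3_listable hL gen.
pose ks' := [seq k <- ks | `[< present (evle e) (pt k) >]].
have ks'_lt k : k \in ks' -> (k < size Ps)%N by rewrite mem_filter => /andP[_ /ks_lt].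
have ks'_pr k : k \in ks' -> present (evle e) (pt k).
  by rewrite mem_filter => /andP[/asboolP].
have hA : has_card (@At L) (Some (size (spectrum_state ks').1)).
  apply: (atoms_spectrum gen finL ks'_lt ks'_pr) => s.
  have hT (F : lattice) : List.In F Fs -> atoms_typed (types_at ks) F by case/hFs.
  move=> /(sat3_atom_typed finF hT hL)[_ [/mapP[a + ->] pr ab]].
  rewrite mem_filter => /andP[ak aT]; exists a.1, a; split=> //.
  by rewrite mem_filter ak andbT; apply/asboolP.
have hC : has_card (@Ct L) (Some (size (spectrum_state ks').2)).
  apply: (coatoms_spectrum gen finL ks'_lt ks'_pr) => s.
  have hT (F : lattice) : List.In F (map dual_lattice Fs) -> atoms_typed (cotypes_at ks) F.
    by move=> h; have [F' [-> /hFs[]]] := In_map_inv h.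
  have finF' (F : lattice) : List.In F (map dual_lattice Fs) -> listable F.
    by move=> h; have [F' [-> /finF]] := In_map_inv h; exact: listable_dual.
  move=> /(sat3_atom_typed finF' hT (sat3_dual hL))[_ [/mapP[a + ->] pr ab]].
  rewrite mem_filter => /andP[ak aT]; exists a.1, a; split=> //.
  rewrite mem_filter ak andbT; apply/asboolP.
  have [F [d hr]] := real (ks_lt _ ak); exact/(present_dual e hr).
exists (spectrum_state ks'); split=> //; first exact: reachableP.
  by rewrite spectrum_stateE; exact: reachableP.
rewrite lt0n; apply/negP => /eqP h0; rewrite h0 in hA.
have [|a ha] := atom_exists finL ne.
  exists (ev e bottom_term) => w; have [t <-] := gen w.
  exact: (bottom_termP (evle e)).
by move: hA; rewrite /has_card II0 card_eq0 => /eqP h; rewrite h in ha.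
Qed.

(** The lattice is the one generated in the product of the pointed lattices with
    indices in [ks]. Each of its atoms is nonzero in one of the coordinates, so
    these pointed lattices and their quotients account for all types. *)
Theorem spectrum_lower (X : lattice_class) (ks : seq nat) : is_variety X ->
  (forall k, k \in ks -> (k < size Ps)%N) ->
  (forall k, k \in ks -> exists (F : lattice) (d : gen3 -> F),
     [/\ X F, controlled (iota 0 (size Ps)) F & realizes (pt k) d]) ->
  (forall u v, u <> v -> exists2 k, k \in ks & at3 (pt k).2 u <> at3 (pt k).2 v) ->
  exists L, [/\ X L, three_generated L, has_card (@At L) (Some (size (spectrum_state ks).1))
    & has_card (@Ct L) (Some (size (spectrum_state ks).2))].
Proof.
move=> hX ks_lt hks dist.
have /choice[f hf] (i : 'I_(size ks)) : exists f : {F : lattice & gen3 -> F},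
     [/\ X (projT1 f), controlled (iota 0 (size Ps)) (projT1 f)
       & realizes (pt (nth 0%N ks i)) (projT2 f)].
  by have [|F [d hd]] := hks (nth 0%N ks i); [exact: mem_nth|exists (existT _ F d)].
pose A i := projT1 (f i); pose d i : gen3 -> A i := projT2 (f i).
pose R := lcap (fun i => evle (d i)); pose L : lattice := quot R; pose e : gen3 -> L := qvar R.
have gen y : exists s, ev e s = y by exact: qvar_gen.
have ksi k : k \in ks -> exists i : 'I_(size ks), nth 0%N ks i = k.
  by move=> hk; exists (Ordinal (etrans (index_mem k ks) hk)); rewrite /= nth_index.
have RP s t : evle e s t <-> forall i, evle (d i) s t by exact: qvarP.
pose Fs := [seq A i | i <- enum 'I_(size ks)].
have FsP (F : lattice) : List.In F Fs -> exists i, F = A i.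
  by move=> h; have [i [-> _]] := In_map_inv h; exists i.
have inFs i : List.In (A i) Fs by apply: In_map; apply/In_mem; rewrite mem_enum.
have HL (Y : lattice_class) : is_variety Y -> (forall i, Y (A i)) -> Y L.
  move=> hY YA; apply: (variety_HSP hY (fun _ h => h)).
  by apply: (@HSP_eval _ _ _ e 'I_(size ks) A d) => // s t h; exact/RP.
have XL : X L by apply: HL => // i; have [] := hf i.
have finL : listable L.
  apply: (@sat3_listable Fs L e) => // [F /FsP[i ->]|]; first by have [_ []] := hf i.
  by apply: HL; [exact: sat3_variety|move=> i; apply: gen_sub_sat3 (inFs i) _ (gen_id _)].
have ks_pr k : k \in ks -> present (evle e) (pt k).
  move=> /ksi[i <-] s t /RP/(_ i) h; have [_ _ hr] := hf i.
  by rewrite (realizes_ple _ _ hr).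
have split_at s z : ~ evle e s z -> exists i, ~ evle (d i) s z.
  by move=> h; apply: contrapT => hn; apply: h; apply/RP => i; apply: contrapT => hi; apply: hn; exists i.
have distinct u v : u <> v -> e u <> e v.
  move=> /dist[k /ksi[i <-] neq] euv; have [_ _ [c [cP hc]]] := hf i; apply: neq.
  rewrite !hc; congr c.
  have h1 : evle e (Var u) (Var v) by rewrite /= euv.
  have h2 : evle e (Var v) (Var u) by rewrite /= euv.
  by apply: le_anti; move/RP/(_ i): h1 => /= ->; move/RP/(_ i): h2.
exists L; split=> //.
- by apply: (generated_three _ _ _ gen); apply: distinct.
- apply: (atoms_spectrum gen finL ks_lt ks_pr) => s [z [zP /split_at[i nsz] atm]].
  have [_ [_ hT _] hr] := hf i.
  have [||a [/mapP[a0 + ->] pr ab]] := hT (d i) (evle (d i)) _ s => //.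
    exists z; split=> // u; first by have /RP := zP u.
    by have [/RP h|/RP h] := atm u; [left|right].
  rewrite mem_filter => /andP[_ aT]; exists (nth 0%N ks i), a0; split=> //; first exact: mem_nth.
  by move=> u v; rewrite (realizes_ple _ _ hr); exact: pr.
- apply: (coatoms_spectrum gen finL ks_lt ks_pr) => s [z [zP nsz atm]].
  pose e' : gen3 -> dual_lattice L := e.
  have RP' u v : evle e' u v <-> forall i, evle (d i : gen3 -> dual_lattice (A i)) u v.
    rewrite /= !ev_dual; split=> [/RP h i|h]; first by rewrite !ev_dual; exact: h.
    by apply/RP => i; have := h i; rewrite !ev_dual.
  have [i nsz'] : exists i, ~ evle (d i : gen3 -> dual_lattice (A i)) s z.
    apply: contrapT => hn; apply: nsz; apply/RP' => i; apply: contrapT => hi.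
    by apply: hn; exists i.
  have [_ [_ _ hT] hr] := hf i.
  have [||a [/mapP[a0 + ->] pr ab]] := hT (d i) (evle (d i : gen3 -> dual_lattice (A i))) _ s => //.
    exists z; split=> // u; first by have /RP' := zP u.
    by have [/RP' h|/RP' h] := atm u; [left|right].
  rewrite mem_filter => /andP[ak aT]; exists (nth 0%N ks i), a0; split=> //; first exact: mem_nth.
  have ak' : (a0.1 < size Ps)%N by move: ak; rewrite mem_iota.
  have [F [d' hr']] := real ak'.
  move=> u v; rewrite (realizes_ple _ _ hr); apply: (present_dual (d i) hr').1.
  exact: pr.
Qed.
End Spectrum.

(** * The spectra of the varieties of the theorem *)

(** The subdirectly irreducible three-generated lattices other than [N5] in the
    varieties generated by the explicit lattices, with their generating triples up
    to isomorphism. *)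
Definition all_points : seq pointed :=
  two_points ++ M3_points ++ L1_points ++ L2_points ++ L3_points ++ L4_points ++
  L5_points ++ V6_points ++ V7_points.

Definition all_tables : tables := Eval vm_compute in compute_tables all_points.

Lemma all_tables_ok : tables_ok all_points all_tables.
Proof. by vm_compute. Qed.

Local Notation pt := (nth no_point all_points).
Local Notation all_controlled := (controlled all_points all_tables).
Local Notation all_types := (types_at all_points all_tables).
Local Notation all_cotypes := (cotypes_at all_points all_tables).

(* Positions in [all_points]. *)
Definition two_ix : seq nat := iota 0 6.
Definition base_ix : seq nat := iota 0 7.
Definition L1_ix : seq nat := base_ix ++ iota 7 3.
Definition L2_ix : seq nat := base_ix ++ iota 10 3.
Definition L3_ix : seq nat := base_ix ++ iota 13 6.
Definition L4_ix : seq nat := base_ix ++ iota 19 3.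
Definition L5_ix : seq nat := base_ix ++ iota 22 3.
Definition V6_ix : seq nat := base_ix ++ iota 25 3.
Definition V7_ix : seq nat := base_ix ++ iota 28 3.

Definition points_in (M : model) (ks : seq nat) : bool :=
  all (fun k => let P := pt k in (P.1 == M) &&
    [&& P.2.1.1 < msize M, P.2.1.2 < msize M & P.2.2 < msize M]%N) ks.

Lemma points_realized (F : lattice) M ks : coded F M -> points_in M ks ->
  forall k, k \in ks -> exists d : gen3 -> F, realizes (pt k) d.
Proof.
move=> cF /allP h k /h/andP[/eqP eM hp]; rewrite -eM in cF hp.
by case: (pt k) cF hp => M' p; exact: coded_realizes.
Qed.

Lemma controlled_check (F : lattice) M ks : coded F M ->
  atom_check (all_types ks) M -> atom_check (all_cotypes ks) (mdual M) -> all_controlled ks F.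
Proof.
move=> cF h1 h2; split; first exact: coded_listable cF.
  exact: atom_checkP cF h1.
exact: atom_checkP (coded_dual cF) h2.
Qed.

Lemma controlled_Two : all_controlled base_ix Two.
Proof. by apply: (controlled_check coded_Two); vm_compute. Qed.
Lemma controlled_M3 : all_controlled base_ix M3.
Proof. by apply: (controlled_check coded_M3); vm_compute. Qed.
Lemma controlled_V1 : all_controlled base_ix V1.
Proof. by apply: (controlled_check coded_V1); vm_compute. Qed.
Lemma controlled_V2 : all_controlled base_ix V2.
Proof. by apply: (controlled_check coded_V2); vm_compute. Qed.
Lemma controlled_V3 : all_controlled base_ix V3.
Proof. by apply: (controlled_check coded_V3); vm_compute. Qed.
Lemma controlled_V4 : all_controlled base_ix V4.
Proof. by apply: (controlled_check coded_V4); vm_compute. Qed.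
Lemma controlled_V5 : all_controlled base_ix V5.
Proof. by apply: (controlled_check coded_V5); vm_compute. Qed.
Lemma controlled_V8 : all_controlled base_ix V8.
Proof. by apply: (controlled_check coded_V8); vm_compute. Qed.
Lemma controlled_L1 : all_controlled L1_ix L1.
Proof. by apply: (controlled_check coded_L1); vm_compute. Qed.
Lemma controlled_L2 : all_controlled L2_ix L2.
Proof. by apply: (controlled_check coded_L2); vm_compute. Qed.
Lemma controlled_L3 : all_controlled L3_ix L3.
Proof. by apply: (controlled_check coded_L3); vm_compute. Qed.
Lemma controlled_L4 : all_controlled L4_ix L4.
Proof. by apply: (controlled_check coded_L4); vm_compute. Qed.
Lemma controlled_L5 : all_controlled L5_ix L5.
Proof. by apply: (controlled_check coded_L5); vm_compute. Qed.
Lemma controlled_V6 : all_controlled V6_ix V6.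
Proof. by apply: (controlled_check coded_V6); vm_compute. Qed.
Lemma controlled_V7 : all_controlled V7_ix V7.
Proof. by apply: (controlled_check coded_V7); vm_compute. Qed.



(* The types of [T] occur in [T'], possibly on other pointed lattices, as happens
   for a two-element chain and its dual. *)
Definition types_convert (T T' : seq ptype) : bool :=
  all (fun a => has (fun b => let l := pair_entries a.1 b.1 in
    [&& pair_ok a.1 b.1 l, implied_on l a.1 b.1 &
        all (fun x => if mle a.1.1 a.2 x.1.1 then mle b.1.1 b.2 x.1.2 else true) l]) T') T.

Lemma atoms_typed_convert T T' (F : lattice) :
  types_convert T T' -> atoms_typed T F -> atoms_typed T' F.
Proof.
move=> /allP h hF d R dR s /(hF d R dR)[a [/h/hasP[b bT /and3P[lok imp /allP le]] pr ab]].
exists b; split=> // [u v huv|].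
  exact: (implied_onP lok).1 imp _ _ (pr _ _ huv).
have [h1 _] := pair_okP lok; have /mapP[x xl hx] := h1 s.
by have := le x xl; rewrite -hx /=; move: ab; rewrite /above => ->.
Qed.

Section CoverControlled.
Variable K : 'I_10 -> lattice.
Hypothesis hK : jonsson_rival_rest K.

Lemma controlled_cover k : all_controlled two_ix (K k).
Proof.
split; first exact: cover_listable.
  by apply: (atoms_typed_convert _ (@cover_atoms K hK k)); vm_compute.
by apply: (atoms_typed_convert _ (@cover_coatoms K hK k)); vm_compute.
Qed.

Definition base_lattices : seq lattice :=
  [:: M3; V1; V2; V3; V4; V5; V8] ++ [seq K k | k <- enum 'I_10].

Lemma controlled_base F : List.In F base_lattices -> all_controlled base_ix F.
Proof.
rewrite /base_lattices => /In_cat[|h].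
  move=> [<-|[<-|[<-|[<-|[<-|[<-|[<-|//]]]]]]].
  - exact: controlled_M3.
  - exact: controlled_V1.
  - exact: controlled_V2.
  - exact: controlled_V3.
  - exact: controlled_V4.
  - exact: controlled_V5.
  - exact: controlled_V8.
have [k [-> _]] := In_map_inv h; apply: controlled_sub (controlled_cover k).
by apply/allP; vm_compute.
Qed.

Lemma genm_sat3 Fs F : List.In M3 Fs -> List.In F Fs -> subclass (genm F) (sat3 Fs).
Proof.
move=> hM hF; apply: vjoin_min; first exact: sat3_variety.
  exact: gen_sub_sat3.
exact: modular_sub_sat3.
Qed.

Lemma varB_sat3 Fs : (forall F, List.In F base_lattices -> List.In F Fs) ->
  subclass (varB K) (sat3 Fs).
Proof.
move=> hFs; have vS := @sat3_variety Fs.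
have hM : List.In M3 Fs by apply: hFs; left.
have hV F : List.In F [:: V1; V2; V3; V4; V5; V8] -> subclass (genm F) (sat3 Fs).
  by move=> h; apply: genm_sat3 => //; apply: hFs; apply/In_cat; left; right.
have J Y Z : subclass Y (sat3 Fs) -> subclass Z (sat3 Fs) -> subclass (vjoin Y Z) (sat3 Fs).
  exact: vjoin_min.
rewrite /varB; apply: (J _ _).
  apply: (J _ _) => [|L h]; first by apply: hV; rewrite /=; tauto.
  apply: (h _ vS) => k; apply: genm_sat3 => //; apply: hFs; apply/In_cat; right.
  by apply: In_map; apply/In_mem; rewrite mem_enum.
by do 4 (apply: (J _ _); last by apply: hV; rewrite /=; tauto); apply: hV; left.
Qed.

End CoverControlled.

Lemma modular_coded F M : coded F M ->
  mvalid M (Meet (Join (Meet (Var G0) (Var G2)) (Var G1)) (Var G2))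
  (Join (Meet (Var G0) (Var G2)) (Meet (Var G1) (Var G2))) -> modular F.
Proof.
move=> cF hv x y z xz; apply: le_anti; apply/andP; split; first by lat 1.
by have := (mvalidP _ _ cF).1 hv (mk3 x y z); rewrite /= (meet_l xz).
Qed.

Definition all_ix : seq nat := iota 0 (size all_points).

Definition available (X : lattice_class) (ks : seq nat) : Prop :=
  forall k, k \in ks -> exists (F : lattice) (d : gen3 -> F),
    [/\ X F, all_controlled all_ix F & realizes (pt k) d].

Lemma available_points (X : lattice_class) (F : lattice) M ks0 ks : coded F M -> X F ->
  all_controlled ks0 F -> {subset ks0 <= all_ix} -> points_in M ks -> available X ks.
Proof.
move=> cF XF hF hks hk k /(points_realized cF hk)[d hd]; exists F, d; split=> //.
exact: controlled_sub hF.
Qed.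

Lemma available_cat X ks ks' : available X ks -> available X ks' -> available X (ks ++ ks').
Proof. by move=> h h' k; rewrite mem_cat => /orP[/h|/h']. Qed.

Ltac indices := by [apply/allP; vm_compute | vm_compute].

Lemma available_base (X : lattice_class) : subclass modular X -> available X base_ix.
Proof.
move=> hX; rewrite (_ : base_ix = iota 0 6 ++ [:: 6]%N) //; apply: available_cat.
  apply: (available_points coded_Two _ controlled_Two); [|indices..].
  by apply: hX; apply: (modular_coded coded_Two); vm_compute.
by apply: (available_points coded_M3 _ controlled_M3); [exact: hX M3_modular|indices..].
Qed.

Lemma available_L1 (X : lattice_class) : X L1 -> available X (iota 7 3).
Proof. by move=> h; apply: (available_points coded_L1 h controlled_L1); indices. Qed.
Lemma available_L2 (X : lattice_class) : X L2 -> available X (iota 10 3).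
Proof. by move=> h; apply: (available_points coded_L2 h controlled_L2); indices. Qed.
Lemma available_L3 (X : lattice_class) : X L3 -> available X (iota 13 6).
Proof. by move=> h; apply: (available_points coded_L3 h controlled_L3); indices. Qed.
Lemma available_L4 (X : lattice_class) : X L4 -> available X (iota 19 3).
Proof. by move=> h; apply: (available_points coded_L4 h controlled_L4); indices. Qed.
Lemma available_L5 (X : lattice_class) : X L5 -> available X (iota 22 3).
Proof. by move=> h; apply: (available_points coded_L5 h controlled_L5); indices. Qed.
Lemma available_V6 (X : lattice_class) : X V6 -> available X (iota 25 3).
Proof. by move=> h; apply: (available_points coded_V6 h controlled_V6); indices. Qed.
Lemma available_V7 (X : lattice_class) : X V7 -> available X (iota 28 3).
Proof. by move=> h; apply: (available_points coded_V7 h controlled_V7); indices. Qed.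

Lemma all_realized k : (k < size all_points)%N ->
  exists (F : lattice) (d : gen3 -> F), realizes (pt k) d.
Proof.
move=> hk; have : available (fun=> True) (base_ix ++ iota 7 3 ++ iota 10 3 ++ iota 13 6 ++
    iota 19 3 ++ iota 22 3 ++ iota 25 3 ++ iota 28 3).
  apply: available_cat; first exact: available_base.
  apply: available_cat; first exact: available_L1.
  apply: available_cat; first exact: available_L2.
  apply: available_cat; first exact: available_L3.
  apply: available_cat; first exact: available_L4.
  apply: available_cat; first exact: available_L5.
  by apply: available_cat; [exact: available_V6|exact: available_V7].
have -> : base_ix ++ iota 7 3 ++ iota 10 3 ++ iota 13 6 ++ iota 19 3 ++ iota 22 3 ++
    iota 25 3 ++ iota 28 3 = iota 0 (size all_points) by vm_compute.
by move=> /(_ k); rewrite mem_iota hk => /(_ isT)[F [d [_ _ hd]]]; exists F, d.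
Qed.

Definition state (ks : seq nat) : nat * nat :=
  let st := spectrum_state all_tables ks in (size st.1, size st.2).

Definition states (ks : seq nat) : seq (nat * nat) :=
  [seq (size st.1, size st.2) | st <- spectrum_states all_tables ks].

Definition sizes (ks : seq nat) : seq nat := [seq size A | A <- atom_states all_tables ks].

(* The three generators of the product are distinct. *)
Definition separating (ks : seq nat) : bool :=
  all (fun uv => has (fun k => at3 (pt k).2 uv.1 != at3 (pt k).2 uv.2) ks)
    [seq (u, v) | u <- gens3, v <- [seq v <- gens3 | ~~ eq3 u v]].

Definition buildable (av ks : seq nat) : bool := separating ks && all (fun k => k \in av) ks.

Lemma build_lattice (X : lattice_class) av ks : is_variety X -> available X av ->
  all (fun k => k \in all_ix) av -> buildable av ks ->
  exists L, [/\ X L, three_generated L, has_card (@At L) (Some (state ks).1)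
    & has_card (@Ct L) (Some (state ks).2)].
Proof.
move=> hX hav /allP hall /andP[/allP sep /allP hks].
apply: (spectrum_lower all_tables_ok all_realized hX).
- by move=> k /hks/hall; rewrite mem_iota.
- by move=> k /hks; exact: hav.
- move=> u v nuv; have /sep/hasP[k hk /eqP h] : (u, v) \in
      [seq (u, v) | u <- gens3, v <- [seq v <- gens3 | ~~ eq3 u v]].
    apply/allpairsPdep; exists u, v; split=> //; first by case: u {nuv}.
    by rewrite mem_filter; case: u v nuv => -[].
  by exists k.
Qed.

Section Spectra.
Variables (X : lattice_class) (Fs : seq lattice) (ks av : seq nat) (exs : seq (seq nat)).
Hypotheses (vX : is_variety X) (XFs : subclass X (sat3 Fs)).
Hypothesis hFs : forall F : lattice, List.In F Fs -> all_controlled ks F.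
Hypothesis hav : available X av.
Hypothesis hix : all (fun k => k \in all_ix) ks && all (fun k => k \in all_ix) av.
Hypothesis hexs : all (buildable av) exs.

Lemma states_upper (L : lattice) : X L -> three_generated L ->
  exists p, [/\ p \in states ks, p.1 \in sizes ks, (0 < p.1)%N, has_card (@At L) (Some p.1)
              & has_card (@Ct L) (Some p.2)].
Proof.
move=> XL gL; have /andP[/allP hks _] := hix.
have ks_lt k : k \in ks -> (k < size all_points)%N by move/hks; rewrite mem_iota.
have [st [hst hat h0 hA hC]] := spectrum_upper all_tables_ok all_realized ks_lt hFs (XFs XL) gL.
by exists (size st.1, size st.2); split=> //; [apply/mapP; exists st|exact: map_f].
Qed.

Lemma states_lower w : w \in exs ->
  exists L, [/\ X L, three_generated L, has_card (@At L) (Some (state w).1)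
    & has_card (@Ct L) (Some (state w).2)].
Proof.
move=> hw; have /andP[_ h] := hix; apply: (build_lattice vX hav h).
by have /allP := hexs; apply.
Qed.

Lemma DS_eq (delta : seq (nat * nat)) :
  all (fun p => (p.1 == 0%N) || (p \in delta)) (states ks) ->
  all (fun p => p \in map state exs) delta -> DS X = spec2 delta.
Proof.
move=> /allP hup /allP hlow; apply: funext => -[m n]; apply: propext; split.
  move=> [L [XL gL hm hn]]; have [[a b] [hp hs h0 ha hb]] := states_upper XL gL.
  have := hup _ hp; rewrite eqn0Ngt h0 /= => hd.
  move: hm hn => /= /(has_card_inj ha) -> /(has_card_inj hb) ->.
  by exists (a, b).
move=> [p /= /hlow/mapP[w hw ->] [<- <-]].
by have [L [h1 h2 h3 h4]] := states_lower hw; exists L.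
Qed.

Lemma AS_eq (ns : seq nat) :
  all (fun n => (n == 0%N) || (n \in ns)) (sizes ks) ->
  all (fun n => n \in map (fun w => (state w).1) exs) ns -> AS X = spec1 ns.
Proof.
move=> /allP hup /allP hlow; apply: funext => c; apply: propext; split.
  move=> [L [XL gL hc]]; have [[a b] [hp hs h0 ha hb]] := states_upper XL gL.
  have := hup _ hs; rewrite eqn0Ngt h0 /= => hd.
  by exists a => //; rewrite (has_card_inj ha hc).
move=> [n /= /hlow/mapP[w hw ->] <-].
by have [L [h1 h2 h3 h4]] := states_lower hw; exists L.
Qed.

End Spectra.

(* Sets of pointed lattices whose subdirect products realize the pairs of
   [delta3], ..., found by exhaustive search. *)
Definition exs3 : seq (seq nat) :=
  [:: [:: 6]; [:: 0; 1]; [:: 0; 2]; [:: 0; 6]; [:: 2; 6]; [:: 0; 1; 2]; [:: 0; 2; 4]]%N.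
Definition exs_L3 : seq (seq nat) :=
  exs3 ++ [:: [:: 6; 13; 15]; [:: 6; 13; 18]; [:: 0; 6; 14; 17]; [:: 2; 6; 17; 18]]%N.
Definition exs_L4 : seq (seq nat) := exs3 ++ [:: [:: 19; 20]; [:: 0; 20; 21]; [:: 19; 20; 21]]%N.
Definition exs_L5 : seq (seq nat) := exs3 ++ [:: [:: 22; 23]; [:: 2; 22; 23]; [:: 22; 23; 24]]%N.

Lemma controlled_cons (Fs : seq lattice) ks F : all_controlled ks F ->
  (forall G, List.In G Fs -> all_controlled ks G) -> forall G, List.In G (F :: Fs) -> all_controlled ks G.
Proof. by move=> hF hFs G [<-|/hFs]. Qed.

Section Main.
Variable K : 'I_10 -> lattice.
Hypothesis hK : jonsson_rival_rest K.

Lemma controlled_base_sub ks : {subset base_ix <= ks} ->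
  forall F, List.In F (base_lattices K) -> all_controlled ks F.
Proof. by move=> h F /(controlled_base hK); exact: controlled_sub. Qed.

Lemma genm_cases S X Y : vinterval (genm S) Y X ->
  [/\ is_variety X, subclass X Y, X S & subclass modular X].
Proof.
move=> [vX h1 h2]; split=> //.
  by apply: h1; apply: sub_vjoinl; exact: gen_id.
by move=> L hL; apply: h1; apply: sub_vjoinr.
Qed.

Lemma DS_base X : vinterval (genm N5) (varB K) X -> DS X = spec2 delta3.
Proof.
move=> /genm_cases[vX XB _ mX].
apply: (@DS_eq X (base_lattices K) base_ix base_ix exs3).
- exact: vX.
- by move=> L /XB; exact: varB_sat3.
- exact: controlled_base_sub.
- exact: available_base.
- by vm_compute.
- by vm_compute.
- by vm_compute.
- by vm_compute.
Qed.

(** One generator [S] besides those of [varB]; the pointed lattices of [S] are at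
    the positions [ks']. *)
Lemma DS_one S ks ks' exs delta X :
  all_controlled ks S -> ks = base_ix ++ ks' -> (X S -> available X ks') ->
  all (fun k => k \in all_ix) ks ->
  all (buildable ks) exs ->
  all (fun p => (p.1 == 0%N) || (p \in delta)) (states ks) ->
  all (fun p => p \in map state exs) delta ->
  vinterval (genm S) (vjoin (genm S) (varB K)) X -> DS X = spec2 delta.
Proof.
move=> hS ksE hav hix hexs hup hlow /genm_cases[vX XB XS mX].
have incl F : List.In F (base_lattices K) -> List.In F (S :: base_lattices K) by right.
apply: (@DS_eq X (S :: base_lattices K) ks ks exs) => //.
- move=> L /XB; apply: vjoin_min; first exact: sat3_variety.
    by apply: genm_sat3; [apply: incl; left|left].
  exact: varB_sat3.
- apply: controlled_cons => //; apply: controlled_base_sub => k hk.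
  by rewrite ksE mem_cat hk.
- by rewrite ksE; apply: available_cat; [exact: available_base|exact: hav].
- by rewrite hix.
Qed.

Lemma AS_many Gs ks av exs ns X : is_variety X -> subclass X (sat3 (Gs ++ base_lattices K)) ->
  (forall F, List.In F Gs -> all_controlled ks F) -> {subset base_ix <= ks} ->
  available X av -> all (fun k => k \in all_ix) ks && all (fun k => k \in all_ix) av ->
  all (buildable av) exs ->
  all (fun n => (n == 0%N) || (n \in ns)) (sizes ks) ->
  all (fun n => n \in map (fun w => (state w).1) exs) ns -> AS X = spec1 ns.
Proof.
move=> vX XFs hG hb hav hix hexs hup hlow.
apply: (@AS_eq X (Gs ++ base_lattices K) ks av exs) => //.
by move=> F /In_cat[/hG //|]; exact: controlled_base_sub.
Qed.

Lemma sat3_join Fs Y Z : subclass Y (sat3 Fs) -> subclass Z (sat3 Fs) -> subclass (vjoin Y Z) (sat3 Fs).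
Proof. by move=> h1 h2; apply: vjoin_min h1 h2; exact: sat3_variety. Qed.

Ltac sub_sat3 :=
  first [ apply: sat3_join; sub_sat3
        | by apply: varB_sat3 => F hF; apply/In_cat; right
        | by apply: genm_sat3; apply/In_cat; [right; left|left; rewrite /=; tauto] ].

Ltac widen := first
  [ by apply: controlled_sub controlled_L1; indices | by apply: controlled_sub controlled_L2; indices
  | by apply: controlled_sub controlled_L3; indices | by apply: controlled_sub controlled_L4; indices
  | by apply: controlled_sub controlled_L5; indices | by apply: controlled_sub controlled_V6; indices
  | by apply: controlled_sub controlled_V7; indices ].

Lemma AS_color3 X : color3 K X -> AS X = spec1 [:: 1; 2; 3].
Proof.
move=> /genm_cases[vX XB _ mX].
apply: (@AS_many [:: L1; L5; V6; L2; V7] (base_ix ++ iota 7 6 ++ iota 22 9) base_ix exs3 _ X vX).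
- by move=> L /XB; rewrite /H3m /varB'; sub_sat3.
- by do 5 (apply: controlled_cons; first by widen).
- by indices.
- exact: available_base.
- by vm_compute.
- by vm_compute.
- by vm_compute.
- by vm_compute.
Qed.

Lemma AS_color4 X : color4 K X -> AS X = spec1 [:: 1; 2; 3; 4].
Proof.
move=> /genm_cases[vX XB XL3 mX].
apply: (@AS_many [:: L1; L5; V6; L2; V7; L3] (base_ix ++ iota 7 12 ++ iota 22 9) L3_ix exs_L3 _ X vX).
- by move=> L /XB; rewrite /H3m /varB'; sub_sat3.
- by do 6 (apply: controlled_cons; first by widen).
- by indices.
- by apply: available_cat; [exact: available_base|exact: available_L3].
- by vm_compute.
- by vm_compute.
- by vm_compute.
- by vm_compute.
Qed.

Lemma AS_color6 X : color6 K X -> AS X = spec1 [:: 1; 2; 3; 4; 6].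
Proof.
case=> [/genm_cases[vX XB XL4 mX]|[vX h XB]].
  apply: (@AS_many [:: L1; L5; V6; L2; V7; L4] (base_ix ++ iota 7 6 ++ iota 19 12) L4_ix exs_L4 _ X vX).
  - by move=> L /XB; rewrite /H3m /varB'; sub_sat3.
  - by do 6 (apply: controlled_cons; first by widen).
  - by indices.
  - by apply: available_cat; [exact: available_base|exact: available_L4].
  - by vm_compute.
  - by vm_compute.
  - by vm_compute.
  - by vm_compute.
have gX : subclass (genm L4) X by move=> L hL; apply: h; exact: sub_vjoinr.
have mX : subclass modular X by move=> L hL; apply: gX; exact: sub_vjoinr.
have XL4 : X L4 by apply: gX; apply: sub_vjoinl; exact: gen_id.
apply: (@AS_many [:: L1; L5; V6; L2; V7; L3; L4] all_ix L4_ix exs_L4 _ X vX).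
- by move=> L /XB; rewrite /H6m /H3m /varB'; sub_sat3.
- by do 7 (apply: controlled_cons; first by widen).
- by indices.
- by apply: available_cat; [exact: available_base|exact: available_L4].
- by vm_compute.
- by vm_compute.
- by vm_compute.
- by vm_compute.
Qed.

End Main.

Theorem theorem5p1 (K : 'I_10 -> lattice) (hK : jonsson_rival_rest K)
    (X : lattice_class) (hX : B23 K X) :
  ((color3 K X -> AS X = spec1 [:: 1; 2; 3]) /\
   (color4 K X -> AS X = spec1 [:: 1; 2; 3; 4]) /\
   (color6 K X -> AS X = spec1 [:: 1; 2; 3; 4; 6])) /\
  ((vinterval (genm N5) (varB K) X -> DS X = spec2 delta3) /\
   (vinterval (genm V6) (vjoin (genm V6) (varB K)) X \/
    vinterval (genm V7) (vjoin (genm V7) (varB K)) X -> DS X = spec2 delta3) /\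
   (vinterval (genm L1) (vjoin (genm L1) (varB K)) X \/
    vinterval (genm L2) (vjoin (genm L2) (varB K)) X -> DS X = spec2 delta3) /\
   (vinterval (genm L3) (vjoin (genm L3) (varB K)) X -> DS X = spec2 delta4) /\
   (vinterval (genm L4) (vjoin (genm L4) (varB K)) X -> DS X = spec2 delta6) /\
   (vinterval (genm L5) (vjoin (genm L5) (varB K)) X ->
      DS X = spec2 delta6inv)).
Proof.
split; [split; [exact: AS_color3|split; [exact: AS_color4|exact: AS_color6]]|].
split; first exact: DS_base.
split.
  case; [apply: (DS_one hK (exs := exs3) controlled_V6 (erefl V6_ix) (@available_V6 X))
        |apply: (DS_one hK (exs := exs3) controlled_V7 (erefl V7_ix) (@available_V7 X))];
    by vm_compute.
split.
  case; [apply: (DS_one hK (exs := exs3) controlled_L1 (erefl L1_ix) (@available_L1 X))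
        |apply: (DS_one hK (exs := exs3) controlled_L2 (erefl L2_ix) (@available_L2 X))];
    by vm_compute.
split.
  by apply: (DS_one hK (exs := exs_L3) controlled_L3 (erefl L3_ix) (@available_L3 X)); vm_compute.
split.
  by apply: (DS_one hK (exs := exs_L4) controlled_L4 (erefl L4_ix) (@available_L4 X)); vm_compute.
by apply: (DS_one hK (exs := exs_L5) controlled_L5 (erefl L5_ix) (@available_L5 X)); vm_compute.
Qed.
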